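(* Let $c\ge0$, let $M=\Lambda^2_-(T^*\mathcal{S}^4)$ with $\varphi_c$ if $c>0$ and $M_0=M\setminus\mathcal{S}^4$ with $\varphi_0$ if $c=0$, with their coassociative fibrations $\pi_c$ over $\mathbb{R}^3$ with parameters $(u,v,\beta)$. Let $B$ be the $\mathcal{S}^2$-bundle over the $(u,v,\beta)$-space $\mathbb{R}^3$ given by the union of the bolts in the coassociative fibration of $M$ or $M_0$. Let $k_c$ and $\lambda_c$ be the pushforward of $g_c|_B$ and $\varphi_c|_B$ along the $\mathcal{S}^2$ fibres of $B$. Then $\lambda_c$ is an $\mathcal{S}^1$-invariant harmonic 1-form on $\mathbb{R}^3$ with respect to the metric $k_c$; that is, $$d\lambda_c=d*_{k_c}\lambda_c=0.$$ Moreover, (up to a constant multiplicative factor) $|\lambda_c|_{k_c}=a_c$, where $a_c$ is the bolt size $$a_c=\frac{2c\cos^2\alpha+t^2(1+\cos^2\alpha)}{(c+t^2)^{1/2}}.$$ Consequently: (a) if $c>0$, then $\lambda_c$ vanishes precisely on the circle $\mathcal{S}^1_c=\{u=0,\ v=2c^{1/4},\ \beta\in[0,2\pi)\}$; (b) if $c=0$, then $\lambda_0$ only vanishes at the origin.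
   Context: Ambient structure. On the round $\mathcal{S}^4$ of curvature $1$, with local oriented orthonormal coframe $b_0,\dots,b_3$, put $\Omega_1=b_0\wedge b_1-b_2\wedge b_3$, $\Omega_2=b_0\wedge b_2-b_3\wedge b_1$, $\Omega_3=b_0\wedge b_3-b_1\wedge b_2$, let $\rho_i$ be the 1-forms of the induced connection, $d\Omega_1=2\rho_3\wedge\Omega_2-2\rho_2\wedge\Omega_3$, $d\Omega_2=2\rho_1\wedge\Omega_3-2\rho_3\wedge\Omega_1$, $d\Omega_3=2\rho_2\wedge\Omega_1-2\rho_1\wedge\Omega_2$, let $(a_1,a_2,a_3)$ be fibre coordinates with respect to $\Omega_i$, $r^2=\sum a_i^2$, and $\zeta_1=da_1-2a_2\rho_3+2a_3\rho_2$, $\zeta_2=da_2-2a_3\rho_1+2a_1\rho_3$, $\zeta_3=da_3-2a_1\rho_2+2a_2\rho_1$. Then $\varphi_c=(c+r^2)^{-3/4}\zeta_1\wedge\zeta_2\wedge\zeta_3+2(c+r^2)^{1/4}\sum_i\zeta_i\wedge\Omega_i$ and its metric is $g_c=(c+r^2)^{-1/2}(\zeta_1^2+\zeta_2^2+\zeta_3^2)+2(c+r^2)^{1/2}(b_0^2+b_1^2+b_2^2+b_3^2)$. Coordinates. With $\mathbb{R}^5=\mathbb{R}^3\oplus\mathbb{R}^2$, write points of $\mathcal{S}^4$ as $(\cos\alpha\cos\theta,\cos\alpha\sin\theta\cos\phi,\cos\alpha\sin\theta\sin\phi,\sin\alpha\cos\beta,\sin\alpha\sin\beta)$, $\alpha\in[0,\frac\pi2]$,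 with coframe $b_0=d\alpha$, $b_1=\sin\alpha\,d\beta$, $b_2=\cos\alpha\,d\theta$, $b_3=\cos\alpha\sin\theta\,d\phi$, and $a_1=t$, $a_2=s\cos\gamma$, $a_3=s\sin\gamma$, $s\ge0$. Fibration. $\pi_c=(u,v\cos\beta,v\sin\beta)$ with $u=t\cos\alpha$, $v=2(c+s^2+t^2)^{1/4}\sin\alpha$. Its fibres are coassociative (i.e. $\varphi_c$ vanishes on them) and are diffeomorphic to $T^*\mathcal{S}^2$, except over $\mathcal{S}^1_c$ (if $c>0$) or over the origin (if $c=0$), where they are singular. The bolt of a smooth fibre is its zero section $\mathcal{S}^2$, i.e. the locus where $\rho=s\cos\alpha$ vanishes; in the coordinate patch $0<\alpha<\frac\pi2$ this is $s=0$, so there $u=t\cos\alpha$, $v=2(c+t^2)^{1/4}\sin\alpha$. The bolt size is the area of the bolt in the induced metric divided by $4\pi$. Pushforwards. $\lambda_c$ is the 1-form obtained by integrating the 3-form $\varphi_c|_B$ over the $\mathcal{S}^2$ fibres of $B$ (extended by zero over the singular fibres). $k_c$ is the metric on the base obtained by restricting $g_c$, at points of $B$, to the orthogonal complement of the tangent space of the coassociative fibre and identifying this complement with the tangent space of the base via $d\pi_c$. The $\mathcal{S}^1$ action on the base is rotation in $\beta$.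
   Formalization: k_c is undefined over S^1_c (c>0) or the origin (c=0), and for c>0 the bolts cannot be oriented continuously around S^1_c, so λ_c is global only up to sign: harmonicity and S^1-invariance are stated off these, on open sets (near every such point) where the orientation is continuous. *)

(* Defs.v *)
From mathcomp Require Import all_boot all_order all_algebra.
From mathcomp Require Import all_classical all_reals all_analysis.
From mathcomp Require Import ring.
Set Implicit Arguments.
Unset Strict Implicit.
Unset Printing Implicit Defensive.
Import Order.TTheory GRing.Theory Num.Theory.
Import numFieldNormedType.Exports.
Local Open Scope classical_set_scope.
Local Open Scope ring_scope.

Section BryantSalamon.
Variable R : realType.

(* M is realised inside R^5 x Mat_5: a point is a pair (p, A) with p on the
   unit sphere of R^5 and A the antisymmetric matrix of a 2-form on R^5 that
   kills p and restricts to an anti-self-dual 2-form on T_p S^4.  Tangent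
   vectors of M are pairs (p', A') as well. *)
Local Notation amb := ('rV[R]_5 * 'M[R]_5)%type.

Definition vec3 (x y z : R) : 'rV[R]_3 := \row_(j < 3) [:: x; y; z]`_j.
Definition vec5 (x0 x1 x2 x3 x4 : R) : 'rV[R]_5 :=
  \row_(j < 5) [:: x0; x1; x2; x3; x4]`_j.
Definition coord n (v : 'rV[R]_n.+1) (j : nat) : R := v 0 (inord j).
Definition entry (A : 'M[R]_5) (i j : nat) : R := A (inord i) (inord j).
Definition dot n (x y : 'rV[R]_n) : R := (x *m y^T) 0 0.

(* The 2-form <x,.> /\ <y,.>; the value of the 2-form A on (v, w) is
   v *m A *m w^T. *)
Definition wedge2 (x y : 'rV[R]_5) : 'M[R]_5 := x^T *m y - y^T *m x.
Definition eval2 (A : 'M[R]_5) (v w : 'rV[R]_5) : R := (v *m A *m w^T) 0 0.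

(* Inner product on 2-forms for which the Omega_i are orthonormal. *)
Definition ip2 (A A' : 'M[R]_5) : R := \tr (A *m A'^T) / 4.

Definition sph (al be th ph : R) : 'rV[R]_5 :=
  vec5 (cos al * cos th) (cos al * sin th * cos ph) (cos al * sin th * sin ph)
       (sin al * cos be) (sin al * sin be).

(* The rows are the vectors e_k of the orthonormal frame of T_p S^4 dual to
   b_0 = d al, b_1 = sin al d be, b_2 = cos al d th, b_3 = cos al sin th d ph;
   they make sense for all values of the angles, and det (p, e_0, .., e_3) = 1
   throughout. *)
Definition frame (al be th ph : R) : 'M[R]_(4, 5) :=
  \matrix_(k < 4)
    [:: vec5 (- sin al * cos th) (- sin al * sin th * cos ph)
             (- sin al * sin th * sin ph) (cos al * cos be) (cos al * sin be);
        vec5 0 0 0 (- sin be) (cos be);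
        vec5 (- sin th) (cos th * cos ph) (cos th * sin ph) 0 0;
        vec5 0 (- sin ph) (cos ph) 0 0]`_k.

Definition Omega (E : 'M[R]_(4, 5)) (i : 'I_3) : 'M[R]_5 :=
  let e0 := row (inord 0) E in let e1 := row (inord 1) E in
  let e2 := row (inord 2) E in let e3 := row (inord 3) E in
  [:: wedge2 e0 e1 - wedge2 e2 e3;
      wedge2 e0 e2 - wedge2 e3 e1;
      wedge2 e0 e3 - wedge2 e1 e2]`_i.

(* The point of M with fibre coordinates a over sph al be th ph. *)
Definition mpt (al be th ph : R) (a : 'rV[R]_3) : amb :=
  (sph al be th ph, \sum_(i < 3) a 0 i *: Omega (frame al be th ph) i).

(* M if c > 0, and M_0 (zero section removed) if c = 0. *)
Definition M (c : R) : set amb :=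
  [set m | (exists al be th ph a, m = mpt al be th ph a) /\
           (c = 0 -> m.2 != 0)].

Definition tangent (X : set amb) (m w : amb) : Prop :=
  exists g : R -> amb,
    [/\ g 0 = m, (forall s, X (g s)) & is_derive (0 : R) 1 g w].

Definition r2 (m : amb) : R := ip2 m.2 m.2.

(* The 1-forms b_k and zeta_i of a frame E at m, evaluated on a tangent vector
   w.  If A = sum a_i Omega_i along a curve, then sum zeta_i Omega_i is the
   covariant derivative of A for the induced connection,
     zeta_1 = da_1 - 2 a_2 rho_3 + 2 a_3 rho_2, etc., where
     nabla Omega_1 = 2 rho_3 Omega_2 - 2 rho_2 Omega_3, etc.
   As S^4 is embedded in R^5, that covariant derivative is the tangential part
   of A'; the Omega_i being tangential, its Omega_i-component is
   ip2 A' Omega_i. *)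
Definition bform (E : 'M[R]_(4, 5)) (k : 'I_4) (w : amb) : R :=
  dot w.1 (row k E).
Definition zeta (E : 'M[R]_(4, 5)) (i : 'I_3) (w : amb) : R :=
  ip2 w.2 (Omega E i).

Definition vol3 (f : 'I_3 -> amb -> R) (w : 'I_3 -> amb) : R :=
  \det (\matrix_(i, j) f i (w j)).

Definition wedge12 (z : amb -> R) (A : 'M[R]_5) (w0 w1 w2 : amb) : R :=
  z w0 * eval2 A w1.1 w2.1 - z w1 * eval2 A w0.1 w2.1
  + z w2 * eval2 A w0.1 w1.1.

Definition phi (c : R) (E : 'M[R]_(4, 5)) (m w0 w1 w2 : amb) : R :=
  (c + r2 m) `^ (- (3 / 4))
    * vol3 (zeta E) (fun j : 'I_3 => [:: w0; w1; w2]`_j)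
  + 2 * (c + r2 m) `^ (1 / 4)
    * \sum_(i < 3) wedge12 (zeta E i) (Omega E i) w0 w1 w2.

Definition gmet (c : R) (E : 'M[R]_(4, 5)) (m w w' : amb) : R :=
  (c + r2 m) `^ (- (1 / 2)) * (\sum_(i < 3) zeta E i w * zeta E i w')
  + 2 * (c + r2 m) `^ (1 / 2) * (\sum_(k < 4) bform E k w * bform E k w').

(* u = t cos al on M; see [piu_mpt] below.  As sin al e^{i be} = p_3 + i p_4,
   the other two components of pi_c are polynomial in p up to the factor
   2 (c + r^2)^{1/4}. *)
Definition piu (m : amb) : R :=
  - (coord m.1 0 * entry m.2 1 2 + coord m.1 1 * entry m.2 2 0
     + coord m.1 2 * entry m.2 0 1).

Definition pic (c : R) (m : amb) : 'rV[R]_3 :=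
  let f := 2 * (c + r2 m) `^ (1 / 4) in
  vec3 (piu m) (f * coord m.1 3) (f * coord m.1 4).

(* rho = s cos al, with s^2 = r^2 - t^2; see [rho_mpt] below. *)
Definition rho (m : amb) : R :=
  Num.sqrt (r2 m * (coord m.1 0 ^+ 2 + coord m.1 1 ^+ 2 + coord m.1 2 ^+ 2)
            - piu m ^+ 2).

Section Coordinates.
Implicit Types (x y z w : 'rV[R]_5) (A : 'M[R]_5).

Lemma cvec5 (x0 x1 x2 x3 x4 : R) j : (j < 5)%N ->
  coord (vec5 x0 x1 x2 x3 x4) j = [:: x0; x1; x2; x3; x4]`_j.
Proof. by move=> j5; rewrite /coord mxE inordK. Qed.

Lemma row_frame al be th ph k : (k < 4)%N -> row (inord k) (frame al be th ph) =
    [:: vec5 (- sin al * cos th) (- sin al * sin th * cos ph)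
             (- sin al * sin th * sin ph) (cos al * cos be) (cos al * sin be);
        vec5 0 0 0 (- sin be) (cos be);
        vec5 (- sin th) (cos th * cos ph) (cos th * sin ph) 0 0;
        vec5 0 (- sin ph) (cos ph) 0 0]`_k.
Proof. by move=> k4; rewrite rowK inordK. Qed.

Lemma entry_wedge2 x y i j :
  entry (wedge2 x y) i j = coord x i * coord y j - coord y i * coord x j.
Proof. by rewrite /entry /wedge2 !mxE !big_ord1 !mxE. Qed.

Let sum5 (F : 'I_5 -> R) : \sum_i F i =
  F (inord 0) + F (inord 1) + F (inord 2) + F (inord 3) + F (inord 4).
Proof.
rewrite !big_ord_recl big_ord0 addr0 !addrA.
by do !congr (_ + _); congr F; apply/val_inj; rewrite /= inordK.
Qed.
Let sum3 (V : nmodType) (F : 'I_3 -> V) :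
  \sum_i F i = F (inord 0) + F (inord 1) + F (inord 2).
Proof.
rewrite !big_ord_recl big_ord0 addr0 !addrA.
by do !congr (_ + _); congr F; apply/val_inj; rewrite /= inordK.
Qed.
Lemma entryD A A' i j : entry (A + A') i j = entry A i j + entry A' i j.
Proof. by rewrite /entry mxE. Qed.
Lemma entryN A i j : entry (- A) i j = - entry A i j.
Proof. by rewrite /entry mxE. Qed.
Lemma entryZ k A i j : entry (k *: A) i j = k * entry A i j.
Proof. by rewrite /entry mxE. Qed.

Lemma mpt2E al be th ph (a : 'rV[R]_3) : (mpt al be th ph a).2 =
  coord a 0 *: Omega (frame al be th ph) (inord 0) +
  coord a 1 *: Omega (frame al be th ph) (inord 1) +
  coord a 2 *: Omega (frame al be th ph) (inord 2).
Proof. by rewrite /mpt /= sum3. Qed.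

Let simp := (row_frame, entryD, entryN, entryZ, entry_wedge2).


Lemma piu_mpt al be th ph a : piu (mpt al be th ph a) = coord a 0 * cos al.
Proof.
rewrite /piu mpt2E /Omega !inordK // !row_frame // /= !simp !cvec5 //=.
transitivity (coord a 0 * cos al * (cos th ^+ 2 + sin th ^+ 2)
              * (cos ph ^+ 2 + sin ph ^+ 2)); first by ring.
by rewrite !cos2Dsin2 !mulr1.
Qed.

Lemma dot5 x y : dot x y = coord x 0 * coord y 0 + coord x 1 * coord y 1
  + coord x 2 * coord y 2 + coord x 3 * coord y 3 + coord x 4 * coord y 4.
Proof. by rewrite /dot mxE sum5 !mxE. Qed.

Lemma dotC x y : dot x y = dot y x.
Proof. by rewrite !dot5; ring. Qed.

Lemma ip2Dl A1 A2 A : ip2 (A1 + A2) A = ip2 A1 A + ip2 A2 A.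
Proof. by rewrite /ip2 mulmxDl raddfD /= mulrDl. Qed.
Lemma ip2Nl A1 A : ip2 (- A1) A = - ip2 A1 A.
Proof. by rewrite /ip2 mulNmx raddfN /= mulNr. Qed.
Lemma ip2Zl k A1 A : ip2 (k *: A1) A = k * ip2 A1 A.
Proof. by rewrite /ip2 -scalemxAl linearZ /= mulrA. Qed.
Lemma ip2C A A' : ip2 A A' = ip2 A' A.
Proof. by rewrite /ip2 -mxtrace_tr trmx_mul trmxK. Qed.
Lemma ip2Dr A1 A2 A : ip2 A (A1 + A2) = ip2 A A1 + ip2 A A2.
Proof. by rewrite !(ip2C A) ip2Dl. Qed.
Lemma ip2Nr A1 A : ip2 A (- A1) = - ip2 A A1.
Proof. by rewrite !(ip2C A) ip2Nl. Qed.
Lemma ip2Zr k A1 A : ip2 A (k *: A1) = k * ip2 A A1.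
Proof. by rewrite !(ip2C A) ip2Zl. Qed.

Lemma tr_outer x y z w : \tr ((x^T *m y) *m (z^T *m w)^T) = dot y w * dot x z.
Proof.
rewrite trmx_mul trmxK -mulmxA mxtrace_mulC.
have -> : y *m (w^T *m z) *m x^T = (y *m w^T) *m (z *m x^T) by rewrite !mulmxA.
rewrite [z *m _]mx11_scalar [y *m _]mx11_scalar -scalar_mxM mxtrace_scalar.
by rewrite -/(dot z x) -/(dot y w) (dotC z) mulr1n.
Qed.

Lemma ip2_wedge2 x y z w : ip2 (wedge2 x y) (wedge2 z w) =
  (dot x z * dot y w - dot x w * dot y z) / 2.
Proof.
rewrite /ip2 /wedge2 linearB /= mulmxBl !mulmxBr !raddfB /= !tr_outer.
by field.
Qed.

Lemma frame_orthonormal al be th ph (i j : nat) : (i < 4)%N -> (j < 4)%N ->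
  dot (row (inord i) (frame al be th ph)) (row (inord j) (frame al be th ph))
  = (i == j)%:R :> R.
Proof.
have := cos2Dsin2 th; have := cos2Dsin2 ph; have := cos2Dsin2 al.
have := cos2Dsin2 be => hb ha hp ht.
have {}hb : cos be ^+ 2 = 1 - sin be ^+ 2 by rewrite -hb; ring.
have {}ha : cos al ^+ 2 = 1 - sin al ^+ 2 by rewrite -ha; ring.
have {}hp : cos ph ^+ 2 = 1 - sin ph ^+ 2 by rewrite -hp; ring.
have {}ht : cos th ^+ 2 = 1 - sin th ^+ 2 by rewrite -ht; ring.
move=> i4 j4; rewrite !row_frame // dot5.
case: i i4 => [|[|[|[|//]]]] _; case: j j4 => [|[|[|[|//]]]] _;
  rewrite /= !cvec5 //=; ring: hb ha hp ht.
Qed.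

Lemma ip2_Omega al be th ph (i j : nat) : (i < 3)%N -> (j < 3)%N ->
  ip2 (Omega (frame al be th ph) (inord i)) (Omega (frame al be th ph) (inord j))
  = (i == j)%:R :> R.
Proof.
move=> i3 j3; rewrite /Omega !inordK //.
case: i i3 => [|[|[|//]]] _; case: j j3 => [|[|[|//]]] _;
  rewrite /= !(ip2Dl, ip2Nl, ip2Dr, ip2Nr, ip2_wedge2) !frame_orthonormal //=;
  by field.
Qed.

Lemma r2_mpt al be th ph a : r2 (mpt al be th ph a) =
  coord a 0 ^+ 2 + coord a 1 ^+ 2 + coord a 2 ^+ 2.
Proof.
rewrite /r2 mpt2E !(ip2Dl, ip2Zl, ip2Dr, ip2Zr) !ip2_Omega //=; ring.
Qed.

Lemma rho_mpt al be th ph a : rho (mpt al be th ph a) =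
  Num.sqrt (coord a 1 ^+ 2 + coord a 2 ^+ 2) * `|cos al|.
Proof.
rewrite /rho r2_mpt piu_mpt /mpt /sph !cvec5 //=.
rewrite -sqrtr_sqr -sqrtrM ?addr_ge0 ?sqr_ge0 //; congr Num.sqrt.
transitivity ((coord a 0 ^+ 2 + coord a 1 ^+ 2 + coord a 2 ^+ 2) * cos al ^+ 2
  * (cos th ^+ 2 + sin th ^+ 2 * (cos ph ^+ 2 + sin ph ^+ 2))
  - (coord a 0 * cos al) ^+ 2); first by ring.
by rewrite cos2Dsin2 mulr1 cos2Dsin2 mulr1; ring.
Qed.

End Coordinates.

(* Coordinates al, be, th, ph, a = (t, 0, 0) on B.  For fixed (t, al, be) the
   pair (th, ph) runs over the bolt; (t, al) and (- t, pi - al) give the same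
   bolt with opposite orientations. *)
Definition bolt (t al be th ph : R) : amb := mpt al be th ph (vec3 t 0 0).

Definition B (c : R) : set amb := [set m | M c m /\ rho m = 0].

Definition circle (c : R) : set 'rV[R]_3 :=
  [set q | exists be, 0 <= be < 2 * pi /\
     q = vec3 0 (2 * c `^ (1 / 4) * cos be) (2 * c `^ (1 / 4) * sin be)].

(* The points of the base over which pi_c is singular, and the others. *)
Definition sing (c : R) : set 'rV[R]_3 :=
  [set q | (0 < c /\ circle c q) \/ (c = 0 /\ q = 0)].
Definition reg (c : R) : set 'rV[R]_3 := ~` sing c.

(* Kernel of d pi_c on T_m M, i.e. the tangent space of the fibre of pi_c. *)
Definition vertical (c : R) (m w : amb) : Prop :=
  tangent (M c) m w /\ 'D_w (pic c) m = 0.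
Definition horizontal (c : R) (E : 'M[R]_(4, 5)) (m h : amb) : Prop :=
  tangent (M c) m h /\ forall w, vertical c m w -> gmet c E m h w = 0.

(* k q is the Gram matrix of k_c at q in the standard basis of R^3. *)
Definition is_pushforward_metric (c : R) (k : 'rV[R]_3 -> 'M[R]_3) : Prop :=
  forall q, reg c q -> forall t al be th ph,
    let m := bolt t al be th ph in let E := frame al be th ph in
    B c m -> pic c m = q ->
    (forall w, exists! h, horizontal c E m h /\ 'D_h (pic c) m = w) /\
    (forall h h', horizontal c E m h -> horizontal c E m h' ->
       dot ('D_h (pic c) m *m k q) ('D_h' (pic c) m) = gmet c E m h h').

Definition int_sphere (f : R -> R -> R) : R :=
  \int[lebesgue_measure]_(ph in `[0, 2 * pi])
    \int[lebesgue_measure]_(th in `[0, pi]) f th ph.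

(* A choice, for each regular q, of oriented coordinates on the bolt over q.
   The fibre integral of a 3-form depends on that orientation up to sign.  For
   c > 0 the monodromy of the bolts around the circle reverses it, so that no
   choice is continuous over all of reg c. *)
Definition bolt_coords (c : R) (T Al Be : 'rV[R]_3 -> R) : Prop :=
  forall q, reg c q -> 0 <= Al q <= pi /\
    [set bolt (T q) (Al q) (Be q) th ph | th in setT & ph in setT] =
    [set m | B c m /\ pic c m = q].

(* The orientations of the bolts given by d th /\ d ph vary continuously
   over U. *)
Definition coherent (c : R) (T Al : 'rV[R]_3 -> R) (U : set 'rV[R]_3) : Prop :=
  [/\ open U, U `<=` reg c, (forall q, U q -> {for q, continuous T})
    & (forall q, U q -> {for q, continuous Al})].

Definition is_lift (c : R) (s : R -> R -> amb) (w : 'rV[R]_3)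
    (W : R -> R -> amb) : Prop :=
  forall th ph, tangent (B c) (s th ph) (W th ph) /\
    'D_(W th ph) (pic c) (s th ph) = w.

(* lam q is the covector of lambda_c at q. *)
Definition is_pushforward_form (c : R) (T Al Be : 'rV[R]_3 -> R)
    (lam : 'rV[R]_3 -> 'rV[R]_3) : Prop :=
  (forall q, sing c q -> lam q = 0) /\
  forall q, reg c q -> forall w,
    let s := bolt (T q) (Al q) (Be q) in let E := frame (Al q) (Be q) in
    (exists W, is_lift c s w W) /\
    forall W, is_lift c s w W ->
      dot (lam q) w = int_sphere (fun th ph =>
        phi c (E th ph) (s th ph)
          (W th ph) (derive1 (fun r => s r ph) th) (derive1 (s th) ph)).

Definition bolt_size (c t al be : R) : R :=
  let s := bolt t al be in
  int_sphere (fun th ph =>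
    let g := gmet c (frame al be th ph) (s th ph) in
    let v := derive1 (fun r => s r ph) th in let w := derive1 (s th) ph in
    Num.sqrt (g v v * g w w - g v w ^+ 2)) / (4 * pi).

(* Exterior derivatives of a 1-form and of a 2-form on R^3, evaluated on
   constant vector fields. *)
Definition d1 (lam : 'rV[R]_3 -> 'rV[R]_3) (q x y : 'rV[R]_3) : R :=
  'D_x (fun q => dot (lam q) y) q - 'D_y (fun q => dot (lam q) x) q.
Definition d2 (om : 'rV[R]_3 -> 'rV[R]_3 -> 'rV[R]_3 -> R)
    (q x y z : 'rV[R]_3) : R :=
  'D_x (fun q => om q y z) q - 'D_y (fun q => om q x z) q
  + 'D_z (fun q => om q x y) q.

(* * lam is the contraction of the volume form of k with the vector field
   k-dual to lam. *)
Definition hodge (k : 'rV[R]_3 -> 'M[R]_3) (lam : 'rV[R]_3 -> 'rV[R]_3)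
    (q x y : 'rV[R]_3) : R :=
  Num.sqrt (\det (k q)) *
  \det (\matrix_(i < 3) [:: lam q *m invmx (k q); x; y]`_i).

Definition knorm (k : 'rV[R]_3 -> 'M[R]_3) (lam : 'rV[R]_3 -> 'rV[R]_3)
    (q : 'rV[R]_3) : R :=
  Num.sqrt (dot (lam q *m invmx (k q)) (lam q)).

Definition harmonic_on (U : set 'rV[R]_3) (k : 'rV[R]_3 -> 'M[R]_3)
    (lam : 'rV[R]_3 -> 'rV[R]_3) : Prop :=
  forall q, U q ->
  [/\ differentiable lam q, (forall x y, d1 lam q x y = 0),
      (forall x y, differentiable (fun q => hodge k lam q x y) q)
    & (forall x y z, d2 (hodge k lam) q x y z = 0)].

Definition rot (ps : R) (q : 'rV[R]_3) : 'rV[R]_3 :=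
  vec3 (coord q 0) (cos ps * coord q 1 - sin ps * coord q 2)
       (sin ps * coord q 1 + cos ps * coord q 2).
Definition rot_stable (U : set 'rV[R]_3) : Prop :=
  forall ps q, U q -> U (rot ps q).
Definition rot_invariant_on (U : set 'rV[R]_3) (lam : 'rV[R]_3 -> 'rV[R]_3)
    : Prop :=
  forall ps q w, U q -> dot (lam (rot ps q)) (rot ps w) = dot (lam q) w.

End BryantSalamon.

(* Main.v *)
(* M is cut out of R^5 x Mat_5 by |p| = 1 and A = - * (p /\ A), which is
   invariant under rotations of R^5; so tangent vectors of M need only be
   computed over one point of S^4.  On B, the horizontal vectors of pi_c are
   spanned by the directions of t, al and be, in which
     g_c = P^(-1/2) dt^2 + 2 P^(1/2) (dal^2 + b_1^2),          P = c + t^2,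
     lambda_c / 4 pi = - 2 P^(1/4) cos al du + t / (2 P^(1/4)) v dv,
     * lambda_c / 4 pi = dH /\ dbe,   H = - 2 t^2 sin^2 al cos al + 4 c / 3 cos^3 al.
   In Cartesian coordinates (u, q_1, q_2) of the base neither al = 0 nor
   al = pi / 2 is singular if one works with (t, cos al) and v^2 in place of
   (t, al) and v: the map (t, C) |-> (t C, 4 P^(1/2) (1 - C^2)) = (u, v^2) has
   Jacobian - 4 P^(-1/2) N, where N = 2 P C^2 + t^2 (1 - C^2) vanishes only over
   the singular points.  Closedness of lambda_c and of * lambda_c then follows from
   the derivatives of t and C, and |lambda_c| = 4 pi N / P^(1/2) is 4 pi times
   the bolt size. *)
Require Import Defs.
From mathcomp Require Import all_boot all_order all_algebra.
From mathcomp Require Import all_classical all_reals all_analysis.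
From mathcomp Require Import ring lra.
Import Order.TTheory GRing.Theory Num.Theory.
Import numFieldNormedType.Exports.
Local Open Scope classical_set_scope.
Local Open Scope ring_scope.
Set Implicit Arguments.
Unset Strict Implicit.
Unset Printing Implicit Defensive.

(* Both names are also used in MathComp. *)
Local Notation coord := Defs.coord.
Local Notation rot := Defs.rot.

(** * Derivatives of scalar, matrix and pair valued functions *)

(** The coordinates t and cos al are given only implicitly by q, and [coherent] asks no more of them
    than continuity. What q determines without ambiguity is s = (c + t^2)^(1/2), the unique
    admissible root of an equation monotone in s; t and cos al follow from it up to a common sign.
    Continuity of s comes from the monotonicity. Differentiability of t and cos al follows from
    continuity alone: the exact increments of u and v^2 are linear in those of t and cos al, with
    coefficients continuous at q, so Cramer's rule yields the difference quotients. The common sign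
    is the orientation of the bolt. For c > 0 it has no continuous choice over [reg c], hence the
    two charts t > 0 and cos al > 0, which together cover [reg c]; for c = 0 the first one is
    global. Tangent vectors are velocities of arbitrary curves in M, so two arguments are needed:
    differentiating the equations of M bounds the tangent space from above, while explicit curves,
    which must avoid A = 0 when c = 0, produce the directions that are used. *)

Lemma is_derive_ext (R : realType) (V W : normedModType R) (x v : V) (f g : V -> W) d :
  f =1 g -> is_derive x v f d -> is_derive x v g d.
Proof. by move=> /funext ->. Qed.

Lemma is_derive_unique (R : realType) (V W : normedModType R) (x v : V) (f : V -> W) d d' :
  is_derive x v f d -> is_derive x v f d' -> d = d'.
Proof. by move=> [_ <-] [_ <-]. Qed.

Section Derivatives.
Context {R : realType} {V : normedModType R}.
Implicit Types (f g : V -> R) (x v : V) (a b : R).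

Lemma derD x v f g a b : is_derive x v f a -> is_derive x v g b ->
  is_derive x v (fun y => f y + g y) (a + b).
Proof. by move=> hf hg; apply: is_deriveD. Qed.

Lemma derN x v f a : is_derive x v f a -> is_derive x v (fun y => - f y) (- a).
Proof. by move=> hf; apply: is_deriveN. Qed.

Lemma derB x v f g a b : is_derive x v f a -> is_derive x v g b ->
  is_derive x v (fun y => f y - g y) (a - b).
Proof. by move=> hf hg; apply: is_deriveB. Qed.

Lemma derM x v f g a b : is_derive x v f a -> is_derive x v g b ->
  is_derive x v (fun y => f y * g y) (a * g x + f x * b).
Proof.
move=> hf hg; apply: (is_derive_eq (@is_deriveM _ _ f g x v a b hf hg)).
by rewrite /GRing.scale /=; ring.
Qed.

Lemma derX x v f a n : is_derive x v f a ->
  is_derive x v (fun y => f y ^+ n.+1) (n.+1%:R * f x ^+ n * a).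
Proof.
move=> hf; elim: n => [|n ih].
  by apply: is_derive_ext (is_derive_eq hf _) => [y|]; rewrite ?expr1 ?expr0 ?mulr1 ?mul1r.
apply: (@is_derive_ext _ _ _ _ _ (fun y => f y * f y ^+ n.+1)) => [y|].
  by rewrite [RHS]exprS.
apply: (is_derive_eq (derM hf ih)).
by rewrite -[n.+2%:R]natr1 !exprS; ring.
Qed.

Lemma derC x v a : is_derive x v (fun=> a) 0.
Proof. exact: is_derive_cst. Qed.

(** Along v, [g] may be replaced by its restriction h |-> g (h v + x) to a line, which turns the
    claim into the one-variable chain rule. *)
Lemma der_comp x v (f : R -> R) g a b : is_derive (g x) 1 f a ->
  is_derive x v g b -> is_derive x v (fun y => f (g y)) (a * b).
Proof.
move=> [hf hfa] [hg hgb].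
have hg' : is_derive (0 : R) 1 (fun h : R => g (h *: v + x)) b.
  apply: DeriveDef; first exact: (derivable1P g x v).1.
  by rewrite -hgb /derive; under eq_fun do
    rewrite /= scale0r add0r addr0 [_%:A]mulr1.
have hf' : is_derive (g (0 *: v + x)) 1 f a by rewrite scale0r add0r; split.
have := is_derive1_comp (f := f) (g := fun h : R => g (h *: v + x)) hf' hg'.
move=> [h1 h2]; apply: DeriveDef; first exact: (derivable1P (fun y => f (g y)) x v).2.
rewrite -h2 /derive; under [in RHS]eq_fun do
    rewrite /= scale0r add0r addr0 [_%:A]mulr1.
by [].
Qed.

Lemma derV x v f a : f x != 0 -> is_derive x v f a ->
  is_derive x v (fun y => (f y)^-1) (- (f x) ^- 2 * a).
Proof.
move=> fx [h1 h2]; split; first exact: derivableV.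
by rewrite deriveV // h2 /GRing.scale /=.
Qed.

Lemma is_derive_mx m n (F : V -> 'M[R]_(m, n)) x v (D : 'M[R]_(m, n)) :
  (forall i j, is_derive x v (fun y => F y i j) (D i j)) <->
  is_derive x v F D.
Proof.
split=> [h|[h1 h2] i j].
  have hd : derivable F x v by apply/derivable_mxP => i j; have [] := h i j.
  split=> //; rewrite derive_mx //; apply/matrixP => i j; rewrite mxE.
  by have [] := h i j.
split; first by move/derivable_mxP: h1; apply.
by rewrite -h2 derive_mx // mxE.
Qed.

End Derivatives.

Section Pairs.
Context {R : realType} {V V1 V2 : normedModType R}.

Lemma is_derive_pair (f : V -> V1 * V2) x v d :
  is_derive x v (fun y => (f y).1) d.1 /\ is_derive x v (fun y => (f y).2) d.2
  <-> is_derive x v f d.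
Proof.
have q : (fun h => h^-1 *: ((f \o shift x) (h *: v) - f x)) =
    (fun h => (h^-1 *: (((fun y => (f y).1) \o shift x) (h *: v) - (f x).1),
               h^-1 *: (((fun y => (f y).2) \o shift x) (h *: v) - (f x).2))).
  by apply/funext => h; rewrite [LHS]surjective_pairing.
split=> [[[h1 e1] [h2 e2]]|[h e]].
  suff h : (fun h => h^-1 *: ((f \o shift x) (h *: v) - f x)) @ 0^' --> d.
    by split; [apply/cvg_ex; exists d | apply/cvg_lim].
  rewrite q [d]surjective_pairing; apply: cvg_pair => /=.
  - by rewrite -e1; exact: h1.
  - by rewrite -e2; exact: h2.
have {}h : (fun h => h^-1 *: ((f \o shift x) (h *: v) - f x)) @ 0^' --> d.
  by rewrite -e.
split.
- have h1 : (fun h => (h^-1 *: ((f \o shift x) (h *: v) - f x)).1) @ 0^' --> d.1.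
    by apply: (cvg_comp _ fst h); exact: cvg_fst.
  by split; [apply/cvg_ex; exists d.1 | apply/cvg_lim].
- have h1 : (fun h => (h^-1 *: ((f \o shift x) (h *: v) - f x)).2) @ 0^' --> d.2.
    by apply: (cvg_comp _ snd h); exact: cvg_snd.
  by split; [apply/cvg_ex; exists d.2 | apply/cvg_lim].
Qed.

End Pairs.

(** * Rotations of R^5 and anti-self-duality *)

Section MatrixLists.
Context {R : realType}.
Implicit Types (p : 'rV[R]_5) (A : 'M[R]_5) (s t : seq (seq R)).

Lemma sum5E (F : 'I_5 -> R) : \sum_i F i =
  F (inord 0) + F (inord 1) + F (inord 2) + F (inord 3) + F (inord 4).
Proof.
rewrite !big_ord_recl big_ord0 addr0 !addrA.
by do !congr (_ + _); congr F; apply/val_inj; rewrite /= inordK.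
Qed.

Lemma sum3E (V : nmodType) (F : 'I_3 -> V) :
  \sum_i F i = F (inord 0) + F (inord 1) + F (inord 2).
Proof.
rewrite !big_ord_recl big_ord0 addr0 !addrA.
by do !congr (_ + _); congr F; apply/val_inj; rewrite /= inordK.
Qed.

Lemma sum4E (V : nmodType) (F : 'I_4 -> V) :
  \sum_i F i = F (inord 0) + F (inord 1) + F (inord 2) + F (inord 3).
Proof.
rewrite !big_ord_recl big_ord0 addr0 !addrA.
by do !congr (_ + _); congr F; apply/val_inj; rewrite /= inordK.
Qed.

(** Rows are kept as lists, so that products and transposes compute to lists again and matrix
    identities reduce to scalar goals for [ring]. *)
Definition mx5 (s : seq (seq R)) : 'M[R]_5 := \matrix_(i, j) nth 0 (nth [::] s i) j.

Lemma entry_mx5 s i j : (i < 5)%N -> (j < 5)%N -> entry (mx5 s) i j = nth 0 (nth [::] s i) j.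
Proof. by move=> i5 j5; rewrite /entry mxE !inordK. Qed.

Lemma coordM p A j : coord (p *m A) j =
  coord p 0 * entry A 0 j + coord p 1 * entry A 1 j + coord p 2 * entry A 2 j
  + coord p 3 * entry A 3 j + coord p 4 * entry A 4 j.
Proof. by rewrite /coord mxE sum5E. Qed.

Lemma entryM A A' i j : entry (A *m A') i j =
  entry A i 0 * entry A' 0 j + entry A i 1 * entry A' 1 j
  + entry A i 2 * entry A' 2 j + entry A i 3 * entry A' 3 j
  + entry A i 4 * entry A' 4 j.
Proof. by rewrite /entry mxE sum5E. Qed.

Lemma entryT A i j : entry A^T i j = entry A j i.
Proof. by rewrite /entry mxE. Qed.

Lemma mx5P A A' : (forall i j, (i < 5)%N -> (j < 5)%N ->
  entry A i j = entry A' i j) <-> A = A'.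
Proof.
split=> [h|-> //]; apply/matrixP => i j.
by have := h i j (ltn_ord i) (ltn_ord j); rewrite /entry !inord_val.
Qed.

Lemma vec5P p p' : (forall i, (i < 5)%N -> coord p i = coord p' i) <-> p = p'.
Proof.
split=> [h|-> //]; apply/matrixP => i j; rewrite (ord1 i).
by have := h j (ltn_ord j); rewrite /coord !inord_val.
Qed.

Lemma vec5_coord p :
  p = vec5 (coord p 0) (coord p 1) (coord p 2) (coord p 3) (coord p 4).
Proof.
by apply/vec5P => -[|[|[|[|[|//]]]]] _; rewrite cvec5.
Qed.

Definition nth5 (s : seq (seq R)) i j := nth 0 (nth [::] s i) j.

End MatrixLists.

Ltac congr_mx5 := congr (mx5
  [:: [:: _; _; _; _; _]; [:: _; _; _; _; _]; [:: _; _; _; _; _];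
      [:: _; _; _; _; _]; [:: _; _; _; _; _]]).

Section Matrices.
Context {R : realType}.
Implicit Types (p : 'rV[R]_5) (A : 'M[R]_5) (s t : seq (seq R)).

Lemma mx5M s t : mx5 s *m mx5 t = mx5 (mkseq (fun i => mkseq (fun j =>
  nth5 s i 0 * nth5 t 0 j + nth5 s i 1 * nth5 t 1 j + nth5 s i 2 * nth5 t 2 j
  + nth5 s i 3 * nth5 t 3 j + nth5 s i 4 * nth5 t 4 j) 5) 5).
Proof.
by apply/mx5P => i j i5 j5; rewrite entryM !entry_mx5 // !nth_mkseq.
Qed.

Lemma mx5T s : (mx5 s)^T = mx5 (mkseq (fun i => mkseq (nth5 s ^~ i) 5) 5).
Proof. by apply/mx5P => i j i5 j5; rewrite entryT !entry_mx5 // !nth_mkseq. Qed.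

Definition asym5 a01 a02 a03 a04 a12 a13 a14 a23 a24 a34 : 'M[R]_5 := mx5
  [:: [:: 0; a01; a02; a03; a04]; [:: - a01; 0; a12; a13; a14];
      [:: - a02; - a12; 0; a23; a24]; [:: - a03; - a13; - a23; 0; a34];
      [:: - a04; - a14; - a24; - a34; 0]].

Lemma asym5P A : A^T = - A ->
  A = asym5 (entry A 0 1) (entry A 0 2) (entry A 0 3) (entry A 0 4)
    (entry A 1 2) (entry A 1 3) (entry A 1 4) (entry A 2 3) (entry A 2 4)
    (entry A 3 4).
Proof.
move=> /mx5P h.
have {}h i j : (i < 5)%N -> (j < 5)%N -> entry A i j = - entry A j i.
  by move=> i5 j5; rewrite -entryT h // entryN.
have h0 i : (i < 5)%N -> entry A i i = 0.
  by move=> i5; have := h i i i5 i5; lra.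
apply/mx5P => i j i5 j5; rewrite entry_mx5 //.
case: i i5 => [|[|[|[|[|//]]]]] i5; case: j j5 => [|[|[|[|[|//]]]]] j5 //=;
  by [rewrite h0|rewrite h].
Qed.

Lemma asym5_tr a01 a02 a03 a04 a12 a13 a14 a23 a24 a34 :
  (asym5 a01 a02 a03 a04 a12 a13 a14 a23 a24 a34)^T =
  - asym5 a01 a02 a03 a04 a12 a13 a14 a23 a24 a34.
Proof.
apply/mx5P => i j i5 j5; rewrite entryT entryN !entry_mx5 //.
by case: i i5 => [|[|[|[|[|//]]]]] _; case: j j5 => [|[|[|[|[|//]]]]] _ //=;
  rewrite ?oppr0 ?opprK.
Qed.

(* The Hodge dual in R^5 of the 3-form p /\ A. *)
Definition star p A : 'M[R]_5 :=
  let s k l m := coord p k * entry A l m + coord p l * entry A m k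
                 + coord p m * entry A k l in
  asym5 (s 2 3 4)%N (s 3 1 4)%N (s 1 2 4)%N (s 2 1 3)%N (s 0 3 4)%N (s 2 0 4)%N
        (s 0 2 3)%N (s 0 1 4)%N (s 1 0 3)%N (s 0 1 2)%N.

(** These four families suffice to reach every frame of the coordinates, see [frameQ], so invariance
    is checked only on them. *)
Definition rot01 (x : R) := mx5
  [:: [:: cos x; sin x; 0; 0; 0]; [:: - sin x; cos x; 0; 0; 0];
      [:: 0; 0; 1; 0; 0]; [:: 0; 0; 0; 1; 0]; [:: 0; 0; 0; 0; 1]].
Definition rot12 (x : R) := mx5
  [:: [:: 1; 0; 0; 0; 0]; [:: 0; cos x; sin x; 0; 0];
      [:: 0; - sin x; cos x; 0; 0]; [:: 0; 0; 0; 1; 0]; [:: 0; 0; 0; 0; 1]].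
Definition rot34 (x : R) := mx5
  [:: [:: 1; 0; 0; 0; 0]; [:: 0; 1; 0; 0; 0]; [:: 0; 0; 1; 0; 0];
      [:: 0; 0; 0; cos x; sin x]; [:: 0; 0; 0; - sin x; cos x]].
Definition rot03 (x : R) := mx5
  [:: [:: cos x; 0; 0; sin x; 0]; [:: 0; 1; 0; 0; 0]; [:: 0; 0; 1; 0; 0];
      [:: - sin x; 0; 0; cos x; 0]; [:: 0; 0; 0; 0; 1]].

Lemma cos2E (x : R) : cos x ^+ 2 = 1 - sin x ^+ 2.
Proof. by rewrite -(cos2Dsin2 x); ring. Qed.

Lemma star_asym5 (p0 p1 p2 p3 p4 a01 a02 a03 a04 a12 a13 a14 a23 a24 a34 : R) :
  star (vec5 p0 p1 p2 p3 p4) (asym5 a01 a02 a03 a04 a12 a13 a14 a23 a24 a34) =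
  asym5 (p2 * a34 - p3 * a24 + p4 * a23) (- p1 * a34 + p3 * a14 - p4 * a13)
    (p1 * a24 - p2 * a14 + p4 * a12) (- p1 * a23 + p2 * a13 - p3 * a12)
    (p0 * a34 - p3 * a04 + p4 * a03) (- p0 * a24 + p2 * a04 - p4 * a02)
    (p0 * a23 - p2 * a03 + p3 * a02) (p0 * a14 - p1 * a04 + p4 * a01)
    (- p0 * a13 + p1 * a03 - p3 * a01) (p0 * a12 - p1 * a02 + p2 * a01).
Proof. by rewrite /star !cvec5 // !entry_mx5 //=; congr asym5; ring. Qed.

Ltac conj_rot x :=
  rewrite mx5T !mx5M /mkseq /nth5 /= /asym5; congr_mx5; ring: (cos2E x).

Lemma conj_rot01 (x a01 a02 a03 a04 a12 a13 a14 a23 a24 a34 : R) :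
  let c := cos x in let s := sin x in
  (rot01 x)^T *m asym5 a01 a02 a03 a04 a12 a13 a14 a23 a24 a34 *m rot01 x =
  asym5 a01 (c * a02 - s * a12) (c * a03 - s * a13) (c * a04 - s * a14)
    (s * a02 + c * a12) (s * a03 + c * a13) (s * a04 + c * a14)
    a23 a24 a34.
Proof. conj_rot x. Qed.

Lemma conj_rot12 (x a01 a02 a03 a04 a12 a13 a14 a23 a24 a34 : R) :
  let c := cos x in let s := sin x in
  (rot12 x)^T *m asym5 a01 a02 a03 a04 a12 a13 a14 a23 a24 a34 *m rot12 x =
  asym5 (c * a01 - s * a02) (s * a01 + c * a02) a03 a04
    a12 (c * a13 - s * a23) (c * a14 - s * a24)
    (s * a13 + c * a23) (s * a14 + c * a24) a34.
Proof. conj_rot x. Qed.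

Lemma conj_rot34 (x a01 a02 a03 a04 a12 a13 a14 a23 a24 a34 : R) :
  let c := cos x in let s := sin x in
  (rot34 x)^T *m asym5 a01 a02 a03 a04 a12 a13 a14 a23 a24 a34 *m rot34 x =
  asym5 a01 a02 (c * a03 - s * a04) (s * a03 + c * a04)
    a12 (c * a13 - s * a14) (s * a13 + c * a14)
    (c * a23 - s * a24) (s * a23 + c * a24) a34.
Proof. conj_rot x. Qed.

Lemma conj_rot03 (x a01 a02 a03 a04 a12 a13 a14 a23 a24 a34 : R) :
  let c := cos x in let s := sin x in
  (rot03 x)^T *m asym5 a01 a02 a03 a04 a12 a13 a14 a23 a24 a34 *m rot03 x =
  asym5 (c * a01 + s * a13) (c * a02 + s * a23) a03 (c * a04 - s * a34)
    a12 (- s * a01 + c * a13) a14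
    (- s * a02 + c * a23) a24 (s * a04 + c * a34).
Proof. conj_rot x. Qed.

Lemma mx5_1 : 1%:M = @mx5 R [:: [:: 1; 0; 0; 0; 0]; [:: 0; 1; 0; 0; 0];
  [:: 0; 0; 1; 0; 0]; [:: 0; 0; 0; 1; 0]; [:: 0; 0; 0; 0; 1]].
Proof.
apply/mx5P => i j i5 j5; rewrite entry_mx5 // /entry !mxE -val_eqE /= !inordK //.
by case: i i5 => [|[|[|[|[|//]]]]] _; case: j j5 => [|[|[|[|[|//]]]]] _.
Qed.

Lemma vec5M (x0 x1 x2 x3 x4 : R) s : vec5 x0 x1 x2 x3 x4 *m mx5 s =
  let f j := x0 * nth5 s 0 j + x1 * nth5 s 1 j + x2 * nth5 s 2 j
             + x3 * nth5 s 3 j + x4 * nth5 s 4 j in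
  vec5 (f 0) (f 1) (f 2) (f 3) (f 4).
Proof.
by apply/vec5P => j j5; rewrite coordM !cvec5 // !entry_mx5 //;
  case: j j5 => [|[|[|[|[|]]]]].
Qed.

(** Equivariance of the Hodge star. An orthogonal Q of determinant - 1 would introduce a sign, so
    the property is verified on rotations rather than deduced from orthogonality. *)
Definition star_invariant (Q : 'M[R]_5) := forall p A, A^T = - A ->
  star (p *m Q) (Q^T *m A *m Q) = Q^T *m star p A *m Q.

Lemma star_invariant_asym (Q : 'M[R]_5) :
  (forall x0 x1 x2 x3 x4 a01 a02 a03 a04 a12 a13 a14 a23 a24 a34 : R,
    star (vec5 x0 x1 x2 x3 x4 *m Q)
      (Q^T *m asym5 a01 a02 a03 a04 a12 a13 a14 a23 a24 a34 *m Q) =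
    Q^T *m star (vec5 x0 x1 x2 x3 x4)
      (asym5 a01 a02 a03 a04 a12 a13 a14 a23 a24 a34) *m Q) ->
  star_invariant Q.
Proof. by move=> h p A /asym5P ->; rewrite (vec5_coord p); exact: h. Qed.

Ltac star_rot x conj := apply: star_invariant_asym; intros;
  rewrite conj vec5M /nth5 /= !star_asym5 conj; congr asym5; ring: (cos2E x).

Lemma star_rot01 (x : R) : star_invariant (rot01 x).
Proof. star_rot x conj_rot01. Qed.

Lemma star_rot12 (x : R) : star_invariant (rot12 x).
Proof. star_rot x conj_rot12. Qed.

Lemma star_rot34 (x : R) : star_invariant (rot34 x).
Proof. star_rot x conj_rot34. Qed.

Lemma star_rot03 (x : R) : star_invariant (rot03 x).
Proof. star_rot x conj_rot03. Qed.

Ltac orthogonal_rot x := rewrite mx5T mx5M mx5_1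
  /mkseq /nth5 /=; congr_mx5; ring: (cos2E x).

(** Inverses stay in the same family, so closure of M under each family covers inverse rotations as
    well. *)
Lemma rot01N (x : R) : rot01 (- x) = (rot01 x)^T.
Proof. by rewrite /rot01 cosN sinN mx5T /mkseq /nth5 /= opprK. Qed.

Lemma rot01K (x : R) : rot01 x *m (rot01 x)^T = 1%:M.
Proof. orthogonal_rot x. Qed.

Lemma rot12N (x : R) : rot12 (- x) = (rot12 x)^T.
Proof. by rewrite /rot12 cosN sinN mx5T /mkseq /nth5 /= opprK. Qed.

Lemma rot12K (x : R) : rot12 x *m (rot12 x)^T = 1%:M.
Proof. orthogonal_rot x. Qed.

Lemma rot34N (x : R) : rot34 (- x) = (rot34 x)^T.
Proof. by rewrite /rot34 cosN sinN mx5T /mkseq /nth5 /= opprK. Qed.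

Lemma rot34K (x : R) : rot34 x *m (rot34 x)^T = 1%:M.
Proof. orthogonal_rot x. Qed.

Lemma rot03N (x : R) : rot03 (- x) = (rot03 x)^T.
Proof. by rewrite /rot03 cosN sinN mx5T /mkseq /nth5 /= opprK. Qed.

Lemma rot03K (x : R) : rot03 x *m (rot03 x)^T = 1%:M.
Proof. orthogonal_rot x. Qed.

End Matrices.

(** * Moving points, frames and tangent vectors by rotations *)

Section Geometry.
Context {R : realType}.
Implicit Types (p x y : 'rV[R]_5) (A Q : 'M[R]_5).
Local Notation amb := ('rV[R]_5 * 'M[R]_5)%type.

Lemma vec5D (x0 x1 x2 x3 x4 y0 y1 y2 y3 y4 : R) :
  vec5 x0 x1 x2 x3 x4 + vec5 y0 y1 y2 y3 y4 =
  vec5 (x0 + y0) (x1 + y1) (x2 + y2) (x3 + y3) (x4 + y4).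
Proof.
by apply/rowP => j; rewrite !mxE; case: j => -[|[|[|[|[|]]]]].
Qed.

Lemma vec5Z k (x0 x1 x2 x3 x4 : R) : k *: vec5 x0 x1 x2 x3 x4 =
  vec5 (k * x0) (k * x1) (k * x2) (k * x3) (k * x4).
Proof.
by apply/rowP => j; rewrite !mxE; case: j => -[|[|[|[|[|]]]]].
Qed.

Lemma asym5D (a01 a02 a03 a04 a12 a13 a14 a23 a24 a34
              b01 b02 b03 b04 b12 b13 b14 b23 b24 b34 : R) :
  asym5 a01 a02 a03 a04 a12 a13 a14 a23 a24 a34
  + asym5 b01 b02 b03 b04 b12 b13 b14 b23 b24 b34 =
  asym5 (a01 + b01) (a02 + b02) (a03 + b03) (a04 + b04) (a12 + b12)
    (a13 + b13) (a14 + b14) (a23 + b23) (a24 + b24) (a34 + b34).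
Proof.
apply/matrixP => i j; rewrite !mxE.
by case: i => -[|[|[|[|[|]]]]] //= _; case: j => -[|[|[|[|[|]]]]] //= _;
  rewrite ?opprD ?addr0.
Qed.

Lemma asym5Z k (a01 a02 a03 a04 a12 a13 a14 a23 a24 a34 : R) :
  k *: asym5 a01 a02 a03 a04 a12 a13 a14 a23 a24 a34 =
  asym5 (k * a01) (k * a02) (k * a03) (k * a04) (k * a12)
    (k * a13) (k * a14) (k * a23) (k * a24) (k * a34).
Proof.
apply/matrixP => i j; rewrite !mxE.
by case: i => -[|[|[|[|[|]]]]] //= _; case: j => -[|[|[|[|[|]]]]] //= _;
  rewrite ?mulrN ?mulr0.
Qed.

Lemma asym5N (a01 a02 a03 a04 a12 a13 a14 a23 a24 a34 : R) :
  - asym5 a01 a02 a03 a04 a12 a13 a14 a23 a24 a34 =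
  asym5 (- a01) (- a02) (- a03) (- a04) (- a12)
    (- a13) (- a14) (- a23) (- a24) (- a34).
Proof. by rewrite -scaleN1r asym5Z !mulN1r. Qed.

Lemma wedge2_vec5 (x0 x1 x2 x3 x4 y0 y1 y2 y3 y4 : R) :
  wedge2 (vec5 x0 x1 x2 x3 x4) (vec5 y0 y1 y2 y3 y4) =
  asym5 (x0 * y1 - y0 * x1) (x0 * y2 - y0 * x2) (x0 * y3 - y0 * x3)
    (x0 * y4 - y0 * x4) (x1 * y2 - y1 * x2) (x1 * y3 - y1 * x3)
    (x1 * y4 - y1 * x4) (x2 * y3 - y2 * x3) (x2 * y4 - y2 * x4)
    (x3 * y4 - y3 * x4).
Proof.
apply/matrixP => i j; rewrite !mxE !big_ord1 !mxE.
by case: i => -[|[|[|[|[|]]]]] //= _; case: j => -[|[|[|[|[|]]]]] //= _; ring.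
Qed.

(** For orthogonal Q the 2-form is carried along with the point: the new form takes on (v Q, w Q)
    the value of the old one on (v, w). *)
Definition act Q (m : amb) : amb := (m.1 *m Q, Q^T *m m.2 *m Q).

Lemma actM Q Q' m : act Q' (act Q m) = act (Q *m Q') m.
Proof. by rewrite /act /= trmx_mul !mulmxA. Qed.

Lemma act1 m : act 1%:M m = m.
Proof. by case: m => p A; rewrite /act /= trmx1 mul1mx !mulmx1. Qed.

Lemma dot_act Q x y : Q *m Q^T = 1%:M -> dot (x *m Q) (y *m Q) = dot x y.
Proof. by move=> h; rewrite /dot trmx_mul mulmxA -(mulmxA x) h mulmx1. Qed.

Lemma ip2_act Q A A' : Q *m Q^T = 1%:M ->
  ip2 (Q^T *m A *m Q) (Q^T *m A' *m Q) = ip2 A A'.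
Proof.
move=> h; rewrite /ip2 !trmx_mul trmxK; congr (_ / _).
rewrite -!mulmxA mxtrace_mulC -!mulmxA h mulmx1 (mulmxA Q) h mul1mx.
by [].
Qed.

Lemma wedge2_act Q x y : wedge2 (x *m Q) (y *m Q) = Q^T *m wedge2 x y *m Q.
Proof. by rewrite /wedge2 mulmxBr mulmxBl !trmx_mul !mulmxA. Qed.

Lemma Omega_act Q (E : 'M[R]_(4, 5)) i :
  Omega (E *m Q) i = Q^T *m Omega E i *m Q.
Proof.
rewrite /Omega !row_mul !wedge2_act.
case: i => -[|[|[|]]] //= _; rewrite ?mulmxBr ?mulmxBl; by [].
Qed.

Lemma bform_act Q E k (w : amb) : Q *m Q^T = 1%:M ->
  bform (E *m Q) k (act Q w) = bform E k w.
Proof. by move=> h; rewrite /bform row_mul dot_act. Qed.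

Lemma zeta_act Q E i (w : amb) : Q *m Q^T = 1%:M ->
  zeta (E *m Q) i (act Q w) = zeta E i w.
Proof. by move=> h; rewrite /zeta Omega_act ip2_act. Qed.

(* The orthogonal matrix with rows p, e_2, e_3, e_0, e_1. *)
Definition frameQ (al be th ph : R) : 'M[R]_5 :=
  rot03 al *m rot01 th *m rot12 ph *m rot34 be.

Lemma frameQK al be th ph : frameQ al be th ph *m (frameQ al be th ph)^T = 1%:M.
Proof.
rewrite /frameQ !trmx_mul !mulmxA -(mulmxA _ (rot34 _)) rot34K mulmx1.
rewrite -(mulmxA _ (rot12 _)) rot12K mulmx1 -(mulmxA _ (rot01 _)) rot01K mulmx1.
by rewrite rot03K.
Qed.

Lemma frameQE al be th ph :
  let ca := cos al in let sa := sin al in let cb := cos be in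
  let sb := sin be in let ct := cos th in let st := sin th in
  let cp := cos ph in let sp := sin ph in
  frameQ al be th ph = mx5
   [:: [:: ca * ct; ca * st * cp; ca * st * sp; sa * cb; sa * sb];
       [:: - st; ct * cp; ct * sp; 0; 0]; [:: 0; - sp; cp; 0; 0];
       [:: - sa * ct; - sa * st * cp; - sa * st * sp; ca * cb; ca * sb];
       [:: 0; 0; 0; - sb; cb]].
Proof.
move=> ca sa cb sb ct st cp sp.
have e1 : rot03 al *m rot01 th = mx5
   [:: [:: ca * ct; ca * st; 0; sa; 0]; [:: - st; ct; 0; 0; 0];
       [:: 0; 0; 1; 0; 0]; [:: - sa * ct; - sa * st; 0; ca; 0];
       [:: 0; 0; 0; 0; 1]].
  by rewrite mx5M /mkseq /nth5 /= /ca /sa /cb /sb /ct /st /cp /sp; congr_mx5; ring.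
have e2 : rot12 ph *m rot34 be = mx5
   [:: [:: 1; 0; 0; 0; 0]; [:: 0; cp; sp; 0; 0]; [:: 0; - sp; cp; 0; 0];
       [:: 0; 0; 0; cb; sb]; [:: 0; 0; 0; - sb; cb]].
  by rewrite mx5M /mkseq /nth5 /= /ca /sa /cb /sb /ct /st /cp /sp; congr_mx5; ring.
by rewrite /frameQ -mulmxA e1 e2 mx5M /mkseq /nth5 /=; congr_mx5; ring.
Qed.

Lemma sph_act al be th ph : sph al be th ph = vec5 1 0 0 0 0 *m frameQ al be th ph.
Proof. by rewrite frameQE vec5M /nth5 /=; congr vec5; ring. Qed.

Lemma frame_act al be th ph : frame al be th ph = frame 0 0 0 0 *m frameQ al be th ph.
Proof.
apply/row_matrixP => k; rewrite row_mul !rowK sin0 cos0 frameQE.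
by case: k => -[|[|[|[|]]]] //= _; rewrite vec5M /nth5 /=; congr vec5; ring.
Qed.

(** The fibre coordinates a are unchanged, so computations over a general point of S^4 reduce to the
    pole (1, 0, 0, 0, 0). *)
Lemma mpt_act al be th ph (a : 'rV[R]_3) :
  mpt al be th ph a = act (frameQ al be th ph) (mpt 0 0 0 0 a).
Proof.
rewrite /mpt /act /= sph_act; congr pair.
  by congr (_ *m _); rewrite /sph sin0 cos0; congr vec5; ring.
rewrite mulmx_sumr mulmx_suml; apply: eq_bigr => i _.
by rewrite frame_act Omega_act -scalemxAr -scalemxAl.
Qed.

(** The tangent vector of M at [bolt t al be th ph] on which the coframe takes the values b_k and
    z_i. The summand with factor t is the normal part of A': since p A = 0 along M, p A' = - p' A
    with A = t Omega_1. *)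
Definition vect (al be th ph t b0 b1 b2 b3 z1 z2 z3 : R) : amb :=
  let E := frame al be th ph in
  let p := sph al be th ph in
  let e0 := row (inord 0) E in let e1 := row (inord 1) E in
  let e2 := row (inord 2) E in let e3 := row (inord 3) E in
  (b0 *: e0 + b1 *: e1 + b2 *: e2 + b3 *: e3,
   z1 *: Omega E (inord 0) + z2 *: Omega E (inord 1) + z3 *: Omega E (inord 2)
   + t *: (- b0 *: wedge2 p e1 + b1 *: wedge2 p e0
           + b2 *: wedge2 p e3 - b3 *: wedge2 p e2)).

Lemma vect_act al be th ph t b0 b1 b2 b3 z1 z2 z3 :
  vect al be th ph t b0 b1 b2 b3 z1 z2 z3 =
  act (frameQ al be th ph) (vect 0 0 0 0 t b0 b1 b2 b3 z1 z2 z3).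
Proof.
have sph0 : sph 0 0 0 0 = vec5 1 0 0 0 0 :> 'rV[R]_5.
  by rewrite /sph sin0 cos0; congr vec5; ring.
rewrite /vect /act /= sph_act frame_act !row_mul sph0 !Omega_act !wedge2_act.
set Q := frameQ _ _ _ _.
have fD X Y : Q^T *m (X + Y) *m Q = Q^T *m X *m Q + Q^T *m Y *m Q.
  by rewrite mulmxDr mulmxDl.
have fZ k X : Q^T *m (k *: X) *m Q = k *: (Q^T *m X *m Q).
  by rewrite -scalemxAr -scalemxAl.
have fN X : Q^T *m (- X) *m Q = - (Q^T *m X *m Q).
  by rewrite mulmxN mulNmx.
by rewrite !(fD, fZ, fN) !mulmxDl -!scalemxAl.
Qed.

End Geometry.

(** * Computations at the pole and the equations of M *)

Section Model.
Context {R : realType}.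
Local Notation amb := ('rV[R]_5 * 'M[R]_5)%type.

Lemma vec3E (x y z : R) j : (j < 3)%N -> coord (vec3 x y z) j = [:: x; y; z]`_j.
Proof. by move=> j3; rewrite /coord mxE inordK. Qed.

Lemma vec3_coord (q : 'rV[R]_3) : q = vec3 (coord q 0) (coord q 1) (coord q 2).
Proof.
apply/rowP => j; rewrite mxE /coord.
by case: j => -[|[|[|//]]] j3 /=; congr (q _ _); apply: val_inj; rewrite /= inordK.
Qed.

Lemma sph0 : sph 0 0 0 0 = vec5 1 0 0 0 0 :> 'rV[R]_5.
Proof. by rewrite /sph sin0 cos0; congr vec5; ring. Qed.

Lemma frame0 k : (k < 4)%N -> row (inord k) (frame 0 0 0 0) =
  nth 0 [:: vec5 0 0 0 1 0; vec5 0 0 0 0 1; vec5 0 1 0 0 0; vec5 0 0 1 0 0] k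
  :> 'rV[R]_5.
Proof.
move=> k4; rewrite row_frame // sin0 cos0 !(mul0r, mulr0, mul1r, oppr0).
by case: k k4 => [|[|[|[|]]]].
Qed.

Lemma Omega0 k : (k < 3)%N -> Omega (frame 0 0 0 0) (inord k) =
  nth 0 [:: asym5 0 0 0 0 (- 1) 0 0 0 0 1; asym5 0 0 0 0 0 (- 1) 0 0 (- 1) 0;
            asym5 0 0 0 0 0 0 1 (- 1) 0 0] k :> 'M[R]_5.
Proof.
move=> k3; rewrite /Omega inordK // !frame0 //=.
by case: k k3 => [|[|[|//]]] _ /=; rewrite !wedge2_vec5 asym5N asym5D;
  congr asym5; ring.
Qed.

Lemma mpt0E (a0 a1 a2 : R) : mpt 0 0 0 0 (vec3 a0 a1 a2) =
  (vec5 1 0 0 0 0, asym5 0 0 0 0 (- a0) (- a1) a2 (- a2) (- a1) a0).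
Proof.
rewrite /mpt sph0; congr pair; rewrite sum3E !Omega0 //= !mxE !inordK //=.
by rewrite !asym5Z !asym5D; congr asym5; ring.
Qed.

Lemma vect0E t b0 b1 b2 b3 z1 z2 z3 : vect 0 0 0 0 t b0 b1 b2 b3 z1 z2 z3 =
  (vec5 0 b2 b3 b0 b1, asym5 (- t * b3) (t * b2) (t * b1) (- t * b0)
     (- z1) (- z2) z3 (- z3) (- z2) z1) :> amb.
Proof.
rewrite /vect sph0 !Omega0 // !frame0 //= !wedge2_vec5 !vec5Z !vec5D.
rewrite -scaleNr !asym5Z !asym5N !asym5D asym5Z !asym5D.
by congr (_, _); [congr vec5|congr asym5]; ring.
Qed.

Lemma ip2_asym5 (a01 a02 a03 a04 a12 a13 a14 a23 a24 a34
              b01 b02 b03 b04 b12 b13 b14 b23 b24 b34 : R) :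
  ip2 (asym5 a01 a02 a03 a04 a12 a13 a14 a23 a24 a34)
      (asym5 b01 b02 b03 b04 b12 b13 b14 b23 b24 b34) =
  (a01 * b01 + a02 * b02 + a03 * b03 + a04 * b04 + a12 * b12
   + a13 * b13 + a14 * b14 + a23 * b23 + a24 * b24 + a34 * b34) / 2.
Proof.
rewrite /ip2 asym5_tr mulmxN raddfN /= /asym5 mx5M /mkseq /nth5 /= /mxtrace sum5E.
by rewrite !mxE !inordK //=; field.
Qed.

Lemma dot_vec5 (x0 x1 x2 x3 x4 y0 y1 y2 y3 y4 : R) :
  dot (vec5 x0 x1 x2 x3 x4) (vec5 y0 y1 y2 y3 y4) =
  x0 * y0 + x1 * y1 + x2 * y2 + x3 * y3 + x4 * y4.
Proof. by rewrite dot5 !cvec5. Qed.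

Lemma bform_vect al be th ph t b0 b1 b2 b3 z1 z2 z3 k : (k < 4)%N ->
  bform (frame al be th ph) (inord k) (vect al be th ph t b0 b1 b2 b3 z1 z2 z3)
  = [:: b0; b1; b2; b3]`_k :> R.
Proof.
move=> k4; rewrite vect_act frame_act bform_act ?frameQK // vect0E /bform /=.
by rewrite frame0 //; case: k k4 => [|[|[|[|//]]]] _ /=; rewrite dot_vec5; ring.
Qed.

Lemma zeta_vect al be th ph t b0 b1 b2 b3 z1 z2 z3 k : (k < 3)%N ->
  zeta (frame al be th ph) (inord k) (vect al be th ph t b0 b1 b2 b3 z1 z2 z3)
  = [:: z1; z2; z3]`_k :> R.
Proof.
move=> k3; rewrite vect_act frame_act zeta_act ?frameQK // vect0E /zeta /=.
by rewrite Omega0 //; case: k k3 => [|[|[|//]]] _ /=; rewrite ip2_asym5; field.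
Qed.

Lemma asym5_0 : asym5 0 0 0 0 0 0 0 0 0 0 = 0 :> 'M[R]_5.
Proof. by rewrite -[RHS](scale0r (asym5 0 0 0 0 0 0 0 0 0 0)) asym5Z !mul0r. Qed.

(** The third equation also makes A kill p, because the dual of p /\ A does; on the complement of p
    it is anti-self-duality. *)
Definition asd (m : amb) :=
  [/\ dot m.1 m.1 = 1, m.2^T = - m.2 & m.2 + star m.1 m.2 = 0].

Lemma asd_act Q m : star_invariant Q -> Q *m Q^T = 1%:M -> asd m -> asd (act Q m).
Proof.
move=> sQ QQ [h1 h2 h3]; split; rewrite /= ?dot_act //.
  by rewrite !trmx_mul trmxK h2 mulNmx mulmxN mulmxA.
by rewrite sQ // -mulmxDl -mulmxDr h3 mulmx0 mul0mx.
Qed.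

Lemma asd_rotation (m : amb) x : asd m ->
  [/\ asd (act (rot01 x) m), asd (act (rot12 x) m), asd (act (rot34 x) m)
    & asd (act (rot03 x) m)].
Proof.
by move=> h; split; [exact: asd_act (@star_rot01 R x) (rot01K x) h
  |exact: asd_act (@star_rot12 R x) (rot12K x) h
  |exact: asd_act (@star_rot34 R x) (rot34K x) h
  |exact: asd_act (@star_rot03 R x) (rot03K x) h].
Qed.

Lemma asd_frameQ al be th ph (m : amb) : asd m -> asd (act (frameQ al be th ph) m).
Proof.
rewrite /frameQ -!actM => h.
have [_ _ _ {}h] := asd_rotation al h.
have [{}h _ _ _] := asd_rotation th h.
have [_ {}h _ _] := asd_rotation ph h.
by have [_ _ {}h _] := asd_rotation be h.
Qed.

Lemma asd_frameQT al be th ph (m : amb) :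
  asd m -> asd (act (frameQ al be th ph)^T m).
Proof.
rewrite /frameQ !trmx_mul -rot03N -rot01N -rot12N -rot34N !mulmxA -!actM => h.
have [_ _ {}h _] := asd_rotation (- be) h.
have [_ {}h _ _] := asd_rotation (- ph) h.
have [{}h _ _ _] := asd_rotation (- th) h.
by have [_ _ _ {}h] := asd_rotation (- al) h.
Qed.

Lemma asd_base (A : 'M[R]_5) : asd (vec5 1 0 0 0 0, A) <->
  exists a, (vec5 1 0 0 0 0, A) = mpt 0 0 0 0 a.
Proof.
split=> [[_ /= /asym5P ->]|[a]]; last first.
  rewrite (vec3_coord a) mpt0E => -[->]; split=> /=.
  - by rewrite dot_vec5; ring.
  - exact: asym5_tr.
  - rewrite star_asym5 asym5D -asym5_0.
    by congr asym5; ring.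
set a01 := entry A 0 1; set a02 := entry A 0 2; set a03 := entry A 0 3.
set a04 := entry A 0 4; set a12 := entry A 1 2; set a13 := entry A 1 3.
set a14 := entry A 1 4; set a23 := entry A 2 3; set a24 := entry A 2 4.
set a34 := entry A 3 4; rewrite star_asym5 asym5D => /mx5P h.
have {}h i j : (i < 5)%N -> (j < 5)%N -> _ := h i j.
have h0 i j : entry (0 : 'M[R]_5) i j = 0 by rewrite /entry mxE.
have := (h 0 1 isT isT, h 0 2 isT isT, h 0 3 isT isT, h 0 4 isT isT,
  (h 1 2 isT isT, h 1 3 isT isT, h 1 4 isT isT))%N.
rewrite !h0 !entry_mx5 //= => -[[[[e01 e02] e03] e04] [[e12 e13] e14]].
(* These entries carry the three fibre coordinates in [mpt0E]. *)
exists (vec3 a34 (- a13) a14); rewrite mpt0E; congr (_, _).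
by congr asym5; lra.
Qed.

Lemma polar (x y : R) : exists r be, [/\ 0 <= r, x = r * cos be & y = r * sin be].
Proof.
have xy0 : 0 <= x ^+ 2 + y ^+ 2 by rewrite addr_ge0 ?sqr_ge0.
have [e0|r0] := eqVneq (x ^+ 2 + y ^+ 2) 0.
  move/eqP: e0; rewrite paddr_eq0 ?sqr_ge0 // !sqrf_eq0 => /andP[/eqP -> /eqP ->].
  by exists 0, 0; rewrite !mul0r.
set r := Num.sqrt (x ^+ 2 + y ^+ 2).
have r2 : r ^+ 2 = x ^+ 2 + y ^+ 2 by rewrite sqr_sqrtr.
have rp : 0 < r by rewrite sqrtr_gt0 lt_neqAle eq_sym r0.
have rn0 : r != 0 by rewrite gt_eqF.
have e : (x / r) ^+ 2 + (y / r) ^+ 2 = 1.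
  by rewrite !expr_div_n -mulrDl -r2 divff // expf_eq0.
have hx : -1 <= x / r <= 1.
  by rewrite -ler_norml -[`|_|]ger0_norm // -sqrtr_sqr -[leRHS]sqrtr1 ler_sqrt //
    real_normK ?num_real // -e lerDl sqr_ge0.
have hs : 1 - (x / r) ^+ 2 = (y / r) ^+ 2 by rewrite -e; ring.
have cx : cos (acos (x / r)) = x / r by rewrite acosK.
have sx : sin (acos (x / r)) = `|y / r| by rewrite sin_acos // hs sqrtr_sqr.
have [y0|y0] := leP 0 y.
  exists r, (acos (x / r)); split; rewrite ?(ltW rp) //.
    by rewrite cx mulrC divfK.
  by rewrite sx ger0_norm ?divr_ge0 // ?(ltW rp) // mulrC divfK.
exists r, (- acos (x / r)); split; rewrite ?(ltW rp) //.
  by rewrite cosN cx mulrC divfK.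
rewrite sinN sx ltr0_norm; last by rewrite pmulr_llt0 ?invr_gt0.
by rewrite opprK mulrC divfK.
Qed.

(** Polar coordinates are introduced four times, in the planes (p_3, p_4), (p_1, p_2), (p_0, r1) and
    (r2, S); the last radius is |p| = 1. Every point is reached, with no exceptional set. *)
Lemma unit_sph (p : 'rV[R]_5) : dot p p = 1 ->
  exists al be th ph, p = sph al be th ph.
Proof.
rewrite dot5 (vec5_coord p).
have [S [be [S0 h3 h4]]] := polar (coord p 3) (coord p 4).
have [r1 [ph [r10 h1 h2]]] := polar (coord p 1) (coord p 2).
have [r2 [th [r20 h0 h]]] := polar (coord p 0) r1.
have [r [al [r30 h5 h6]]] := polar r2 S.
rewrite !cvec5 //= h3 h4 h1 h2 h0 h h5 h6 => e.
have {}e : r ^+ 2 = 1.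
  by rewrite -e; ring: (cos2E al) (cos2E be) (cos2E th) (cos2E ph).
have -> : r = 1 by apply/eqP; rewrite -(eqrXn2 (n := 2)) // e expr1n.
by exists al, be, th, ph; rewrite /sph; congr vec5; ring.
Qed.

Lemma frameQTK al be th ph :
  (frameQ al be th ph)^T *m frameQ al be th ph = 1%:M :> 'M[R]_5.
Proof. exact/mulmx1C/frameQK. Qed.

(** The equations hold at the pole and are rotation invariant. Conversely the inverse of [frameQ]
    brings a solution to the pole, where [asd_base] solves the equations, and [frameQ] brings the
    answer back. *)
Lemma M_asd c (m : amb) : M c m <-> asd m /\ (c = 0 -> m.2 != 0).
Proof.
split=> [[[al [be [th [ph [a ->]]]]] h]|[am h]].
  split=> //; rewrite mpt_act; apply: asd_frameQ.
  have e : mpt 0 0 0 0 a = (vec5 1 0 0 0 0, (mpt 0 0 0 0 a).2).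
    by rewrite -sph0.
  by rewrite e; apply/asd_base; exists a; rewrite -e.
split=> //; have [p1 _ _] := am.
have [al [be [th [ph mE]]]] := unit_sph p1.
exists al, be, th, ph.
set Q := frameQ al be th ph.
have : asd (act Q^T m) by exact: asd_frameQT.
have -> : act Q^T m = (vec5 1 0 0 0 0, Q *m m.2 *m Q^T).
  by rewrite /act mE sph_act -mulmxA frameQK mulmx1 trmxK.
move=> /asd_base[a e]; exists a; rewrite mpt_act -e -/Q /act /= -sph_act -mE.
have QQ : Q^T *m Q = 1%:M by exact: frameQTK.
clearbody Q; by rewrite !mulmxA QQ mul1mx -mulmxA QQ mulmx1; case: (m).
Qed.

Lemma M_act c al be th ph (m : amb) : M c m -> M c (act (frameQ al be th ph) m).
Proof.
move=> /M_asd[am h]; apply/M_asd; split; first exact: asd_frameQ.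
move=> /h; apply: contra_neq => /= e; set Q := frameQ al be th ph in e *.
have : act Q^T (act Q m) = m by rewrite actM frameQK act1.
by rewrite {1}/act /= e mulmx0 mul0mx => <-.
Qed.

Lemma M_actT c al be th ph (m : amb) : M c m -> M c (act (frameQ al be th ph)^T m).
Proof.
move=> /M_asd[am h]; apply/M_asd; split; first exact: asd_frameQT.
move=> /h; apply: contra_neq => /= e; set Q := frameQ al be th ph in e *.
have : act Q (act Q^T m) = m by rewrite actM frameQTK act1.
by rewrite {1}/act /= e mulmx0 mul0mx => <-.
Qed.

End Model.

(** * Tangent vectors of M along the bolts *)

Ltac der_with leaf := repeat first [apply: derC | leaf | apply: derB | apply: derD
  | apply: derN | apply: derM | apply: derX].

Section Tangent.
Context {R : realType}.
Local Notation amb := ('rV[R]_5 * 'M[R]_5)%type.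

Lemma der_sum (V : normedModType R) n (x v : V) (f : 'I_n -> V -> R) a :
  (forall i, is_derive x v (f i) (a i)) ->
  is_derive x v (fun y => \sum_i f i y) (\sum_i a i).
Proof.
move=> h; have hs := @is_derive_sum _ _ _ n f x v a h.
apply: is_derive_ext hs => y; by rewrite fct_sumE.
Qed.

Lemma is_derive_mulmx (V : normedModType R) m n p (x v : V)
    (f : V -> 'M[R]_(m, n)) (g : V -> 'M[R]_(n, p)) f' g' :
  is_derive x v f f' -> is_derive x v g g' ->
  is_derive x v (fun y => f y *m g y) (f' *m g x + f x *m g').
Proof.
move=> /is_derive_mx hf /is_derive_mx hg; apply/is_derive_mx => i j.
apply: (@is_derive_ext _ _ _ _ _ (fun y => \sum_k f y i k * g y k j)) => [y|].
  by rewrite mxE.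
rewrite !mxE -big_split /=; apply: der_sum => k.
exact: derM.
Qed.

Lemma is_derive_constant (V W : normedModType R) (x v : V) (a : W) :
  is_derive x v (fun=> a) 0.
Proof. exact: is_derive_cst. Qed.

Lemma is_derive_act (V : normedModType R) (x v : V) (g : V -> amb) w Q :
  is_derive x v g w -> is_derive x v (fun y => act Q (g y)) (act Q w).
Proof.
move=> /is_derive_pair[g1 g2]; apply/is_derive_pair; split=> /=.
  apply: is_derive_eq (is_derive_mulmx g1 (is_derive_constant x v Q)) _.
  by rewrite mulmx0 addr0.
apply: is_derive_eq (is_derive_mulmx
  (is_derive_mulmx (is_derive_constant x v Q^T) g2) (is_derive_constant x v Q)) _.
by rewrite mulmx0 addr0 mul0mx add0r.
Qed.

Lemma tangent_act (X : set amb) Q m w : (forall y, X y -> X (act Q y)) ->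
  tangent X m w -> tangent X (act Q m) (act Q w).
Proof.
move=> XQ [g [<- gX gw]]; exists (fun s => act Q (g s)); split=> //.
  by move=> s; apply/XQ/gX.
exact: is_derive_act.
Qed.

Lemma is_derive_coord (V : normedModType R) (x v : V) n (f : V -> 'rV[R]_n.+1) f' j :
  is_derive x v f f' -> is_derive x v (fun y => coord (f y) j) (coord f' j).
Proof. by move=> /is_derive_mx h; exact: h. Qed.

Lemma is_derive_entry (V : normedModType R) (x v : V) (f : V -> 'M[R]_5) f' i j :
  is_derive x v f f' -> is_derive x v (fun y => entry (f y) i j) (entry f' i j).
Proof. by move=> /is_derive_mx h; exact: h. Qed.

(** The equations of M written in entries, so that they can be differentiated term by term along a
    curve. The components 23, 24 and 34 of the dual would repeat 14, 13 and 12 at the pole. *)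
Definition asd_eqn (k : nat) (m : amb) : R :=
  let p0 := coord m.1 0 in let p1 := coord m.1 1 in let p2 := coord m.1 2 in
  let p3 := coord m.1 3 in let p4 := coord m.1 4 in let A := m.2 in
  match k with
  | 0 => p0 * p0 + p1 * p1 + p2 * p2 + p3 * p3 + p4 * p4 - 1
  | 1 => entry A 0 1 + (p2 * entry A 3 4 - p3 * entry A 2 4 + p4 * entry A 2 3)
  | 2 => entry A 0 2 + (- p1 * entry A 3 4 + p3 * entry A 1 4 - p4 * entry A 1 3)
  | 3 => entry A 0 3 + (p1 * entry A 2 4 - p2 * entry A 1 4 + p4 * entry A 1 2)
  | 4 => entry A 0 4 + (- p1 * entry A 2 3 + p2 * entry A 1 3 - p3 * entry A 1 2)
  | 5 => entry A 1 2 + (p0 * entry A 3 4 - p3 * entry A 0 4 + p4 * entry A 0 3)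
  | 6 => entry A 1 3 + (- p0 * entry A 2 4 + p2 * entry A 0 4 - p4 * entry A 0 2)
  | _ => entry A 1 4 + (p0 * entry A 2 3 - p2 * entry A 0 3 + p3 * entry A 0 2)
  end.

Lemma asd_eqnE k m : asd m -> asd_eqn k m = 0.
Proof.
move=> [h1 h2 h3].
have : forall i j, entry (m.2 + star m.1 m.2) i j = 0.
  by move=> i j; rewrite h3 /entry mxE.
rewrite {1}(vec5_coord m.1) {2}(asym5P h2) star_asym5 => h.
case: k => [|[|[|[|[|[|[|k]]]]]]]; rewrite /asd_eqn; first by rewrite -dot5 h1 subrr.
- by rewrite -(h 0 1)%N entryD entry_mx5.
- by rewrite -(h 0 2)%N entryD entry_mx5.
- by rewrite -(h 0 3)%N entryD entry_mx5.
- by rewrite -(h 0 4)%N entryD entry_mx5.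
- by rewrite -(h 1 2)%N entryD entry_mx5.
- by rewrite -(h 1 3)%N entryD entry_mx5.
- by rewrite -(h 1 4)%N entryD entry_mx5.
Qed.

(** Differentiating antisymmetry and the eight [asd_eqn] at the pole gives eight linear equations on
    the 5 + 10 entries of w, which leave the seven parameters of [vect]. *)
Lemma tangent_base (c t : R) w : tangent (M c) (mpt 0 0 0 0 (vec3 t 0 0)) w ->
  exists b0 b1 b2 b3 z1 z2 z3, w = vect 0 0 0 0 t b0 b1 b2 b3 z1 z2 z3.
Proof.
move=> [g [g0 gM /is_derive_pair[g1 g2]]].
have ga s : asd (g s) by have /M_asd[] := gM s.
have w2 : w.2^T = - w.2.
  apply/matrixP => i j; rewrite !mxE.
  have/is_derive_mx h := g2.
  have e : (fun y => (g y).2 j i) = (fun y => - (g y).2 i j).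
    apply/funext => s; have [_ /matrixP/(_ i j) + _] := ga s.
    by rewrite !mxE.
  by have := h j i; rewrite e => h1; apply: (is_derive_unique h1); apply: derN.
have hp j := is_derive_coord j g1.
have ha i j := is_derive_entry i j g2.
have der0 k d : is_derive (0 : R) 1 (fun s => asd_eqn k (g s)) d -> d = 0.
  move=> h; apply: is_derive_unique h _.
  have h0 := derC (0 : R) (1 : R) (0 : R).
  by apply: is_derive_ext h0 => s; rewrite asd_eqnE.
have simp := (mul0r, mulr0, mul1r, mulr1, mulrN, mulNr, oppr0, add0r, addr0, subr0).
have gE : g 0 = (vec5 1 0 0 0 0, asym5 0 0 0 0 (- t) 0 0 0 0 t).
  by rewrite g0 mpt0E oppr0.
have := der0 0%N _ ltac:(rewrite /asd_eqn; der_with ltac:(first [exact: hp|exact: ha])).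
rewrite gE /= !(cvec5, entry_mx5) //= /GRing.scale /= !simp => E0.
have := der0 1%N _ ltac:(rewrite /asd_eqn; der_with ltac:(first [exact: hp|exact: ha])).
rewrite gE /= !(cvec5, entry_mx5) //= /GRing.scale /= !simp => E1.
have := der0 2%N _ ltac:(rewrite /asd_eqn; der_with ltac:(first [exact: hp|exact: ha])).
rewrite gE /= !(cvec5, entry_mx5) //= /GRing.scale /= !simp => E2.
have := der0 3%N _ ltac:(rewrite /asd_eqn; der_with ltac:(first [exact: hp|exact: ha])).
rewrite gE /= !(cvec5, entry_mx5) //= /GRing.scale /= !simp => E3.
have := der0 4%N _ ltac:(rewrite /asd_eqn; der_with ltac:(first [exact: hp|exact: ha])).
rewrite gE /= !(cvec5, entry_mx5) //= /GRing.scale /= !simp => E4.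
have := der0 5%N _ ltac:(rewrite /asd_eqn; der_with ltac:(first [exact: hp|exact: ha])).
rewrite gE /= !(cvec5, entry_mx5) //= /GRing.scale /= !simp => E5.
have := der0 6%N _ ltac:(rewrite /asd_eqn; der_with ltac:(first [exact: hp|exact: ha])).
rewrite gE /= !(cvec5, entry_mx5) //= /GRing.scale /= !simp => E6.
have := der0 7%N _ ltac:(rewrite /asd_eqn; der_with ltac:(first [exact: hp|exact: ha])).
rewrite gE /= !(cvec5, entry_mx5) //= /GRing.scale /= !simp => E7.
have {}E0 : coord w.1 0 = 0 by lra.
rewrite E0 mulr0 addr0 in E5.
(* The parameters are read off from the positions they occupy in [vect0E]. *)
exists (coord w.1 3), (coord w.1 4), (coord w.1 1), (coord w.1 2).
exists (- entry w.2 1 2), (- entry w.2 1 3), (entry w.2 1 4).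
clear -E0 E1 E2 E3 E4 E5 E6 E7 w2.
rewrite vect0E [LHS]surjective_pairing {1}(vec5_coord w.1) {1}(asym5P w2).
by congr (_, _); [congr vec5|congr asym5]; lra.
Qed.
End Tangent.

(** * Bolts in closed form and velocities of curves along them *)

Section Bolts.
Context {R : realType}.
Local Notation amb := ('rV[R]_5 * 'M[R]_5)%type.

(** Only t, cos al, y = sin al e^{i be} and the unit vector n of (th, ph) enter. All identifications
    between coordinates of bolt points are read off from this form, also where be or ph
    degenerates. *)
Lemma boltE (t al be th ph : R) : bolt t al be th ph =
  let n0 := cos th in let n1 := sin th * cos ph in let n2 := sin th * sin ph in
  let y1 := sin al * cos be in let y2 := sin al * sin be in
  (vec5 (cos al * n0) (cos al * n1) (cos al * n2) y1 y2,
   asym5 (t * (- n2)) (t * n1) (t * (n0 * y2)) (t * (- n0 * y1)) (t * (- n0))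
     (t * (n1 * y2)) (t * (- n1 * y1)) (t * (n2 * y2)) (t * (- n2 * y1))
     (t * cos al)).
Proof.
rewrite /bolt /mpt /sph; congr pair; first by congr vec5; ring.
rewrite sum3E !mxE !inordK //= !scale0r !addr0 /Omega inordK //= !row_frame //=.
rewrite !wedge2_vec5 asym5N asym5D asym5Z.
by congr asym5; ring: (cos2E al) (cos2E be) (cos2E th) (cos2E ph).
Qed.

Lemma vectE (al be th ph t b0 b1 b2 b3 z1 z2 z3 : R) :
  vect al be th ph t b0 b1 b2 b3 z1 z2 z3 = act (frameQ al be th ph)
    (vec5 0 b2 b3 b0 b1, asym5 (- t * b3) (t * b2) (t * b1) (- t * b0)
      (- z1) (- z2) z3 (- z3) (- z2) z1).
Proof. by rewrite vect_act vect0E. Qed.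

Lemma der_cos (V : normedModType R) (x v : V) f d : is_derive x v f d ->
  is_derive x v (fun y => cos (f y)) (- sin (f x) * d).
Proof. by move=> h; apply: der_comp h; exact: is_derive_cos. Qed.

Lemma der_sin (V : normedModType R) (x v : V) f d : is_derive x v f d ->
  is_derive x v (fun y => sin (f y)) (cos (f x) * d).
Proof. by move=> h; apply: der_comp h; exact: is_derive_sin. Qed.

Lemma is_derive_vec5 (V : normedModType R) (x v : V) (f0 f1 f2 f3 f4 : V -> R)
    d0 d1 d2 d3 d4 :
  is_derive x v f0 d0 -> is_derive x v f1 d1 -> is_derive x v f2 d2 ->
  is_derive x v f3 d3 -> is_derive x v f4 d4 ->
  is_derive x v (fun y => vec5 (f0 y) (f1 y) (f2 y) (f3 y) (f4 y))
    (vec5 d0 d1 d2 d3 d4).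
Proof.
move=> h0 h1 h2 h3 h4; apply/is_derive_mx => i j; rewrite mxE.
apply: (@is_derive_ext _ _ _ _ _
  (fun y => [:: f0 y; f1 y; f2 y; f3 y; f4 y]`_j)) => [y|]; first by rewrite mxE.
by case: j => -[|[|[|[|[|//]]]]].
Qed.

Lemma is_derive_vec3 (V : normedModType R) (x v : V) (f0 f1 f2 : V -> R) d0 d1 d2 :
  is_derive x v f0 d0 -> is_derive x v f1 d1 -> is_derive x v f2 d2 ->
  is_derive x v (fun y => vec3 (f0 y) (f1 y) (f2 y)) (vec3 d0 d1 d2).
Proof.
move=> h0 h1 h2; apply/is_derive_mx => i j; rewrite mxE.
apply: (@is_derive_ext _ _ _ _ _ (fun y => [:: f0 y; f1 y; f2 y]`_j)) => [y|].
  by rewrite mxE.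
by case: j => -[|[|[|//]]].
Qed.

Lemma is_derive_asym5 (V : normedModType R) (x v : V)
    (f01 f02 f03 f04 f12 f13 f14 f23 f24 f34 : V -> R)
    d01 d02 d03 d04 d12 d13 d14 d23 d24 d34 :
  is_derive x v f01 d01 -> is_derive x v f02 d02 -> is_derive x v f03 d03 ->
  is_derive x v f04 d04 -> is_derive x v f12 d12 -> is_derive x v f13 d13 ->
  is_derive x v f14 d14 -> is_derive x v f23 d23 -> is_derive x v f24 d24 ->
  is_derive x v f34 d34 ->
  is_derive x v (fun y => asym5 (f01 y) (f02 y) (f03 y) (f04 y) (f12 y) (f13 y)
    (f14 y) (f23 y) (f24 y) (f34 y))
    (asym5 d01 d02 d03 d04 d12 d13 d14 d23 d24 d34).
Proof.
move=> h01 h02 h03 h04 h12 h13 h14 h23 h24 h34; apply/is_derive_mx => i j.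
rewrite /asym5 mxE.
pose F y i j := nth 0 (nth [::]
  [:: [:: 0; f01 y; f02 y; f03 y; f04 y]; [:: - f01 y; 0; f12 y; f13 y; f14 y];
      [:: - f02 y; - f12 y; 0; f23 y; f24 y]; [:: - f03 y; - f13 y; - f23 y; 0; f34 y];
      [:: - f04 y; - f14 y; - f24 y; - f34 y; 0]] i) j.
apply: (@is_derive_ext _ _ _ _ _ (fun y => F y i j)) => [y|]; first by rewrite mxE.
rewrite /F; clear F.
by case: i => -[|[|[|[|[|//]]]]] i5; case: j => -[|[|[|[|[|//]]]]] j5 //=;
  first [exact: derC | by apply: derN | by []].
Qed.

(** For a = (t, 0, 0) one has zeta_2 = 2 t rho_3 and zeta_3 = - 2 t rho_2, so the last two entries
    record 2 rho_3 = sin al sin th dph and 2 rho_2 = sin al dth. *)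
Lemma bolt_curve (ta a b h f : R -> R) (dt da db dh df : R) :
  is_derive (0 : R) 1 ta dt -> is_derive (0 : R) 1 a da ->
  is_derive (0 : R) 1 b db -> is_derive (0 : R) 1 h dh ->
  is_derive (0 : R) 1 f df ->
  let t := ta 0 in let al := a 0 in let be := b 0 in
  let th := h 0 in let ph := f 0 in
  is_derive (0 : R) 1 (fun s => bolt (ta s) (a s) (b s) (h s) (f s))
    (vect al be th ph t da (sin al * db) (cos al * dh) (cos al * sin th * df)
      dt (t * sin al * sin th * df) (- t * sin al * dh)).
Proof.
move=> hta ha hb hh hf t al be th ph.
apply: (@is_derive_ext _ _ _ _ _ (fun s =>
  let n0 := cos (h s) in let n1 := sin (h s) * cos (f s) in
  let n2 := sin (h s) * sin (f s) in
  let y1 := sin (a s) * cos (b s) in let y2 := sin (a s) * sin (b s) in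
  (vec5 (cos (a s) * n0) (cos (a s) * n1) (cos (a s) * n2) y1 y2,
   asym5 (ta s * (- n2)) (ta s * n1) (ta s * (n0 * y2)) (ta s * (- n0 * y1))
     (ta s * (- n0)) (ta s * (n1 * y2)) (ta s * (- n1 * y1)) (ta s * (n2 * y2))
     (ta s * (- n2 * y1)) (ta s * cos (a s))))) => [s|]; first by rewrite boltE.
rewrite vectE /act /= -/al -/be -/th -/ph.
apply/is_derive_pair; split=> /=.
  rewrite frameQE vec5M /nth5 /=.
  apply: is_derive_eq.
    by apply: is_derive_vec5; der_with ltac:(first [exact: hta|exact: ha|exact: hb|
      exact: hh|exact: hf|apply: der_cos|apply: der_sin]).
  by rewrite -/t -/al -/be -/th -/ph /GRing.scale /=; congr vec5; ring.
rewrite frameQE mx5T /asym5 !mx5M /mkseq /nth5 /=.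
apply: is_derive_eq.
  by apply: is_derive_asym5; der_with ltac:(first [exact: hta|exact: ha|exact: hb|
      exact: hh|exact: hf|apply: der_cos|apply: der_sin]).
rewrite -/t -/al -/be -/th -/ph /GRing.scale /= /asym5; congr_mx5;
  ring: (cos2E al) (cos2E be) (cos2E th) (cos2E ph).
Qed.

End Bolts.

Section BoltTangent.
Context {R : realType}.
Local Notation amb := ('rV[R]_5 * 'M[R]_5)%type.

Lemma M_mpt c (al be th ph : R) (a : 'rV[R]_3) :
  (c = 0 -> coord a 0 ^+ 2 + coord a 1 ^+ 2 + coord a 2 ^+ 2 != 0) ->
  M c (mpt al be th ph a).
Proof.
move=> h; split; first by exists al, be, th, ph, a.
move=> /h; apply: contra_neq => e.
by rewrite -(r2_mpt al be th ph) /r2 e /ip2 mul0mx mxtrace0 mul0r.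
Qed.

Lemma r2_bolt (t al be th ph : R) : r2 (bolt t al be th ph) = t ^+ 2.
Proof. by rewrite r2_mpt !vec3E //=; ring. Qed.

Lemma M_bolt c (t al be th ph : R) :
  M c (bolt t al be th ph) <-> (c = 0 -> t != 0).
Proof.
split=> [[_ h] c0|h].
  apply: contra_neq (h c0) => t0; rewrite boltE t0 /= !mul0r.
  exact: asym5_0.
by apply: M_mpt => /h t0; rewrite !vec3E //= expr0n /= !addr0 sqrf_eq0.
Qed.

Lemma B_bolt c (t al be th ph : R) :
  B c (bolt t al be th ph) <-> (c = 0 -> t != 0).
Proof.
split=> [[/M_bolt//]|h]; split; first exact/M_bolt.
by rewrite rho_mpt !vec3E //= expr0n /= addr0 sqrtr0 mul0r.
Qed.

(** A curve for t that stays in M_0 when c = 0: the exponential t exp (s z / t) never vanishes, and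
    a straight line serves when t = 0. *)
Lemma scalar_curve (t z : R) : exists ta : R -> R,
  [/\ ta 0 = t, is_derive (0 : R) 1 ta z & t != 0 -> forall s, ta s != 0].
Proof.
have hid : is_derive (0 : R) 1 (fun s : R => s) 1 by exact: is_derive_id.
have [->|t0] := eqVneq t 0.
  exists (fun s => s * z); split; rewrite ?mul0r //.
  have h := derM hid (derC (0 : R) (1 : R) z); apply: (is_derive_eq h); ring.
exists (fun s => t * expR (s * (z / t))); split.
- by rewrite mul0r expR0 mulr1.
- have h1 := derM hid (derC (0 : R) (1 : R) (z / t)).
  have h2 := der_comp (is_derive_expR _) h1.
  have h3 := derM (derC (0 : R) (1 : R) t) h2.
  apply: (is_derive_eq h3).
  by rewrite !mul0r expR0; field.
- by move=> _ s; rewrite mulf_neq0 // gt_eqF // expR_gt0.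
Qed.

Lemma frameQ0 : frameQ 0 0 0 0 = 1%:M :> 'M[R]_5.
Proof. by rewrite frameQE !(sin0, cos0) mx5_1; congr_mx5; ring. Qed.

(** At al = 0 the angle be is degenerate, so the direction (b0, b1) is reached by moving al at speed
    r with be fixed at the polar angle of (b0, b1). *)
Lemma tangent_bolt_base c (t b0 b1 z1 : R) : (c = 0 -> t != 0) ->
  tangent (M c) (bolt t 0 0 0 0) (vect 0 0 0 0 t b0 b1 0 0 z1 0 0).
Proof.
move=> ct; have [r [ps [_ e0 e1]]] := polar b0 b1.
have [ta [ta0 dta taN]] := scalar_curve t z1.
exists (fun s => bolt (ta s) (s * r) ps 0 0); split.
- by rewrite ta0 !boltE mul0r !(sin0, cos0, mul0r, mulr0).
- by move=> s; apply/M_bolt => /ct /taN.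
have hid : is_derive (0 : R) 1 (fun s : R => s) 1 by exact: is_derive_id.
have hC a := derC (0 : R) (1 : R) (a : R).
have := bolt_curve dta (derM hid (hC r)) (hC ps) (hC 0) (hC 0).
rewrite /= mul0r ta0 => h; apply: (is_derive_eq h) => {h}.
have Q34 : frameQ 0 ps 0 0 = rot34 ps.
  by rewrite frameQE !(sin0, cos0); congr_mx5; ring.
rewrite !vectE frameQ0 act1 Q34 /act /= conj_rot34 vec5M /nth5 /= !(sin0, cos0).
by rewrite e0 e1; congr (_, _); [congr vec5|congr asym5]; ring.
Qed.

Lemma tangent_bolt_base2 c (t : R) : (c = 0 -> t != 0) ->
  tangent (M c) (bolt t 0 0 0 0) (vect 0 0 0 0 t 0 0 1 0 0 0 0).
Proof.
move=> ct; exists (fun s => bolt t 0 0 s 0); split => //.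
- by move=> s; exact/M_bolt.
have hid : is_derive (0 : R) 1 (fun s : R => s) 1 by exact: is_derive_id.
have hC a := derC (0 : R) (1 : R) (a : R).
have := bolt_curve (hC t) (hC 0) (hC 0) hid (hC 0).
by rewrite /= !(sin0, cos0, mulr0, mul0r, mulr1).
Qed.

(** At th = 0 the angle ph is degenerate; moving th with ph = pi / 2 turns the direction e_2 into
    e_3. *)
Lemma tangent_bolt_base3 c (t : R) : (c = 0 -> t != 0) ->
  tangent (M c) (bolt t 0 0 0 0) (vect 0 0 0 0 t 0 0 0 1 0 0 0).
Proof.
move=> ct; exists (fun s => bolt t 0 0 s (pi / 2)); split => //.
- by rewrite !boltE !(sin0, cos0, mulr0, mul0r, mulr1).
- by move=> s; exact/M_bolt.
have hid : is_derive (0 : R) 1 (fun s : R => s) 1 by exact: is_derive_id.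
have hC a := derC (0 : R) (1 : R) (a : R).
have := bolt_curve (hC t) (hC 0) (hC 0) hid (hC (pi / 2)).
rewrite /= => h; apply: (is_derive_eq h) => {h}.
have Q12 : frameQ 0 0 0 (pi / 2) = rot12 (pi / 2) :> 'M[R]_5.
  by rewrite frameQE !(sin0, cos0); congr_mx5; ring.
rewrite !vectE frameQ0 act1 Q12 /act /= conj_rot12 vec5M /nth5 /=.
rewrite !(sin0, cos0, sin_pihalf, cos_pihalf).
by congr (_, _); [congr vec5|congr asym5]; ring.
Qed.

Lemma tangent_bolt_base45 c (t z2 z3 : R) : (c = 0 -> t != 0) ->
  tangent (M c) (bolt t 0 0 0 0) (vect 0 0 0 0 t 0 0 0 0 0 z2 z3).
Proof.
move=> ct; exists (fun s => mpt 0 0 0 0 (vec3 t (s * z2) (s * z3))); split.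
- by rewrite !mul0r.
- move=> s; apply: M_mpt => /ct t0; rewrite !vec3E //=.
  by rewrite gt_eqF // -addrA ltr_pwDl ?exprn_even_gt0 // addr_ge0 ?sqr_ge0.
apply: (@is_derive_ext _ _ _ _ _ (fun s : R => (vec5 1 0 0 0 0,
   asym5 0 0 0 0 (- t) (- (s * z2)) (s * z3) (- (s * z3)) (- (s * z2)) t))) => [s|].
  by rewrite mpt0E.
rewrite vect0E; apply/is_derive_pair; split=> /=.
  by apply: is_derive_vec5; exact: derC.
have hid : is_derive (0 : R) 1 (fun s : R => s) 1 by exact: is_derive_id.
apply: is_derive_eq.
  by apply: is_derive_asym5; der_with ltac:(exact: hid).
by rewrite /GRing.scale /=; congr asym5; ring.
Qed.

Lemma tangent_boltP c (t al be th ph : R) w :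
  tangent (M c) (bolt t al be th ph) w ->
  exists b0 b1 b2 b3 z1 z2 z3, w = vect al be th ph t b0 b1 b2 b3 z1 z2 z3.
Proof.
move=> tw; have tw' := tangent_act (@M_actT _ _ al be th ph) tw.
have e : act (frameQ al be th ph)^T (bolt t al be th ph) = bolt t 0 0 0 0.
  by rewrite /bolt mpt_act actM frameQK act1.
rewrite e in tw'.
have [b0 [b1 [b2 [b3 [z1 [z2 [z3 e2]]]]]]] := tangent_base tw'.
exists b0, b1, b2, b3, z1, z2, z3; rewrite vect_act -e2 actM frameQTK act1.
by [].
Qed.

Lemma tangent_bolt_act c (t al be th ph b0 b1 b2 b3 z1 z2 z3 : R) :
  tangent (M c) (bolt t 0 0 0 0) (vect 0 0 0 0 t b0 b1 b2 b3 z1 z2 z3) ->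
  tangent (M c) (bolt t al be th ph) (vect al be th ph t b0 b1 b2 b3 z1 z2 z3).
Proof.
move=> h; rewrite vect_act /bolt mpt_act; apply: tangent_act h => y.
exact: M_act.
Qed.

End BoltTangent.

(** * The differential of pi_c and horizontal vectors *)

Section Fibration.
Context {R : realType}.
Local Notation amb := ('rV[R]_5 * 'M[R]_5)%type.

Lemma coordD n (x y : 'rV[R]_n.+1) j : coord (x + y) j = coord x j + coord y j.
Proof. by rewrite /coord mxE. Qed.

Lemma coordZ n k (x : 'rV[R]_n.+1) j : coord (k *: x) j = k * coord x j.
Proof. by rewrite /coord mxE. Qed.

(** A single fourth root w makes every real power occurring in phi_c, g_c and pi_c a rational
    expression in w, which [field] can treat. *)
Lemma powR_quarter (P : R) : 0 < P -> exists w, [/\ 0 < w, P = w ^+ 4,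
  P `^ (1 / 4) = w, P `^ (1 / 2) = w ^+ 2 &
  [/\ P `^ (- (1 / 2)) = w ^- 2, P `^ (- (3 / 4)) = w ^- 3
    & P `^ (1 / 4 - 1) = w ^- 3]].
Proof.
move=> P0; have hM n : (P `^ (1 / 4)) ^+ n = P `^ (1 / 4 * n%:R).
  by rewrite -powR_mulrn ?powR_ge0 // -powRrM.
exists (P `^ (1 / 4)); split=> //.
- exact: powR_gt0.
- by rewrite hM (_ : 1 / 4 * 4 = 1) ?powRr1 ?(ltW P0) //; field.
- by rewrite hM; congr (_ `^ _); field.
- have -> : 1 / 4 - 1 = - (3 / 4) :> R by field.
  by rewrite !powRN !hM; split; congr (_ `^ _)^-1; field.
Qed.

Lemma is_derive_line (V W : normedModType R) (x v : V) (f : V -> W) d :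
  is_derive (0 : R) 1 (fun h : R => f (h *: v + x)) d -> is_derive x v f d.
Proof.
case=> h1 h2; apply: DeriveDef; first exact: (derivable1P f x v).2.
rewrite -h2 /derive; under [in RHS]eq_fun do
    rewrite /= scale0r add0r addr0 [_%:A]mulr1.
by [].
Qed.

Lemma is_derive_r2 (m w : amb) : is_derive m w (@r2 R) (2 * ip2 w.2 m.2).
Proof.
apply: is_derive_line.
have e : (fun h : R => h * h * ip2 w.2 w.2 + h * (2 * ip2 w.2 m.2) + ip2 m.2 m.2)
    =1 (fun h => r2 (h *: w + m)).
  move=> h; rewrite /r2 /= ip2Dl !ip2Dr !ip2Zl !ip2Zr (ip2C m.2); ring.
have hid : is_derive (0 : R) 1 (fun s : R => s) 1 by exact: is_derive_id.
have hC a := derC (0 : R) (1 : R) (a : R).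
apply: (is_derive_ext e).
have h := derD (derD (derM (derM hid hid) (hC (ip2 w.2 w.2)))
  (derM hid (hC (2 * ip2 w.2 m.2)))) (hC (ip2 m.2 m.2)).
by apply: (is_derive_eq h); ring.
Qed.

(** The parameters b2, b3, z2 and z3 drop out: these four directions are tangent to the fibres of
    pi_c. *)
Lemma is_derive_pic c (t al be th ph b0 b1 b2 b3 z1 z2 z3 : R) :
  0 < c + t ^+ 2 -> let w := (c + t ^+ 2) `^ (1 / 4) in
  is_derive (bolt t al be th ph) (vect al be th ph t b0 b1 b2 b3 z1 z2 z3) (pic c)
    (vec3 (cos al * z1 - t * sin al * b0)
      (t * w ^- 3 * z1 * (sin al * cos be)
       + 2 * w * (cos al * b0 * cos be - b1 * sin be))
      (t * w ^- 3 * z1 * (sin al * sin be)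
       + 2 * w * (cos al * b0 * sin be + b1 * cos be))).
Proof.
move=> P0; have [w [w0 _ w14 _ [_ _ wE]]] := powR_quarter P0; rewrite /= w14.
set m := bolt _ _ _ _ _; set v := vect _ _ _ _ _ _ _ _ _ _ _ _.
have [h1 h2] : is_derive m v (fun y => y.1) v.1 /\ is_derive m v (fun y => y.2) v.2.
  by apply/is_derive_pair; exact: is_derive_id.
have hp j := is_derive_coord j h1.
have ha i j := is_derive_entry i j h2.
have hr : is_derive m v (@r2 R) (2 * (t * z1)).
  apply: (is_derive_eq (is_derive_r2 m v)); congr (2 * _).
  rewrite /m /bolt mpt2E !vec3E //= !scale0r !addr0 ip2Zr.
  by have := zeta_vect al be th ph t b0 b1 b2 b3 z1 z2 z3 (k := 0) isT;
    rewrite /zeta => ->.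
have hf : is_derive m v (fun y => 2 * (c + r2 y) `^ (1 / 4)) (t * w ^- 3 * z1).
  have hcr := derD (derC m v c) hr.
  have hP : 0 < c + r2 m by rewrite /m r2_bolt.
  have hpow : is_derive (c + r2 m) 1 (fun x => x `^ (1 / 4))
      (1 / 4 * (c + r2 m) `^ (1 / 4 - 1)) by exact: is_derive1_powR.
  have h := derM (derC m v 2) (der_comp (f := fun x => x `^ (1 / 4))
    (g := fun y => c + r2 y) hpow hcr).
  apply: (is_derive_eq h); rewrite /m r2_bolt wE; field.
  by rewrite gt_eqF.
have wPE : (c + r2 m) `^ (1 / 4) = w.
  by rewrite /m r2_bolt.
have hu := derN (derD (derD (derM (hp 0) (ha 1 2)) (derM (hp 1) (ha 2 0)))
  (derM (hp 2) (ha 0 1)))%N.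
have h := is_derive_vec3 hu (derM hf (hp 3%N)) (derM hf (hp 4%N)).
apply: (is_derive_eq h) => {h hu hf hr hp ha h1 h2}.
rewrite wPE /m boltE /= !(cvec5, entry_mx5) //= /v /vect /=.
rewrite /Omega !inordK //= !(row_frame, coordD, coordZ, entryD, entryN, entryZ,
  entry_wedge2) //= !cvec5 //=.
congr vec3; ring: (cos2E al) (cos2E be) (cos2E th) (cos2E ph).
Qed.

Lemma gmet_vect c (al be th ph t b0 b1 b2 b3 z1 z2 z3
    b0' b1' b2' b3' z1' z2' z3' : R) :
  gmet c (frame al be th ph) (bolt t al be th ph)
    (vect al be th ph t b0 b1 b2 b3 z1 z2 z3)
    (vect al be th ph t b0' b1' b2' b3' z1' z2' z3') =
  (c + t ^+ 2) `^ (- (1 / 2)) * (z1 * z1' + z2 * z2' + z3 * z3')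
  + 2 * (c + t ^+ 2) `^ (1 / 2) * (b0 * b0' + b1 * b1' + b2 * b2' + b3 * b3').
Proof. by rewrite /gmet r2_bolt sum3E sum4E !zeta_vect // !bform_vect. Qed.

End Fibration.

Section Horizontal.
Context {R : realType}.
Local Notation amb := ('rV[R]_5 * 'M[R]_5)%type.

Lemma vec3_inj (x y z x' y' z' : R) : vec3 x y z = vec3 x' y' z' ->
  [/\ x = x', y = y' & z = z'].
Proof.
move=> e; have h j := vec3E x y z (j := j).
have := (h 0 isT, h 1 isT, h 2 isT)%N; rewrite e !vec3E //= => -[[-> ->] ->].
by [].
Qed.

Lemma rot_eq (x y X Y C S : R) : C ^+ 2 + S ^+ 2 = 1 ->
  (x * C - y * S = X /\ x * S + y * C = Y) <->
  (x = X * C + Y * S /\ y = - X * S + Y * C).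
Proof.
move=> CS; have {}CS : C ^+ 2 = 1 - S ^+ 2 by rewrite -CS; ring.
by split=> [[<- <-]|[-> ->]]; split; ring: CS.
Qed.

(* The determinant of d pi_c in the horizontal plane of d t and d al is N / w^3. *)
Lemma pic_solve (c t al be w b0 b1 z1 x0 x1 x2 : R) : 0 < w -> c + t ^+ 2 = w ^+ 4 ->
  let N := 2 * (c + t ^+ 2) * cos al ^+ 2 + t ^+ 2 * sin al ^+ 2 in N != 0 ->
  vec3 (cos al * z1 - t * sin al * b0)
      (t * w ^- 3 * z1 * (sin al * cos be)
       + 2 * w * (cos al * b0 * cos be - b1 * sin be))
      (t * w ^- 3 * z1 * (sin al * sin be)
       + 2 * w * (cos al * b0 * sin be + b1 * cos be)) = vec3 x0 x1 x2 <->
  let a := x1 * cos be + x2 * sin be in let b := - x1 * sin be + x2 * cos be in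
  [/\ z1 = (2 * w * cos al * x0 + t * sin al * a) * w ^+ 3 / N,
      b0 = (cos al * a * w ^+ 3 - t * sin al * x0) / N & b1 = b / (2 * w)].
Proof.
move=> w0 Pw; rewrite /= Pw => N0; have wn0 : w != 0 by rewrite gt_eqF.
have hr X Y := rot_eq (t * w ^- 3 * z1 * sin al + 2 * w * (cos al * b0))
  (2 * w * b1) X Y (cos2Dsin2 be).
split=> [/vec3_inj[h0 h1 h2]|[hz hb0 hb1]].
  have [h3 h4] : t * w ^- 3 * z1 * sin al + 2 * w * (cos al * b0) =
      x1 * cos be + x2 * sin be /\ 2 * w * b1 = - x1 * sin be + x2 * cos be.
    by apply/hr; rewrite -h1 -h2; split; ring.
  rewrite -h3 -h4 -h0; split; field; rewrite ?wn0 ?exprMn ?N0 //.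
have [h1 h2] : (t * w ^- 3 * z1 * sin al + 2 * w * (cos al * b0)) * cos be
      - 2 * w * b1 * sin be = x1 /\
    (t * w ^- 3 * z1 * sin al + 2 * w * (cos al * b0)) * sin be
      + 2 * w * b1 * cos be = x2.
  by apply/hr; rewrite hz hb0 hb1; split; field; rewrite ?wn0 ?exprMn ?N0 //.
rewrite -h1 -h2; congr vec3; [|ring|ring].
by rewrite hz hb0; field; rewrite ?wn0 ?exprMn ?N0.
Qed.

(** As g_c is diagonal in the coframe, orthogonality to four explicit vertical vectors kills b2, b3,
    z2 and z3. Conversely N != 0 forces b0 = b1 = z1 = 0 on every vertical vector, by
    [pic_solve]. *)
Lemma horizontalP c (al be th ph t : R) h : 0 < c + t ^+ 2 ->
  2 * (c + t ^+ 2) * cos al ^+ 2 + t ^+ 2 * sin al ^+ 2 != 0 ->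
  horizontal c (frame al be th ph) (bolt t al be th ph) h <->
  exists b0 b1 z1, h = vect al be th ph t b0 b1 0 0 z1 0 0.
Proof.
move=> P0 N0; have ct : c = 0 -> t != 0.
  by move=> c00; move: P0; rewrite c00 add0r; apply: contraTneq => ->; rewrite expr0n ltxx.
have [w [w0 wP w14 w12 [wm12 _ _]]] := powR_quarter P0.
have wn0 : w != 0 by rewrite gt_eqF.
have vertical_of b2 b3 z2 z3 :
    tangent (M c) (bolt t 0 0 0 0) (vect 0 0 0 0 t 0 0 b2 b3 0 z2 z3) ->
    vertical c (bolt t al be th ph) (vect al be th ph t 0 0 b2 b3 0 z2 z3).
  move=> /(tangent_bolt_act al be th ph) ht; split=> //.
  have [_ ->] := is_derive_pic al be th ph 0 0 b2 b3 0 z2 z3 P0.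
  by apply/rowP => j; rewrite !mxE; case: j => -[|[|[|//]]] j3 /=; ring.
split=> [[/tangent_boltP[b0 [b1 [b2 [b3 [z1 [z2 [z3 ->]]]]]]] hv]|[b0 [b1 [z1 ->]]]].
  have h2 := hv _ (vertical_of _ _ _ _ (tangent_bolt_base2 ct)).
  have h3 := hv _ (vertical_of _ _ _ _ (tangent_bolt_base3 ct)).
  have h4 := hv _ (vertical_of _ _ _ _ (tangent_bolt_base45 1 0 ct)).
  have h5 := hv _ (vertical_of _ _ _ _ (tangent_bolt_base45 0 1 ct)).
  move: h2 h3 h4 h5; rewrite !gmet_vect w12 wm12 !(mulr0, mulr1, addr0, add0r).
  have a0 : 2 * w ^+ 2 != 0 by rewrite mulf_neq0 // expf_neq0.
  have d0 : w ^- 2 != 0 by rewrite invr_eq0 expf_neq0.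
  move=> /eqP; rewrite mulf_eq0 (negbTE a0) => /eqP ->.
  move=> /eqP; rewrite mulf_eq0 (negbTE a0) => /eqP ->.
  move=> /eqP; rewrite mulf_eq0 (negbTE d0) => /eqP ->.
  move=> /eqP; rewrite mulf_eq0 (negbTE d0) => /eqP ->.
  by exists b0, b1, z1.
split; first exact: tangent_bolt_act (tangent_bolt_base _ _ _ ct).
move=> v [/tangent_boltP[b0' [b1' [b2 [b3 [z1' [z2 [z3 ->]]]]]]]].
have [_ ->] := is_derive_pic al be th ph b0' b1' b2 b3 z1' z2 z3 P0.
rewrite w14 (_ : 0 = vec3 0 0 0); last first.
  by apply/rowP => j; rewrite !mxE; case: j => -[|[|[|]]].
move=> /(pic_solve _ _ _ _ _ _ _ w0 wP N0)[-> -> ->].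
by rewrite gmet_vect !(mul0r, mulr0, addr0, oppr0, subr0).
Qed.

End Horizontal.

(** * The coordinates (t, cos al) on the base *)

Section Sigma.
Context {R : realType}.
Implicit Types (q : 'rV[R]_3) (c s : R).

Definition vsq q := coord q 1 ^+ 2 + coord q 2 ^+ 2.

Lemma vsq_ge0 q : 0 <= vsq q.
Proof. by rewrite addr_ge0 ?sqr_ge0. Qed.

Lemma angle_2pi (x y : R) : x ^+ 2 + y ^+ 2 = 1 ->
  exists be, [/\ 0 <= be < 2 * pi, x = cos be & y = sin be].
Proof.
move=> e.
have hx : -1 <= x <= 1.
  rewrite -ler_norml -[`|_|]ger0_norm // -sqrtr_sqr -[leRHS]sqrtr1 ler_sqrt //.
  by rewrite real_normK ?num_real // -e lerDl sqr_ge0.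
have cx : cos (acos x) = x by rewrite acosK.
have sx : sin (acos x) = `|y|.
  by rewrite sin_acos // -sqrtr_sqr -e; congr Num.sqrt; ring.
have a0 := acos_ge0 hx; have api := acos_lepi hx; have p0 := pi_gt0 R.
have [y0|y0] := leP 0 y.
  by exists (acos x); rewrite cx sx ger0_norm //; split=> //; lra.
(* Needed to keep 2 pi - acos x strictly below 2 pi. *)
have a1 : 0 < acos x.
  rewrite lt_neqAle a0 andbT eq_sym; apply/eqP => z; move: sx.
  by rewrite z sin0 => /esym/eqP; rewrite normr_eq0 lt_eqF.
exists (- acos x + pi *+ 2).
rewrite cosD2pi sinD2pi cosN sinN cx sx ltr0_norm // opprK mulr2n.
by split=> //; lra.
Qed.

Lemma powR_half c : 0 <= c -> (c `^ (1 / 4)) ^+ 2 = c `^ (1 / 2).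
Proof.
by move=> c0; rewrite -powR_mulrn ?powR_ge0 // -powRrM; congr (_ `^ _); field.
Qed.

Lemma powR_half_sqr c : 0 <= c -> (c `^ (1 / 2)) ^+ 2 = c.
Proof.
move=> c0; rewrite -powR_mulrn ?powR_ge0 // -powRrM.
by rewrite (_ : 1 / 2 * 2 = 1) ?powRr1 //; field.
Qed.

(** One condition covers both cases: for c = 0 the power c^(1/2) is 0 and the circle shrinks to the
    origin. *)
Lemma singP c q : 0 <= c ->
  sing c q <-> (coord q 0 = 0 /\ vsq q = 4 * c `^ (1 / 2)).
Proof.
move=> c0; split=> [[[cp [be [_ ->]]]|[-> ->]]|[h0 hV]].
- rewrite /vsq !vec3E //=; split=> //; rewrite -powR_half //.
  by ring: (cos2E be).
- by rewrite /vsq /coord !mxE powR0 ?expr0n /= ?addr0 ?mulr0 //;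
    rewrite mul1r invr_eq0.
have [cz|cn0] := eqVneq c 0.
  right; split=> //; move: hV; rewrite cz powR0 ?mul1r ?invr_eq0 // mulr0.
  move/eqP; rewrite paddr_eq0 ?sqr_ge0 // !sqrf_eq0 => /andP[/eqP h1 /eqP h2].
  rewrite (vec3_coord q) h0 h1 h2.
  by apply/rowP => j; rewrite !mxE; case: j => -[|[|[|]]].
have cp : 0 < c by rewrite lt_neqAle eq_sym cn0.
left; split=> //; set r := 2 * c `^ (1 / 4).
have r0 : r != 0 by rewrite mulf_neq0 // gt_eqF // powR_gt0.
have [be [hbe h1 h2]] : exists be, [/\ 0 <= be < 2 * pi,
    coord q 1 / r = cos be & coord q 2 / r = sin be].
  apply: angle_2pi; rewrite !expr_div_n -mulrDl -/(vsq q) hV /r exprMn.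
  rewrite powR_half // -natrX divff // mulf_neq0 // gt_eqF // powR_gt0 //.
exists be; split=> //; rewrite -/r -h1 -h2 (vec3_coord q) !vec3E //= h0.
by congr vec3; rewrite mulrC divfK.
Qed.

Lemma regP c q : 0 <= c ->
  reg c q <-> ~ (coord q 0 = 0 /\ vsq q = 4 * c `^ (1 / 2)).
Proof. by move=> c0; split=> h /(singP _ c0). Qed.

(** Here s stands for (c + t^2)^(1/2). With t^2 = s^2 - c and cos^2 al = 1 - v^2 / (4 s), the
    equation says t^2 cos^2 al = u^2, and the inequalities say that both squares are nonnegative. *)
Definition is_sigma c q s := [/\ 0 < s, c <= s ^+ 2, vsq q <= 4 * s
  & (s ^+ 2 - c) * (4 * s - vsq q) = 4 * s * coord q 0 ^+ 2].

(** Divided by s, the expression is the product of s^2 - c, which is strictly increasing, and 4 - v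
    / s, which is nondecreasing and positive at s2; both are nonnegative at s1. *)
Lemma sigma_mono c (v s1 s2 : R) : 0 <= v -> 0 < s1 -> s1 < s2 ->
  c <= s1 ^+ 2 -> v <= 4 * s1 ->
  (s1 ^+ 2 - c) * (4 * s1 - v) * s2 < (s2 ^+ 2 - c) * (4 * s2 - v) * s1.
Proof.
move=> v0 s10 s12 c1 v1.
have s20 := lt_trans s10 s12.
have h1 : (4 * s1 - v) * s2 <= (4 * s2 - v) * s1.
  have : v * s1 <= v * s2 by rewrite ler_wpM2l // ltW.
  by lra.
have h2 : s1 ^+ 2 < s2 ^+ 2 by rewrite ltr_pXn2r // ?nnegrE ltW.
have h3 : 0 < (4 * s2 - v) * s1 by rewrite mulr_gt0 //; lra.
rewrite -!mulrA; apply: (@le_lt_trans _ _ ((s1 ^+ 2 - c) * ((4 * s2 - v) * s1))).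
  by rewrite ler_wpM2l // subr_ge0.
by rewrite ltr_pM2r // ltrD2r.
Qed.

Lemma sigma_unique c q s1 s2 : is_sigma c q s1 -> is_sigma c q s2 -> s1 = s2.
Proof.
wlog s12 : s1 s2 / s1 < s2 => [h h1 h2|[p1 c1 v1 e1] [p2 c2 v2 e2]].
  by case: (ltgtP s1 s2) => // s12; [exact: h|symmetry; exact: h].
have := sigma_mono (vsq_ge0 q) p1 s12 c1 v1; rewrite e1 e2.
by rewrite (_ : 4 * s1 * _ * _ = 4 * s2 * coord q 0 ^+ 2 * s1) ?ltxx //; ring.
Qed.

Lemma sigma_exists c q : 0 <= c -> reg c q -> exists s, is_sigma c q s.
Proof.
move=> c0 /regP - /(_ c0) hq.
set u := coord q 0; set v := vsq q.
have v0 : 0 <= v := vsq_ge0 q.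
pose sc := c `^ (1 / 2); have sc0 : 0 <= sc by exact: powR_ge0.
have sc2 : sc ^+ 2 = c by exact: powR_half_sqr.
(* The least s that the two inequalities of [is_sigma] allow; one of the factors s^2 - c and 4 s - v
   vanishes there. *)
pose m := Num.max sc (v / 4).
have msc : sc <= m by rewrite le_max lexx.
have mv : v / 4 <= m by rewrite le_max lexx orbT.
(* If m = 0, then c and v vanish, the endpoint fails 0 < s, and the root |u| is explicit. *)
have [m0|m0] := eqVneq m 0.
  have scz : sc = 0 by apply/eqP; rewrite eq_le sc0 -{1}m0 msc.
  have vz : v = 0 by apply/eqP; rewrite eq_le v0 andbT; move: mv; rewrite m0; lra.
  have cz : c = 0 by rewrite -sc2 scz expr0n.
  have u0 : u != 0.
    by apply/eqP => u0; apply: hq; rewrite -/u -/v -/sc u0 vz scz mulr0.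
  exists `|u|; rewrite /is_sigma -/u -/v normr_gt0 u0 vz cz.
  rewrite real_normK ?num_real // sqr_ge0 mulr_ge0 //.
  by split=> //; ring.
have mp : 0 < m by rewrite lt_neqAle eq_sym m0 (le_trans sc0).
pose f s := (s ^+ 2 - c) * (4 * s - v) - 4 * s * u ^+ 2.
have fc : {within `[m, m + `|u|], continuous f}.
  apply: continuous_subspaceT => s.
  have hid : is_derive s 1 (fun s : R => s) 1 by exact: is_derive_id.
  have hC a := derC s (1 : R) (a : R).
  have [h _] := derB (derM (derB (derX 1 hid) (hC c)) (derB (derM (hC 4) hid) (hC v)))
    (derM (derM (hC 4) hid) (hC (u ^+ 2))).
  by apply: differentiable_continuous; apply/derivable1_diffP.
have u0 := normr_ge0 u.
have mm : m <= m + `|u| by rewrite lerDl.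
have m2 : m ^+ 2 = sc ^+ 2 \/ 4 * m = v.
  by rewrite /m; case: (leP sc (v / 4)) => _; [right; field|left].
have fm : f m <= 0.
  have -> : f m = - (4 * m * u ^+ 2).
    by rewrite /f; case: m2 => ->; rewrite ?sc2 ?subrr ?mul0r ?mulr0 ?sub0r.
  by rewrite oppr_le0 mulr_ge0 ?sqr_ge0 // mulr_ge0 // ltW.
have cm : c <= m ^+ 2 by rewrite -sc2 ler_pXn2r ?nnegrE // ltW.
(* At b = m + |u| the two factors are at least |u| b and 4 |u|, so their product is at least 4 b
   u^2. *)
have fb : 0 <= f (m + `|u|).
  set b := m + `|u|.
  have h1 : `|u| * b <= b ^+ 2 - c.
    have : b ^+ 2 - m ^+ 2 = `|u| * b + `|u| * m by rewrite /b; ring.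
    have : 0 <= `|u| * m by rewrite mulr_ge0 // ltW.
    by lra.
  have h2 : 4 * `|u| <= 4 * b - v by rewrite /b; lra.
  rewrite subr_ge0 -[u ^+ 2]real_normK ?num_real //.
  rewrite (_ : 4 * b * _ = (`|u| * b) * (4 * `|u|)); last by ring.
  by apply: ler_pM => //; rewrite mulr_ge0 // /b addr_ge0 // ltW.
have [s /[!in_itv]/= /andP[ms _] fs] : exists2 s, s \in `[m, m + `|u|] & f s = 0.
  apply: IVT => //; rewrite ge_min le_max fm fb orbT //.
exists s; split.
- exact: lt_le_trans ms.
- by apply: le_trans cm _; rewrite ler_pXn2r ?nnegrE // ltW // (lt_le_trans mp).
- by rewrite -/v; lra.
- by apply/eqP; rewrite -subr_eq0; apply/eqP.
Qed.

Definition sigma c q : R := xget 0 [set s | is_sigma c q s].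

Lemma sigmaP c q : 0 <= c -> reg c q -> is_sigma c q (sigma c q).
Proof.
move=> c0 /(sigma_exists c0)[s hs]; rewrite /sigma.
by case: xgetP => [x _ //|/(_ s)].
Qed.

Lemma sigmaE c q s : is_sigma c q s -> sigma c q = s.
Proof.
move=> hs; rewrite /sigma; case: xgetP => [x _ hx|/(_ s) //].
exact: sigma_unique hx hs.
Qed.

End Sigma.

(* Stated over an abstract topological space: the unifier unfolds the
   neighbourhood filter of a concrete matrix space. *)
Section Limits.
Context {R : realType} {V : topologicalType}.
Implicit Types (f g : V -> R) (x : V).

Lemma ctsC x (a : R) : (fun=> a) y @[y --> x] --> a.
Proof. exact: cvg_cst. Qed.

Lemma ctsD x f g : f y @[y --> x] --> f x -> g y @[y --> x] --> g x ->
  f y + g y @[y --> x] --> f x + g x.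
Proof. exact: cvgD. Qed.

Lemma ctsB x f g : f y @[y --> x] --> f x -> g y @[y --> x] --> g x ->
  f y - g y @[y --> x] --> f x - g x.
Proof. exact: cvgB. Qed.

Lemma ctsN x f : f y @[y --> x] --> f x -> - f y @[y --> x] --> - f x.
Proof. exact: cvgN. Qed.

Lemma ctsM x f g : f y @[y --> x] --> f x -> g y @[y --> x] --> g x ->
  f y * g y @[y --> x] --> f x * g x.
Proof. exact: cvgM. Qed.

Lemma ctsV x f : f x != 0 -> f y @[y --> x] --> f x ->
  (f y)^-1 @[y --> x] --> (f x)^-1.
Proof. exact: cvgV. Qed.

Lemma cts_comp x f (h : R -> R) : {for f x, continuous h} ->
  f y @[y --> x] --> f x -> h (f y) @[y --> x] --> h (f x).
Proof. by move=> hc hf; apply: (cvg_comp _ _ hf); exact: hc. Qed.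

Lemma cts_near x f g : (\near x, f x = g x) ->
  f y @[y --> x] --> f x -> g y @[y --> x] --> g x.
Proof.
move=> fg; rewrite (nbhs_singleton fg); apply: cvg_trans.
exact: near_eq_cvg.
Qed.

Lemma cts_lt x f a : f y @[y --> x] --> f x -> f x < a -> \near x, f x < a.
Proof. by move=> h; exact: (cvgr_lt _ h). Qed.

Lemma cts_gt x f a : f y @[y --> x] --> f x -> a < f x -> \near x, a < f x.
Proof. by move=> h; exact: (cvgr_gt _ h). Qed.

Lemma cts_dist x f : (forall e, 0 < e ->
    (\forall y \near x, f y < f x + e) /\ (\forall y \near x, f x - e < f y)) ->
  f y @[y --> x] --> f x.
Proof.
move=> h; apply/cvgrPdist_lt => e /h[h1 h2]; near=> y.
rewrite ltr_norml; apply/andP; split.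
- have : f y < f x + e by near: y.
  by lra.
- have : f x - e < f y by near: y.
  by lra.
Unshelve. all: by end_near. Qed.

End Limits.

(** * Continuity of [sigma] and of acos *)

Section Continuity.
Context {R : realType}.
Implicit Types (q : 'rV[R]_3) (c s : R).

Lemma coord_cvg n (q : 'rV[R]_n.+1) j : coord p j @[p --> q] --> coord q j.
Proof. exact: coord_continuous. Qed.

Lemma vsq_cvg q : vsq p @[p --> q] --> vsq q.
Proof.
have -> : vsq = (fun p : 'rV[R]_3 => coord p 1 * coord p 1 + coord p 2 * coord p 2).
  by apply/funext => p; rewrite /vsq !expr2.
by apply: ctsD; apply: ctsM; exact: coord_cvg.
Qed.

Lemma reg_near c q : 0 <= c -> reg c q -> \near q, reg c q.
Proof.
move=> c0 /(regP _ c0) hq.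
pose k := 4 * c `^ (1 / 2).
(* A continuous function whose zeros are exactly the singular points. *)
pose F p := coord p 0 * coord p 0 + (vsq p - k) * (vsq p - k).
have hF : F p @[p --> q] --> F q.
  by apply: ctsD; apply: ctsM; [exact: coord_cvg..|apply: ctsB|apply: ctsB];
    by [exact: vsq_cvg|exact: ctsC].
have F0 : 0 < F q.
  rewrite lt_neqAle /F -!expr2 addr_ge0 ?sqr_ge0 // andbT eq_sym.
  rewrite paddr_eq0 ?sqr_ge0 // !sqrf_eq0 subr_eq0.
  by apply/negP => /andP[/eqP h1 /eqP h2]; apply: hq.
near=> p; apply/regP => // -[h1 h2].
have : 0 < F p by near: p; exact: (cts_gt hF F0).
by rewrite /F h1 h2 subrr !mulr0 addr0 ltxx.
Unshelve. all: by end_near. Qed.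

(** Its sign at a trial value r tells on which side of the root r lies. For fixed r it is continuous
    in q, so strict bounds on the root persist near q. *)
Definition sigma_gap c (r : R) q :=
  (r ^+ 2 - c) * (4 * r - vsq q) - 4 * r * (coord q 0 * coord q 0).

Lemma sigma_gap_cvg c r q : sigma_gap c r p @[p --> q] --> sigma_gap c r q.
Proof.
apply: ctsB; apply: ctsM; [exact: ctsC| |exact: ctsC|].
  by apply: ctsB; [exact: ctsC|exact: vsq_cvg].
by apply: ctsM; exact: coord_cvg.
Qed.

Lemma sigma_gapP c q s r : is_sigma c q s -> 0 < r -> c <= r ^+ 2 ->
  vsq q <= 4 * r ->
  (0 < sigma_gap c r q) = (s < r) /\ (sigma_gap c r q < 0) = (r < s).
Proof.
move=> [s0 cs vs es] r0 cr vr.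
have [sr|rs|<-] := ltgtP s r.
- have := sigma_mono (vsq_ge0 q) s0 sr cs vs; rewrite es => h.
  have : 0 < sigma_gap c r q.
    by rewrite -(pmulr_lgt0 _ s0) /sigma_gap mulrBl subr_gt0; apply: le_lt_trans h;
       rewrite le_eqVlt; apply/orP; left; apply/eqP; ring.
  by move=> h1; rewrite h1 (lt_gtF h1).
- have := sigma_mono (vsq_ge0 q) r0 rs cr vr; rewrite es => h.
  have : sigma_gap c r q < 0.
    rewrite -(pmulr_llt0 _ s0) /sigma_gap mulrBl subr_lt0; apply: lt_le_trans h _.
    by rewrite le_eqVlt; apply/orP; left; apply/eqP; ring.
  by move=> h1; rewrite h1 (lt_gtF h1).
- by rewrite /sigma_gap es expr2 subrr ltxx.
Qed.

(** The bounds s + e and s - e are passed on to nearby points by the sign of [sigma_gap]. Where s -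
    e is not an admissible trial value, the inequality that it violates bounds the nearby roots from
    below. *)
Lemma sigma_continuous c q : 0 <= c -> reg c q ->
  sigma c p @[p --> q] --> sigma c q.
Proof.
move=> c0 rq; have sq := sigmaP c0 rq; have [s0 cs vs _] := sq.
set s := sigma c q in s0 cs vs sq *.
have rn := reg_near c0 rq.
apply: cts_dist => e e0; rewrite -/s; split.
- have se0 : 0 < s + e by rewrite addr_gt0.
  have cse : c <= (s + e) ^+ 2.
    by apply: le_trans cs _; rewrite ler_pXn2r ?nnegrE ?ltW // ltrDl.
  have vse : vsq q < 4 * (s + e) by lra.
  have [g1 _] := sigma_gapP sq se0 cse (ltW vse).
  have g0 : 0 < sigma_gap c (s + e) q by rewrite g1 ltrDl.
  near=> p.
  have rp : reg c p by near: p.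
  have vp : vsq p < 4 * (s + e) by near: p; exact: (cts_lt (vsq_cvg (q := q))).
  have gp : 0 < sigma_gap c (s + e) p.
    by near: p; exact: (cts_gt (@sigma_gap_cvg _ _ q)).
  by have [<- _] := sigma_gapP (sigmaP c0 rp) se0 cse (ltW vp).
- have [sen|se0] := leP (s - e) 0.
    near=> p; have rp : reg c p by near: p.
    by have [h _ _ _] := sigmaP c0 rp; exact: le_lt_trans sen h.
  have [sec|cse] := ltP ((s - e) ^+ 2) c.
    near=> p; have rp : reg c p by near: p.
    have [h hc _ _] := sigmaP c0 rp.
    rewrite -(ltr_pXn2r (n := 2)) ?nnegrE ?ltW //.
    exact: lt_le_trans sec hc.
  have [vse|vse] := ltP (4 * (s - e)) (vsq q).
    near=> p; have rp : reg c p by near: p.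
    have vp : 4 * (s - e) < vsq p by near: p; exact: (cts_gt (vsq_cvg (q := q))).
    by have [_ _ h _] := sigmaP c0 rp; lra.
  have [_ g1] := sigma_gapP sq se0 cse vse.
  have g0 : sigma_gap c (s - e) q < 0 by rewrite g1; lra.
  near=> p; have rp : reg c p by near: p.
  have gp : sigma_gap c (s - e) p < 0.
    by near: p; exact: (cts_lt (@sigma_gap_cvg _ _ q)).
  (* Equality is possible at q, so the inequality need not persist at p. *)
  have [vp|vp] := leP (vsq p) (4 * (s - e)).
    by have [_ <-] := sigma_gapP (sigmaP c0 rp) se0 cse vp.
  by have [_ _ h _] := sigmaP c0 rp; lra.
Unshelve. all: by end_near. Qed.

(** Continuity up to the values - 1 and 1, which occur at al = pi and al = 0; it rests on the strict
    monotonicity of cos on [0, pi]. *)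
Lemma acos_cvg (V : topologicalType) (f : V -> R) (x : V) :
  (\near x, -1 <= f x <= 1) -> f y @[y --> x] --> f x ->
  acos (f y) @[y --> x] --> acos (f x).
Proof.
move=> fb fx; have fbx := nbhs_singleton fb.
have a0 := acos_ge0 fbx; have a1 := acos_lepi fbx.
have aK y : -1 <= y <= 1 -> cos (acos y) = y :> R by move=> ?; rewrite acosK.
have inD y : -1 <= y <= 1 -> acos y \in `[0, pi].
  by move=> hy; rewrite in_itv /= acos_ge0 ?acos_lepi.
apply: cts_dist => e e0; split.
- have [h|h] := ltP pi (acos (f x) + e).
    near=> y; have fy : -1 <= f y <= 1 by near: y.
    exact: le_lt_trans (acos_lepi fy) h.
  have inE : acos (f x) + e \in `[0, pi] by rewrite in_itv /= h andbT addr_ge0 // ltW.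
  have hc : cos (acos (f x) + e) < f x.
    by rewrite -[ltRHS]aK // ltr_cos ?inD // ltrDl.
  near=> y; have fy : -1 <= f y <= 1 by near: y.
  have : cos (acos (f x) + e) < f y by near: y; exact: (cts_gt fx hc).
  by rewrite -[in ltRHS](aK _ fy) ltr_cos ?inD.
- have [h|h] := ltP (acos (f x) - e) 0.
    near=> y; have fy : -1 <= f y <= 1 by near: y.
    exact: lt_le_trans h (acos_ge0 fy).
  have inE : acos (f x) - e \in `[0, pi].
    by rewrite in_itv /= h /= lerBlDr; apply: le_trans a1 _; rewrite lerDl ltW.
  have hc : f x < cos (acos (f x) - e).
    by rewrite -[ltLHS]aK // ltr_cos ?inD // ltrBlDr ltrDl.
  near=> y; have fy : -1 <= f y <= 1 by near: y.
  have : f y < cos (acos (f x) - e) by near: y; exact: (cts_lt fx hc).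
  by rewrite -[in ltLHS](aK _ fy) ltr_cos ?inD.
Unshelve. all: by end_near. Qed.

End Continuity.

(** * Which (t, al, be) describe the bolt over q *)

Section Charts.
Context {R : realType}.
Implicit Types (q : 'rV[R]_3) (c t : R).

Lemma pic_bolt c (t al be th ph : R) : let w := (c + t ^+ 2) `^ (1 / 4) in
  pic c (bolt t al be th ph) =
  vec3 (t * cos al) (2 * w * (sin al * cos be)) (2 * w * (sin al * sin be)).
Proof. by rewrite /pic piu_mpt r2_bolt boltE /= !cvec5 // vec3E. Qed.

(* C is cos al. *)
Definition chart c q t (C : R) := [/\ 0 < c + t ^+ 2, t * C = coord q 0
  & 4 * (c + t ^+ 2) `^ (1 / 2) * (1 - C ^+ 2) = vsq q].

Lemma chart_pos c t : 0 <= c -> (c = 0 -> t != 0) <-> 0 < c + t ^+ 2.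
Proof.
move=> c0; split=> [h|h cz].
  have [cz|cn] := eqVneq c 0; first by rewrite cz add0r exprn_even_gt0 ?h.
  by rewrite ltr_pwDl ?sqr_ge0 // lt_neqAle eq_sym cn.
by apply: contraTneq h => ->; rewrite cz expr0n addr0 ltxx.
Qed.

Lemma chart_sigma c q t C : 0 <= c -> chart c q t C ->
  is_sigma c q ((c + t ^+ 2) `^ (1 / 2)).
Proof.
move=> c0 [P0 hu hv]; set s := _ `^ _.
have s0 : 0 < s by rewrite powR_gt0.
have s2 : s ^+ 2 = c + t ^+ 2 by rewrite powR_half_sqr // ltW.
split=> //.
- by rewrite s2 lerDl sqr_ge0.
- by rewrite -hv -/s -[leRHS]mulr1 ler_pM2l ?mulr_gt0 // gerBl sqr_ge0.
- by rewrite s2 -hv -hu -/s; ring.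
Qed.

(** The common root s fixes t^2 and then C^2, and t C = u ties the two signs together. If t = 0,
    only the sign of C is at stake and t = - t fits either alternative. *)
Lemma chart_unique c q t C t' C' : 0 <= c ->
  chart c q t C -> chart c q t' C' ->
  (t' = t /\ C' = C) \/ (t' = - t /\ C' = - C).
Proof.
move=> c0 h h'; have hs := sigma_unique (chart_sigma c0 h) (chart_sigma c0 h').
case: h h' => P0 hu hv [P0' hu' hv'].
have s0 : 0 < (c + t ^+ 2) `^ (1 / 2) by rewrite powR_gt0.
have t2 : t' ^+ 2 = t ^+ 2.
  have := powR_half_sqr (ltW P0); rewrite hs powR_half_sqr ?(ltW P0') //.
  by move=> /addrI.
have C2 : C' ^+ 2 = C ^+ 2.
  move: hv'; rewrite -hv t2 => /mulfI h.
  have {}h : 1 - C' ^+ 2 = 1 - C ^+ 2 by apply: h; rewrite mulf_neq0 // gt_eqF.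
  by lra.
have /orP[/eqP te|/eqP te] : (t' == t) || (t' == - t) by rewrite -eqf_sqr t2.
  have [tz|tn] := eqVneq t 0.
    have /orP[/eqP ->|/eqP ->] : (C' == C) || (C' == - C) by rewrite -eqf_sqr C2.
      by left.
    by right; rewrite te tz oppr0.
  by left; split=> //; apply: (mulfI tn); rewrite hu -hu' te.
have [tz|tn] := eqVneq t 0.
  have /orP[/eqP ->|/eqP ->] : (C' == C) || (C' == - C) by rewrite -eqf_sqr C2.
    by left; rewrite te tz oppr0.
  by right.
by right; split=> //; apply: (mulfI tn); rewrite mulrN hu -hu' te mulNr opprK.
Qed.

Lemma bolt_chart c q (t al be th ph : R) : 0 <= c ->
  M c (bolt t al be th ph) -> pic c (bolt t al be th ph) = q ->
  chart c q t (cos al).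
Proof.
move=> c0 /M_bolt /(chart_pos _ c0) P0 <-; rewrite pic_bolt.
split=> //; rewrite ?/vsq !vec3E //=.
by rewrite -powR_half ?(ltW P0) //; ring: (cos2E al) (cos2E be).
Qed.

(** Each entry of [boltE] is even under (t, C, n) |-> (- t, - C, - n). The change of (th, ph) is the
    antipodal map of the sphere, which reverses its orientation. *)
Lemma bolt_of_cos (t t' al al' be be' th ph : R) :
  t' = - t -> cos al' = - cos al ->
  sin al' * cos be' = sin al * cos be -> sin al' * sin be' = sin al * sin be ->
  bolt t' al' be' th ph = bolt t al be (pi - th) (ph + pi).
Proof.
move=> ht hC h1 h2; rewrite !boltE h1 h2 ht hC.
rewrite addrC cosDpi sinDpi cosN sinN cosDpi sinDpi.
by congr (_, _); [congr vec5|congr asym5]; ring.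
Qed.

Lemma bolt_same_cos (t al al' be be' th ph : R) : cos al' = cos al ->
  sin al' * cos be' = sin al * cos be -> sin al' * sin be' = sin al * sin be ->
  bolt t al' be' th ph = bolt t al be th ph.
Proof. by move=> hC h1 h2; rewrite !boltE h1 h2 hC. Qed.

Lemma spherical (x y z : R) : exists r th ph,
  [/\ x = r * cos th, y = r * (sin th * cos ph) & z = r * (sin th * sin ph)].
Proof.
have [r1 [ph [_ e1 e2]]] := polar y z.
have [r [th [_ e3 e4]]] := polar x r1.
by exists r, th, ph; rewrite e1 e2 e3 e4 !mulrA.
Qed.

(** The product s |cos al| vanishes in two ways. If s = 0, the coordinates already have the required
    form. If cos al = 0, then th and ph do not move the point of S^4, and the whole fibre R^3 over
    it is swept out by spherical coordinates (r, th', ph') with r in the role of t. *)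
Lemma B_is_bolt c m : B c m -> exists t al be th ph, m = bolt t al be th ph.
Proof.
move=> [[[al [be [th [ph [a ->]]]]] _]]; rewrite rho_mpt => /eqP.
rewrite mulf_eq0 => /orP[|].
  rewrite sqrtr_eq0 => h.
  have : (coord a 1 ^+ 2 + coord a 2 ^+ 2 == 0).
    by rewrite eq_le h addr_ge0 ?sqr_ge0.
  rewrite paddr_eq0 ?sqr_ge0 // !sqrf_eq0 => /andP[/eqP a1 /eqP a2].
  by exists (coord a 0), al, be, th, ph; rewrite /bolt [in LHS](vec3_coord a) a1 a2.
rewrite normr_eq0 => /eqP ca.
have s2 : sin al ^+ 2 = 1 by have := cos2E al; rewrite ca expr0n /=; lra.
have [r [th' [ph' [e0 e1 e2]]]] := spherical (coord a 0 * cos th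
    + coord a 1 * sin al * 0 - coord a 2 * sin al * (- sin th))
  (coord a 0 * (sin th * cos ph) + coord a 1 * sin al * (- sin ph)
    - coord a 2 * sin al * (cos th * cos ph))
  (coord a 0 * (sin th * sin ph) + coord a 1 * sin al * cos ph
    - coord a 2 * sin al * (cos th * sin ph)).
exists r, al, be, th', ph'; rewrite boltE /=.
rewrite (surjective_pairing (mpt _ _ _ _ _)) mpt2E /Omega !inordK //= !row_frame //=.
rewrite !wedge2_vec5 !asym5N !asym5D !asym5Z !asym5D.
move/esym in e0; move/esym in e1; move/esym in e2.
congr (_, _); [rewrite /sph ca; congr vec5; ring|].
move: e1 e2; rewrite ca; set n1 := sin th' * cos ph'; set n2 := sin th' * sin ph'.
move: n1 n2 => n1 n2 e1 e2.
by congr asym5; rewrite ?(mulrN r) ?(mulNr, mulrN r) ?(mulrA r) ?e0 ?e1 ?e2;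
  ring: s2 (cos2E be) (cos2E th) (cos2E ph).
Qed.

(* (t, al) and (- t, pi - al) are the only coordinates of a given bolt. *)
Lemma fiber_bolt c q (t al be : R) m : 0 <= c -> reg c q ->
  chart c q t (cos al) -> pic c (bolt t al be 0 0) = q ->
  B c m -> pic c m = q -> exists th ph, m = bolt t al be th ph.
Proof.
move=> c0 rq hq pq Bm pm; have [t' [al' [be' [th [ph me]]]]] := B_is_bolt Bm.
have hq' : chart c q t' (cos al').
  by apply: (bolt_chart (be := be') (th := th) (ph := ph)) c0 _ _; rewrite -me //;
    case: Bm.
have [P0 _ _] := hq; have [w [w0 _ w14 _ _]] := powR_quarter P0.
have h2w : 2 * w != 0 by rewrite mulf_neq0 // gt_eqF.
have tt : t' ^+ 2 = t ^+ 2.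
  by have [[-> _]|[-> _]] := chart_unique c0 hq hq'; rewrite ?sqrrN.
move: pm; rewrite me -pq !pic_bolt tt w14 => /vec3_inj[_ /(mulfI h2w) h1 /(mulfI h2w) h2].
have [[e1 e2]|[e1 e2]] := chart_unique c0 hq hq'.
  by exists th, ph; rewrite e1; exact: bolt_same_cos.
by exists (pi - th), (ph + pi); exact: bolt_of_cos.
Qed.

(** By [fiber_bolt], the equality of a whole bolt with the part of B over q amounts to pi_c taking
    the value q at one of its points. *)
Lemma bolt_coordsP c (T Al Be : 'rV[R]_3 -> R) : 0 <= c ->
  bolt_coords c T Al Be <-> forall q, reg c q ->
    [/\ 0 <= Al q <= pi, chart c q (T q) (cos (Al q))
      & pic c (bolt (T q) (Al q) (Be q) 0 0) = q].
Proof.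
move=> c0; split=> h q rq; have := h q rq.
  move=> [hA e]; have [Bm pm] : [set m | B c m /\ pic c m = q] (bolt (T q) (Al q) (Be q) 0 0).
    by rewrite -e; exists 0 => //; exists 0.
  by split=> //; apply: bolt_chart c0 _ pm; case: Bm.
move=> [hA hq pq]; split=> //; apply/seteqP; split=> [_ [th _ [ph _ <-]]|m [Bm pm]] /=.
  have [P0 _ _] := hq; rewrite -[RHS]pq !pic_bolt; split=> //.
  by apply/B_bolt; exact/chart_pos.
by have [th [ph ->]] := fiber_bolt c0 rq hq pq Bm pm; exists th => //; exists ph.
Qed.

End Charts.

(** * Existence of coordinates on the base *)

Section CoordinatesExist.
Context {R : realType}.
Implicit Types (q : 'rV[R]_3) (c t : R).

Lemma powR_sqr_half (s : R) : 0 <= s -> (s ^+ 2) `^ (1 / 2) = s.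
Proof.
move=> s0; apply/eqP; rewrite -(eqrXn2 (n := 2)) ?powR_ge0 //.
by rewrite powR_half_sqr ?sqr_ge0.
Qed.

Lemma chart_of_sigma c q s t C : is_sigma c q s -> t ^+ 2 = s ^+ 2 - c ->
  C ^+ 2 = 1 - vsq q / (4 * s) -> t * C = coord q 0 -> chart c q t C.
Proof.
move=> [s0 _ _ _] ht hC hu.
have P : c + t ^+ 2 = s ^+ 2 by rewrite ht; ring.
rewrite /chart P exprn_gt0 // hC hu powR_sqr_half ?ltW //; split=> //.
by field; rewrite gt_eqF.
Qed.

Lemma chart_cos c q t C : 0 <= c -> chart c q t C -> -1 <= C <= 1.
Proof.
move=> c0 [P0 _ hV].
have h : 0 <= 1 - C ^+ 2.
  rewrite -(pmulr_rge0 _ (x := 4 * (c + t ^+ 2) `^ (1 / 2))) ?hV ?vsq_ge0 //.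
  by rewrite mulr_gt0 // powR_gt0.
rewrite -ler_norml -(ler_pXn2r (n := 2)) ?nnegrE // real_normK ?num_real //.
by rewrite expr1n; lra.
Qed.

(** Be is a polar angle of (q_1, q_2), picked by choice: [coherent] constrains only T and Al. *)
Lemma bolt_coords_of_chart c (T C : 'rV[R]_3 -> R) : 0 <= c ->
  (forall q, reg c q -> chart c q (T q) (C q)) ->
  exists Be, bolt_coords c T (fun q => acos (C q)) Be.
Proof.
move=> c0 h.
have /choice[Be hBe] : forall q, exists be,
    reg c q -> pic c (bolt (T q) (acos (C q)) be 0 0) = q.
  move=> q; have [r [be [r0 e1 e2]]] := polar (coord q 1) (coord q 2).
  exists be => rq; have hq := h q rq; have hC := chart_cos c0 hq.
  have [P0 hu hV] := hq.
  rewrite pic_bolt acosK // hu [RHS]vec3_coord e1 e2 !mulrA.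
  suff -> : 2 * (c + T q ^+ 2) `^ (1 / 4) * sin (acos (C q)) = r by [].
  (* Both sides are nonnegative, since acos takes values in [0, pi], so their squares may be
     compared. *)
  apply/eqP; rewrite -(eqrXn2 (n := 2)) //; last first.
    by rewrite mulr_ge0 ?mulr_ge0 ?powR_ge0 // sin_acos // sqrtr_ge0.
  rewrite !exprMn powR_half ?(ltW P0) // sin_acos // sqr_sqrtr; last first.
    by rewrite subr_ge0 -[leRHS](expr1n _ 2) -real_normK ?num_real //
      ler_pXn2r ?nnegrE // ler_norml.
  rewrite -natrX hV /vsq e1 e2; apply/eqP.
  by ring: (cos2E be).
exists Be; apply/bolt_coordsP => // q rq; split; last exact: hBe.
- have hC := chart_cos c0 (h q rq).
  by rewrite acos_ge0 // acos_lepi.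
- by rewrite acosK; [exact: h|rewrite in_itv /= (chart_cos c0 (h q rq))].
Qed.

(** The absolute values |t| and |cos al|, which unlike t and cos al are continuous functions of q on
    all of [reg c]. *)
Definition tabs c q := Num.sqrt (sigma c q ^+ 2 - c).
Definition cabs c q := Num.sqrt (1 - vsq q / (4 * sigma c q)).

Lemma tabs_cabs c q : 0 <= c -> reg c q ->
  [/\ tabs c q ^+ 2 = sigma c q ^+ 2 - c,
      cabs c q ^+ 2 = 1 - vsq q / (4 * sigma c q)
    & tabs c q ^+ 2 * cabs c q ^+ 2 = coord q 0 ^+ 2].
Proof.
move=> c0 rq; have [s0 cs vs es] := sigmaP c0 rq.
have sn : sigma c q != 0 by rewrite gt_eqF.
have ht : tabs c q ^+ 2 = sigma c q ^+ 2 - c by rewrite sqr_sqrtr // subr_ge0.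
have hC : cabs c q ^+ 2 = 1 - vsq q / (4 * sigma c q).
  by rewrite sqr_sqrtr // subr_ge0 ler_pdivrMr ?mulr_gt0 // mul1r.
split=> //; rewrite ht hC.
have h4 : 4 * sigma c q != 0 by rewrite mulf_neq0.
apply: (mulfI h4); rewrite -es; field.
exact: sn.
Qed.

Lemma cts_sqrt (V : topologicalType) (f : V -> R) x : f y @[y --> x] --> f x ->
  Num.sqrt (f y) @[y --> x] --> Num.sqrt (f x).
Proof. by apply: cts_comp; exact: sqrt_continuous. Qed.

Lemma tabs_cvg c q : 0 <= c -> reg c q -> tabs c p @[p --> q] --> tabs c q.
Proof.
move=> c0 rq; have h := sigma_continuous c0 rq; apply: cts_sqrt.
by apply: ctsB; [rewrite /=; apply: ctsM|exact: ctsC].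
Qed.

Lemma cabs_cvg c q : 0 <= c -> reg c q -> cabs c p @[p --> q] --> cabs c q.
Proof.
move=> c0 rq; have h := sigma_continuous c0 rq; apply: cts_sqrt.
have [s0 _ _ _] := sigmaP c0 rq.
apply: ctsB; [exact: ctsC|apply: ctsM; [exact: vsq_cvg|apply: ctsV]].
  by rewrite mulf_neq0 // gt_eqF.
by apply: ctsM; [exact: ctsC|].
Qed.

Lemma rot_coords ps q : [/\ coord (rot ps q) 0 = coord q 0,
  coord (rot ps q) 1 = cos ps * coord q 1 - sin ps * coord q 2,
  coord (rot ps q) 2 = sin ps * coord q 1 + cos ps * coord q 2
  & vsq (rot ps q) = vsq q].
Proof.
rewrite /vsq /rot !vec3E //=; split=> //.
by ring: (cos2E ps).
Qed.

Lemma rot_reg c ps q : 0 <= c -> reg c q -> reg c (rot ps q).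
Proof.
move=> c0 /(regP _ c0) h; apply/regP => //.
by have [-> _ _ ->] := rot_coords ps q.
Qed.

Lemma rot_sigma c ps q : sigma c (rot ps q) = sigma c q.
Proof.
rewrite /sigma; congr xget; apply/seteqP.
by split=> s; rewrite /= /is_sigma; have [-> _ _ ->] := rot_coords ps q.
Qed.

Lemma open_of_near (V : topologicalType) (U : set V) :
  (forall x : V, U x -> \forall y \near x, U y) -> open U.
Proof. by move=> h; rewrite openE => x Ux; exact: h. Qed.

Lemma near_reg_gt c (f : 'rV[R]_3 -> R) q : 0 <= c -> reg c q ->
  f p @[p --> q] --> f q -> 0 < f q -> \forall p \near q, reg c p /\ 0 < f p.
Proof.
move=> c0 rq fq f0; near=> p; split; first by near: p; exact: reg_near.
by near: p; exact: (cts_gt fq f0).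
Unshelve. all: by end_near. Qed.

(* Coordinates with cos al > 0, defined off the half-planes u = 0, v >= 2 c^(1/4). *)
Lemma coords_cos_pos c : 0 <= c -> exists T Al Be, bolt_coords c T Al Be /\
  let U := [set q | reg c q /\ 0 < cabs c q] in
  coherent c T Al U /\ rot_stable U.
Proof.
move=> c0.
(* For cos al > 0 the sign of t is that of u; where cos al = 0 one has u = 0 and either sign of t
   fits. *)
pose T q := if cabs c q == 0 then tabs c q else coord q 0 / cabs c q.
have hch q : reg c q -> chart c q (T q) (cabs c q).
  move=> rq; have [h1 h2 h3] := tabs_cabs c0 rq.
  apply: chart_of_sigma (sigmaP c0 rq) _ h2 _; rewrite /T.
    case: eqVneq => [_ //|Cn]; rewrite expr_div_n -h3 mulfK ?expf_neq0 //.
  case: eqVneq => [Cz|Cn]; last by rewrite divfK.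
  by apply/esym/eqP; rewrite Cz mulr0 -sqrf_eq0 -h3 Cz expr0n mulr0.
have [Be hBe] := bolt_coords_of_chart c0 hch.
exists T, (fun q => acos (cabs c q)), Be; split=> //=; split; last first.
  move=> ps q [rq Cq]; split; first exact: rot_reg.
  by have [_ _ _ hv] := rot_coords ps q; rewrite /cabs rot_sigma hv.
have near_U q : reg c q -> 0 < cabs c q ->
    \forall p \near q, reg c p /\ 0 < cabs c p.
  by move=> rq Cq; apply: near_reg_gt => //; exact: cabs_cvg.
split.
- by apply: open_of_near => q [rq Cq]; exact: near_U.
- by move=> q [].
- move=> q [rq Cq].
  apply: (@cts_near _ _ _ (fun p => coord p 0 / cabs c p)).
    near=> p; have [_ Cp] : reg c p /\ 0 < cabs c p by near: p; exact: near_U.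
    by rewrite /T gt_eqF.
  apply: ctsM; first exact: coord_cvg.
  by apply: ctsV; [rewrite gt_eqF|exact: cabs_cvg].
- move=> q [rq Cq]; apply: acos_cvg; last exact: cabs_cvg.
  near=> p; have [rp _] : reg c p /\ 0 < cabs c p by near: p; exact: near_U.
  exact: chart_cos c0 (hch p rp).
Unshelve. all: by end_near. Qed.

(* Coordinates with t > 0, defined off the disc u = 0, v <= 2 c^(1/4). *)
Lemma coords_t_pos c : 0 <= c -> exists T Al Be, bolt_coords c T Al Be /\
  let U := [set q | reg c q /\ 0 < tabs c q] in
  coherent c T Al U /\ rot_stable U.
Proof.
move=> c0.
pose C q := if tabs c q == 0 then cabs c q else coord q 0 / tabs c q.
have hch q : reg c q -> chart c q (tabs c q) (C q).
  move=> rq; have [h1 h2 h3] := tabs_cabs c0 rq.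
  apply: chart_of_sigma (sigmaP c0 rq) h1 _ _; rewrite /C.
    case: eqVneq => [_ //|Cn]; rewrite expr_div_n -h3 mulrC mulKf ?expf_neq0 //.
  case: eqVneq => [Cz|Cn]; last by rewrite mulrC divfK.
  by apply/esym/eqP; rewrite Cz mul0r -sqrf_eq0 -h3 Cz expr0n mul0r.
have [Be hBe] := bolt_coords_of_chart c0 hch.
exists (tabs c), (fun q => acos (C q)), Be; split=> //=; split; last first.
  move=> ps q [rq Cq]; split; first exact: rot_reg.
  by have [_ _ _ hv] := rot_coords ps q; rewrite /tabs rot_sigma.
have near_U q : reg c q -> 0 < tabs c q ->
    \forall p \near q, reg c p /\ 0 < tabs c p.
  by move=> rq Cq; apply: near_reg_gt => //; exact: tabs_cvg.
split.
- by apply: open_of_near => q [rq Cq]; exact: near_U.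
- by move=> q [].
- by move=> q [rq Cq]; exact: tabs_cvg.
- move=> q [rq Cq]; apply: acos_cvg.
    near=> p; have [rp _] : reg c p /\ 0 < tabs c p by near: p; exact: near_U.
    exact: chart_cos c0 (hch p rp).
  apply: (@cts_near _ _ _ (fun p => coord p 0 / tabs c p)).
    near=> p; have [_ Cp] : reg c p /\ 0 < tabs c p by near: p; exact: near_U.
    by rewrite /C gt_eqF.
  apply: ctsM; first exact: coord_cvg.
  by apply: ctsV; [rewrite gt_eqF|exact: tabs_cvg].
Unshelve. all: by end_near. Qed.

(** The domains of the two charts cover [reg c], because t = cos al = 0 gives u = 0 and v^2 = 4
    c^(1/2), a singular point. *)
Lemma coords_exist c : 0 <= c -> forall q0, reg c q0 -> exists T Al Be U,
  [/\ bolt_coords c T Al Be, coherent c T Al U, rot_stable U & U q0].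
Proof.
move=> c0 q0 rq.
have [C0|Cn] := eqVneq (cabs c q0) 0; last first.
  have [T [Al [Be [h1 [h2 h3]]]]] := coords_cos_pos c0.
  exists T, Al, Be; eexists; split; [exact: h1|exact: h2|exact: h3|].
  by split=> //; rewrite lt_neqAle eq_sym Cn sqrtr_ge0.
have [T [Al [Be [h1 [h2 h3]]]]] := coords_t_pos c0.
exists T, Al, Be; eexists; split; [exact: h1|exact: h2|exact: h3|].
split=> //; rewrite lt_neqAle eq_sym sqrtr_ge0 andbT; apply/eqP => t0.
have [h4 h5 h6] := tabs_cabs c0 rq; have [s0 _ _ _] := sigmaP c0 rq.
apply: ((regP _ c0).1 rq); split.
  by apply/eqP; rewrite -sqrf_eq0 -h6 C0 expr0n mulr0.
have cs : c = sigma c q0 ^+ 2 by move: h4; rewrite t0 expr0n /=; lra.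
rewrite cs powR_sqr_half ?(ltW s0) //.
have h4s : 4 * sigma c q0 != 0 by rewrite mulf_neq0 // gt_eqF.
move: h5; rewrite C0 expr0n /= => /esym/eqP; rewrite subr_eq0 => /eqP h.
by rewrite -(divfK h4s (vsq q0)) -h mul1r.
Qed.

(** For c = 0 one has t^2 = s^2 > 0 at every regular point, so the chart t > 0 is global. *)
Lemma coords_exist_cone c : c = 0 -> exists T Al Be,
  bolt_coords c T Al Be /\ coherent c T Al (reg c).
Proof.
move=> cz; have c0 : 0 <= c by rewrite cz.
have [T [Al [Be [h1 [h2 _]]]]] := coords_t_pos c0.
exists T, Al, Be; split=> //; move: h2.
rewrite (_ : [set q | _] = reg c) //; apply/seteqP; split=> [q []//|q rq].
split=> //; have [s0 _ _ _] := sigmaP c0 rq.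
by rewrite sqrtr_gt0 [X in _ - X]cz subr0 exprn_gt0.
Qed.

End CoordinatesExist.

(** * The pushforward metric *)

Section Metric.
Context {R : realType}.
Implicit Types (q : 'rV[R]_3) (c t : R).

Definition mx3 (s : seq (seq R)) : 'M[R]_3 := \matrix_(i, j) nth 0 (nth [::] s i) j.

Lemma dot3 (x y : 'rV[R]_3) : dot x y =
  coord x 0 * coord y 0 + coord x 1 * coord y 1 + coord x 2 * coord y 2.
Proof. by rewrite /dot mxE sum3E !mxE. Qed.

Lemma vec3_mx3 (x0 x1 x2 k00 k01 k02 k10 k11 k12 k20 k21 k22 : R) :
  vec3 x0 x1 x2 *m
    mx3 [:: [:: k00; k01; k02]; [:: k10; k11; k12]; [:: k20; k21; k22]] =
  vec3 (x0 * k00 + x1 * k10 + x2 * k20) (x0 * k01 + x1 * k11 + x2 * k21)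
    (x0 * k02 + x1 * k12 + x2 * k22).
Proof.
apply/rowP => j; rewrite !mxE sum3E !mxE !inordK //=.
by case: j => -[|[|[|//]]].
Qed.

(* N = 2 (c + t^2) cos^2 al + t^2 sin^2 al in terms of s = (c + t^2)^(1/2). *)
Definition jac c (s : R) q := 2 * s ^+ 2 * (1 - vsq q / (4 * s))
  + (s ^+ 2 - c) * (vsq q / (4 * s)).

(* k = (2 s / N) du^2 + (dq_1^2 + dq_2^2) / 2
       + (2 c + t^2) / (8 N s) (q_1 dq_1 + q_2 dq_2)^2 *)
Definition kmat c (s : R) q : 'M[R]_3 :=
  let g := (c + s ^+ 2) / (8 * jac c s q * s) in
  let q1 := coord q 1 in let q2 := coord q 2 in
  mx3 [:: [:: 2 * s / jac c s q; 0; 0];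
          [:: 0; 1 / 2 + g * q1 * q1; g * q1 * q2];
          [:: 0; g * q1 * q2; 1 / 2 + g * q2 * q2]].

Definition kmetric c q := kmat c (sigma c q) q.

(** Both summands are nonnegative. The first vanishes only if v^2 = 4 s, that is cos al = 0, and
    then the second only if t = 0, which is excluded at regular points. *)
Lemma jac_gt0 c q s : 0 <= c -> reg c q -> is_sigma c q s -> 0 < jac c s q.
Proof.
move=> c0 /(regP _ c0) rq [s0 cs vs es].
have s4 : 0 < 4 * s by rewrite mulr_gt0.
have h1 : 0 <= 1 - vsq q / (4 * s) by rewrite subr_ge0 ler_pdivrMr // mul1r.
have h2 : 0 <= vsq q / (4 * s) by rewrite divr_ge0 ?vsq_ge0 // ltW.
have h3 : 0 <= s ^+ 2 - c by rewrite subr_ge0.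
have h4 : 0 < 2 * s ^+ 2 by rewrite mulr_gt0 // exprn_gt0.
have hA := mulr_ge0 (ltW h4) h1; have hB := mulr_ge0 h3 h2.
rewrite lt_neqAle /jac addr_ge0 // andbT eq_sym paddr_eq0 //.
rewrite mulf_eq0 (gt_eqF h4) /= mulf_eq0.
apply/negP => /andP[/eqP e1 /orP[/eqP e2|/eqP e2]]; last by move: e1; rewrite e2; lra.
have sn : 4 * s != 0 by rewrite gt_eqF.
have e3 : vsq q = 4 * s.
  by rewrite -[LHS](divfK sn) (_ : vsq q / (4 * s) = 1) ?mul1r //; lra.
apply: rq; split.
  move/eqP: es; rewrite e2 mul0r eq_sym mulf_eq0 (gt_eqF s4) /= sqrf_eq0.
  by move/eqP.
rewrite e3; congr (4 * _); have -> : c = s ^+ 2 by lra.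
by rewrite powR_sqr_half // ltW.
Qed.

Lemma jac_chart c q t al : 0 <= c -> chart c q t (cos al) ->
  jac c ((c + t ^+ 2) `^ (1 / 2)) q =
  2 * (c + t ^+ 2) * cos al ^+ 2 + t ^+ 2 * sin al ^+ 2.
Proof.
move=> c0 [P0 _ hV]; rewrite /jac -hV powR_half_sqr ?(ltW P0) //.
have s0 : (c + t ^+ 2) `^ (1 / 2) != 0 by rewrite gt_eqF // powR_gt0.
rewrite (_ : 4 * _ * _ / _ = 1 - cos al ^+ 2); last by field.
by ring: (cos2E al).
Qed.

Lemma sigma_chart c q t C : 0 <= c -> chart c q t C ->
  sigma c q = (c + t ^+ 2) `^ (1 / 2).
Proof. by move=> c0 h; exact: sigmaE (chart_sigma c0 h). Qed.

Lemma jac_neq0 c q t al : 0 <= c -> reg c q -> chart c q t (cos al) ->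
  2 * (c + t ^+ 2) * cos al ^+ 2 + t ^+ 2 * sin al ^+ 2 != 0.
Proof.
move=> c0 rq h; rewrite -(jac_chart c0 h) gt_eqF //.
exact: jac_gt0 (chart_sigma c0 h).
Qed.

(** [pic_solve] inverts d pi_c on the horizontal vectors (b0, b1, z1). Along u, and along the radial
    and angular directions of (q_1, q_2), k is diagonal with entries 2 w^2 / N, w^4 / N and 1 /
    2. *)
Lemma kmetric_pushforward c : 0 <= c -> is_pushforward_metric c (kmetric c).
Proof.
move=> c0 q rq t al be th ph m E [Mm _] pq.
have hq := bolt_chart c0 Mm pq; have [P0 _ _] := hq.
have [w [w0 wP w14 w12 [wm12 _ _]]] := powR_quarter P0.
have wn0 : w != 0 by rewrite gt_eqF.
have N0 := jac_neq0 c0 rq hq.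
have hor h := horizontalP be th ph h P0 N0.
have hpic := is_derive_pic (c := c) al be th ph _ _ _ _ _ _ _ P0.
split=> [x|h h'].
  rewrite (vec3_coord x); set x0 := coord x 0; set x1 := coord x 1; set x2 := coord x 2.
  pose a := x1 * cos be + x2 * sin be; pose b := - x1 * sin be + x2 * cos be.
  set N := _ + _ in N0.
  exists (vect al be th ph t ((cos al * a * w ^+ 3 - t * sin al * x0) / N)
    (b / (2 * w)) 0 0 ((2 * w * cos al * x0 + t * sin al * a) * w ^+ 3 / N) 0 0).
  split.
    split; first by apply/hor; do 3 eexists.
    have [_ ->] := hpic ((cos al * a * w ^+ 3 - t * sin al * x0) / N)
      (b / (2 * w)) 0 0 ((2 * w * cos al * x0 + t * sin al * a) * w ^+ 3 / N) 0 0.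
    by rewrite w14; apply/(pic_solve _ _ _ _ _ _ _ w0 wP N0).
  move=> h [/hor[b0 [b1 [z1 ->]]]].
  have [_ ->] := hpic b0 b1 0 0 z1 0 0.
  by rewrite w14 => /(pic_solve _ _ _ _ _ _ _ w0 wP N0)[-> -> ->].
move=> /hor[b0 [b1 [z1 ->]]] /hor[b0' [b1' [z1' ->]]].
have [_ ->] := hpic b0 b1 0 0 z1 0 0; have [_ ->] := hpic b0' b1' 0 0 z1' 0 0.
rewrite gmet_vect w14 w12 wm12 /kmetric (sigma_chart c0 hq) w12 /kmat.
have jE : jac c (w ^+ 2) q = 2 * w ^+ 4 * cos al ^+ 2 + t ^+ 2 * sin al ^+ 2.
  by rewrite -w12 (jac_chart c0 hq) wP.
rewrite vec3_mx3 dot3 !vec3E //= jE.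
move: N0; rewrite wP -pq /m pic_bolt w14 !vec3E //= => N0.
have cE : c = w ^+ 4 - t ^+ 2 by rewrite -wP; ring.
set N := _ + _ in N0 *; set g := (c + _) / _.
(* The radial entry of k, where q_1^2 + q_2^2 = (2 w sin al)^2. *)
have e : 1 / 2 + g * (2 * w * sin al) ^+ 2 = w ^+ 4 / N.
  have -> : w ^+ 4 = (N + (2 * w ^+ 4 - t ^+ 2) * sin al ^+ 2) / 2.
    by rewrite /N; field: (cos2E al).
  by rewrite /g cE; field; rewrite N0 wn0.
(* The radial component of d pi_c; the angular one is 2 w b1. *)
pose A z b := t * w ^- 3 * z * sin al + 2 * w * cos al * b.
transitivity (2 * w ^+ 2 / N * (cos al * z1 - t * sin al * b0)
    * (cos al * z1' - t * sin al * b0')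
  + (1 / 2 + g * (2 * w * sin al) ^+ 2) * A z1 b0 * A z1' b0'
  + 2 * w ^+ 2 * b1 * b1').
  rewrite /A; move: (w ^- 3) (2 * w ^+ 2 / N) => v n.
  by field: (cos2E be).
rewrite e /A; move: N0; rewrite /N => N0; field.
by rewrite wn0 ?exprMn N0.
Qed.

End Metric.

(** * The pushforward form and the bolt size *)

Section FormIntegral.
Context {R : realType}.
Implicit Types (q : 'rV[R]_3) (c t : R).

Lemma det3 (A : 'M[R]_3) : let a i j := A (inord i) (inord j) in
  \det A = a 0%N 0%N * (a 1%N 1%N * a 2%N 2%N - a 1%N 2%N * a 2%N 1%N)
    - a 0%N 1%N * (a 1%N 0%N * a 2%N 2%N - a 1%N 2%N * a 2%N 0%N)
    + a 0%N 2%N * (a 1%N 0%N * a 2%N 1%N - a 1%N 1%N * a 2%N 0%N).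
Proof.
move=> a; have h i j : A i j = a (val i) (val j) by rewrite /a !inord_val.
rewrite (expand_det_row _ ord0) !big_ord_recl big_ord0 /cofactor.
rewrite !(expand_det_row _ ord0) !big_ord_recl !big_ord0 /cofactor !det_mx11 !mxE.
rewrite !h /= /bump /=; ring.
Qed.

Lemma eval2_act Q A (x y : 'rV[R]_5) : Q *m Q^T = 1%:M ->
  eval2 (Q^T *m A *m Q) (x *m Q) (y *m Q) = eval2 A x y.
Proof.
move=> h; rewrite /eval2 trmx_mul !mulmxA -(mulmxA x) h mulmx1.
by rewrite -(mulmxA _ Q) h mulmx1.
Qed.

Lemma eval2_asym5 (a01 a02 a03 a04 a12 a13 a14 a23 a24 a34
    x0 x1 x2 x3 x4 y0 y1 y2 y3 y4 : R) :
  eval2 (asym5 a01 a02 a03 a04 a12 a13 a14 a23 a24 a34)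
    (vec5 x0 x1 x2 x3 x4) (vec5 y0 y1 y2 y3 y4) =
  a01 * (x0 * y1 - x1 * y0) + a02 * (x0 * y2 - x2 * y0)
  + a03 * (x0 * y3 - x3 * y0) + a04 * (x0 * y4 - x4 * y0)
  + a12 * (x1 * y2 - x2 * y1) + a13 * (x1 * y3 - x3 * y1)
  + a14 * (x1 * y4 - x4 * y1) + a23 * (x2 * y3 - x3 * y2)
  + a24 * (x2 * y4 - x4 * y2) + a34 * (x3 * y4 - x4 * y3).
Proof.
rewrite /eval2 /asym5 vec5M /nth5 /= -/(dot _ _) dot_vec5; ring.
Qed.

Lemma eval2_Omega_vect al be th ph t t' b0 b1 b2 b3 z1 z2 z3
    b0' b1' b2' b3' z1' z2' z3' k : (k < 3)%N ->
  eval2 (Omega (frame al be th ph) (inord k))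
    (vect al be th ph t b0 b1 b2 b3 z1 z2 z3).1
    (vect al be th ph t' b0' b1' b2' b3' z1' z2' z3').1 =
  [:: b0 * b1' - b1 * b0' - (b2 * b3' - b3 * b2');
      b0 * b2' - b2 * b0' - (b3 * b1' - b1 * b3');
      b0 * b3' - b3 * b0' - (b1 * b2' - b2 * b1')]`_k :> R.
Proof.
move=> k3; rewrite frame_act Omega_act !vectE /act /= eval2_act ?frameQK //.
by rewrite Omega0 //; case: k k3 => [|[|[|//]]] _ /=; rewrite eval2_asym5; ring.
Qed.

Lemma derive_th t al be th ph :
  derive1 (fun r => bolt t al be r ph) th =
  vect al be th ph t 0 0 (cos al) 0 0 0 (- t * sin al) :> 'rV[R]_5 * 'M[R]_5.
Proof.
rewrite derive1E.
have hid : is_derive (0 : R) 1 (fun s : R => s) 1 by exact: is_derive_id.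
have hC a := derC (0 : R) (1 : R) (a : R).
have := bolt_curve (hC t) (hC al) (hC be) (derD hid (hC th)) (hC ph).
rewrite /= !(mulr0, add0r, addr0, mulr1).
rewrite (_ : (fun s => _) = (fun s : R => (fun r => bolt t al be r ph) (s *: 1 + th))).
  by move=> h; have [_ ->] := @is_derive_line R R _ th 1 (fun r => bolt t al be r ph) _ h.
by apply/funext => s; rewrite /GRing.scale /= mulr1.
Qed.

Lemma derive_ph t al be th ph :
  derive1 (bolt t al be th) ph =
  vect al be th ph t 0 0 0 (cos al * sin th) 0 (t * sin al * sin th) 0
  :> 'rV[R]_5 * 'M[R]_5.
Proof.
rewrite derive1E.
have hid : is_derive (0 : R) 1 (fun s : R => s) 1 by exact: is_derive_id.
have hC a := derC (0 : R) (1 : R) (a : R).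
have := bolt_curve (hC t) (hC al) (hC be) (hC th) (derD hid (hC ph)).
rewrite /= !(mulr0, add0r, addr0, mulr1).
rewrite (_ : (fun s => _) = (fun s : R => bolt t al be th (s *: 1 + ph))).
  by move=> h; have [_ ->] := @is_derive_line R R _ ph 1 (bolt t al be th) _ h.
by apply/funext => s; rewrite /GRing.scale /= mulr1.
Qed.

(** The angles th and ph enter only through sin th, the area density of the unit sphere, so fibre
    integration multiplies the other factor by 4 pi. *)
Lemma phi_vect c t al be th ph b0 b1 b2 b3 z1 z2 z3 :
  0 < c + t ^+ 2 -> let w := (c + t ^+ 2) `^ (1 / 4) in
  phi c (frame al be th ph) (bolt t al be th ph)
    (vect al be th ph t b0 b1 b2 b3 z1 z2 z3)
    (derive1 (fun r => bolt t al be r ph) th) (derive1 (bolt t al be th) ph) =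
  sin th * (z1 * (w ^- 3 * (t * sin al) ^+ 2 - 2 * w * cos al ^+ 2)
            + 4 * w * t * sin al * cos al * b0).
Proof.
move=> P0; have [w [w0 _ w14 _ [_ w34 _]]] := powR_quarter P0.
rewrite /= w14 derive_th derive_ph /phi r2_bolt w14 w34 /vol3 det3 !mxE !inordK //=.
rewrite !zeta_vect //= sum3E /wedge12 !zeta_vect //= !eval2_Omega_vect //=.
by move: (w ^- 3) => v; ring.
Qed.

Lemma int_sin (a : R) : \int[lebesgue_measure]_(th in `[0, pi]) (sin th * a) = 2 * a.
Proof.
have hF (x : R) : is_derive x 1 (fun x : R => - cos x * a) (sin x * a).
  have h := derM (derN (is_derive_cos x)) (derC (x : R) (1 : R) a).
  by apply: (is_derive_eq h); rewrite /GRing.scale /=; ring.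
have hc (f : R -> R) g : (forall x : R, is_derive x 1 f (g x)) -> continuous f.
  move=> h x; apply: differentiable_continuous; apply/derivable1_diffP.
  by have [] := h x.
have hs (x : R) : is_derive x 1 (fun x : R => sin x * a) (cos x * a).
  have h := derM (is_derive_sin x) (derC (x : R) (1 : R) a).
  by apply: (is_derive_eq h); rewrite /GRing.scale /=; ring.
rewrite /Rintegral (@continuous_FTC2 R _ (fun x => - cos x * a)) ?pi_gt0 //.
- by rewrite /= cospi cos0; ring.
- by apply: continuous_subspaceT; exact: hc hs.
- split.
  + by move=> x _; have [] := hF x.
  + by apply: cvg_at_right_filter; exact: (hc _ _ hF).
  + by apply: cvg_at_left_filter; exact: (hc _ _ hF).
- by move=> x _; rewrite derive1E; have [_ ->] := hF x.
Qed.

(** The hypothesis is confined to [0, pi], where sin th >= 0: the area density of a bolt is the root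
    of a square and has this form in general only there. *)
Lemma int_sphere_sin (a : R) (f : R -> R -> R) :
  (forall th ph, 0 <= th <= pi -> f th ph = sin th * a) ->
  int_sphere f = 4 * pi * a.
Proof.
move=> h; rewrite /int_sphere.
transitivity (\int[@lebesgue_measure R]_(ph in `[0, 2 * pi]) (2 * a)).
  apply: eq_Rintegral => ph _; rewrite -int_sin; apply: eq_Rintegral => th.
  by rewrite inE /= in_itv /= => hth; exact: h.
rewrite Rintegral_cst //= lebesgue_measure_itv /= lte_fin mulr_gt0 ?pi_gt0 //=.
by rewrite subr0; ring.
Qed.

(* a_c times its denominator is the determinant N of [jac]. *)
Lemma bolt_size_eq c t al be : 0 < c + t ^+ 2 ->
  bolt_size c t al be =
  (2 * c * cos al ^+ 2 + t ^+ 2 * (1 + cos al ^+ 2)) / (c + t ^+ 2) `^ (1 / 2).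
Proof.
move=> P0; have [w [w0 wP w14 w12 [wm12 _ _]]] := powR_quarter P0.
have wn0 : w != 0 by rewrite gt_eqF.
have cE : c = w ^+ 4 - t ^+ 2 by rewrite -wP; ring.
set a := (X in _ = X).
have aE : a = w ^- 2 * (t * sin al) ^+ 2 + 2 * w ^+ 2 * cos al ^+ 2.
  by rewrite /a w12 cE; field: (cos2E al).
have a0 : 0 <= a.
  by rewrite aE addr_ge0 // mulr_ge0 ?sqr_ge0 ?invr_ge0 ?exprn_ge0 ?mulr_ge0 ?sqr_ge0 // ltW.
rewrite /bolt_size (int_sphere_sin (a := a)); last first.
  move=> th ph hth; rewrite derive_th derive_ph !gmet_vect w12 wm12.
  have s0 : 0 <= sin th by rewrite sin_ge0_pi // in_itv /=.
  have -> : sin th * a = Num.sqrt ((sin th * a) ^+ 2).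
    by rewrite sqrtr_sqr ger0_norm // mulr_ge0.
  rewrite aE; congr Num.sqrt.
  by move: (w ^- 2) => v; ring.
by rewrite mulrAC divff ?mul1r // mulf_neq0 // gt_eqF // pi_gt0.
Qed.

End FormIntegral.

Section Form.
Context {R : realType}.
Implicit Types (q : 'rV[R]_3) (c t : R).

(* lambda_c / (4 pi) = - 2 (c + t^2)^(1/4) cos al du + t / (2 (c + t^2)^(1/4)) v dv *)
Definition lamv c t (C : R) q : 'rV[R]_3 :=
  let w := (c + t ^+ 2) `^ (1 / 4) in
  vec3 (- 2 * w * C) (t / (2 * w) * coord q 1) (t / (2 * w) * coord q 2).

Definition lam c (T Al : 'rV[R]_3 -> R) q : 'rV[R]_3 :=
  if `[< reg c q >] then (4 * pi) *: lamv c (T q) (cos (Al q)) q else 0.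

Lemma lamE c T Al q : reg c q ->
  lam c T Al q = (4 * pi) *: lamv c (T q) (cos (Al q)) q.
Proof. by move=> rq; rewrite /lam asboolT. Qed.

Lemma tangent_B_M c m (w : 'rV[R]_5 * 'M[R]_5) :
  tangent (B c) m w -> tangent (M c) m w.
Proof. by move=> [g [g0 gB gw]]; exists g; split=> // s; have [] := gB s. Qed.

Lemma tangent_B_curve c t al be th ph (b0 db z1 : R) : (c = 0 -> t != 0) ->
  tangent (B c) (bolt t al be th ph)
    (vect al be th ph t b0 (sin al * db) 0 0 z1 0 0).
Proof.
move=> ct; have [ta [ta0 dta taN]] := scalar_curve t z1.
exists (fun s => bolt (ta s) (s * b0 + al) (s * db + be) th ph); split.
- by rewrite ta0 !mul0r !add0r.
- by move=> s; apply/B_bolt => /ct /taN.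
have hid : is_derive (0 : R) 1 (fun s : R => s) 1 by exact: is_derive_id.
have hC a := derC (0 : R) (1 : R) (a : R).
have := bolt_curve dta (derD (derM hid (hC b0)) (hC al))
  (derD (derM hid (hC db)) (hC be)) (hC th) (hC ph).
by rewrite /= !(mul0r, mulr0, add0r, addr0, mul1r) ta0.
Qed.

(** Away from sin al = 0 the lift moves t, al and be, with velocities given by [pic_solve]. *)
Lemma lift_exists c q t al be x : 0 <= c -> reg c q -> chart c q t (cos al) ->
  exists W, is_lift c (bolt t al be) x W.
Proof.
move=> c0 rq hq; have [P0 _ _] := hq.
have [w [w0 wP w14 _ _]] := powR_quarter P0.
have wn0 : w != 0 by rewrite gt_eqF.
have ct := (chart_pos t c0).2 P0.
have N0 := jac_neq0 c0 rq hq.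
have hpic := is_derive_pic (c := c) al _ _ _ _ _ _ _ _ _ _ P0.
(* Here moving be does nothing, but the bolt is the same for every be. Choosing be as the polar
   angle of the required (x_1, x_2) lets al alone produce that direction. *)
have [S0|Sn] := eqVneq (sin al) 0.
  have C2 : cos al ^+ 2 = 1 by rewrite cos2E S0 expr0n subr0.
  have Cn : cos al != 0 by rewrite -sqrf_eq0 C2 oner_eq0.
  have [r [ps [_ e1 e2]]] := polar (coord x 1) (coord x 2).
  exists (fun th ph => vect al ps th ph t (r / (2 * w * cos al)) (sin al * 0) 0 0
    (coord x 0 / cos al) 0 0) => th ph.
  have be_ps : bolt t al be th ph = bolt t al ps th ph.
    by apply: bolt_same_cos; rewrite // S0 !mul0r.
  rewrite be_ps; split; first exact: tangent_B_curve.
  have [_ ->] := hpic ps th ph (r / (2 * w * cos al)) (sin al * 0) 0 0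
    (coord x 0 / cos al) 0 0.
  rewrite w14 S0 [RHS]vec3_coord e1 e2; congr vec3; field.
  - by rewrite Cn wn0.
  - by rewrite Cn wn0.
  - by rewrite Cn wn0.
set a := coord x 1 * cos be + coord x 2 * sin be.
set b := - coord x 1 * sin be + coord x 2 * cos be.
set N := _ + _ in N0.
pose b0 := (cos al * a * w ^+ 3 - t * sin al * coord x 0) / N.
pose z1 := (2 * w * cos al * coord x 0 + t * sin al * a) * w ^+ 3 / N.
exists (fun th ph => vect al be th ph t b0 (sin al * (b / (2 * w) / sin al)) 0 0 z1 0 0).
move=> th ph; split; first exact: tangent_B_curve.
have [_ ->] := hpic be th ph b0 (sin al * (b / (2 * w) / sin al)) 0 0 z1 0 0.
have hb : sin al * (b / (2 * w) / sin al) = b / (2 * w) by rewrite mulrC divfK.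
rewrite w14 hb [RHS]vec3_coord.
by apply/(pic_solve _ _ _ _ _ _ _ w0 wP N0).
Qed.

(** The value is the same for all lifts: phi_c sees only b0 and z1 once two entries are tangent to
    the bolt, and [pic_solve] determines these from x. *)
Lemma lam_value c q t al be x (W : R -> R -> 'rV[R]_5 * 'M[R]_5) th ph :
  0 <= c -> reg c q -> chart c q t (cos al) ->
  pic c (bolt t al be 0 0) = q -> is_lift c (bolt t al be) x W ->
  phi c (frame al be th ph) (bolt t al be th ph) (W th ph)
    (derive1 (fun r => bolt t al be r ph) th) (derive1 (bolt t al be th) ph) =
  sin th * dot (lamv c t (cos al) q) x.
Proof.
move=> c0 rq hq pq /(_ th ph)[/tangent_B_M/tangent_boltP].
move=> [b0 [b1 [b2 [b3 [z1 [z2 [z3 ->]]]]]]]; have [P0 _ _] := hq.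
have N0 := jac_neq0 c0 rq hq.
have [_ ->] := is_derive_pic al be th ph b0 b1 b2 b3 z1 z2 z3 P0.
rewrite (phi_vect _ _ _ _ _ _ _ _ _ _ _ P0) /lamv.
have [w [w0 wP w14 _ _]] := powR_quarter P0.
have wn0 : w != 0 by rewrite gt_eqF.
rewrite w14 (vec3_coord x) => /(pic_solve _ _ _ _ _ _ _ w0 wP N0)[-> -> _].
congr (_ * _); rewrite dot3 !vec3E //= -pq pic_bolt w14 !vec3E //=.
move: N0; rewrite wP => N0; field.
by rewrite wn0 ?exprMn N0.
Qed.

Lemma lam_pushforward c T Al Be : 0 <= c -> bolt_coords c T Al Be ->
  is_pushforward_form c T Al Be (lam c T Al).
Proof.
move=> c0 /(bolt_coordsP _ _ _ c0) h; split=> [q sq|q rq w s E].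
  by rewrite /lam asboolF // => rq; exact: rq.
have [_ hq pq] := h q rq; split; first exact: lift_exists hq.
move=> W hW; rewrite (int_sphere_sin (a := dot (lamv c (T q) (cos (Al q)) q) w)).
  by rewrite lamE // {1}/dot -scalemxAl mxE.
by move=> th ph _; rewrite (lam_value _ _ c0 rq hq pq hW).
Qed.

End Form.

(** * Differentiability of the coordinates *)

Section Differentials.
Context {R : realType} {V : normedModType R}.
Implicit Types (f g h : V -> R) (x : V) (L : V -> R).

Definition dif f x L := differentiable f x /\ forall v, is_derive x v f (L v).

Lemma dif_eq f x L L' : dif f x L -> L =1 L' -> dif f x L'.
Proof. by move=> [h1 h2] e; split=> // v; rewrite -e. Qed.

(** A function that is o(|y - x|) has differential zero; this absorbs the error terms below. *)
Lemma dif_small f x : (forall e : R, 0 < e -> \forall y \near x, `|f y| <= e * `|y - x|) ->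
  dif f x (fun=> 0).
Proof.
move=> h.
have fx0 : f x = 0.
  apply/eqP; rewrite -normr_le0.
  by have := nbhs_singleton (h 1 ltr01); rewrite subrr normr0 mulr0.
have c0 : continuous (\0 : V -> R) by move=> y; exact: cvg_cst.
have e : f \o shift x = cst (f x) + \0 +o_ (0 : V) id.
  apply/eqaddoP => e e0; have /nbhs0P := h e e0; apply: filterS => y.
  rewrite addrAC subrr add0r /= => hy.
  by rewrite fx0 !fctE /= addr0 subr0 addrC.
have d0 := diff_unique (df := \0) c0 e.
have df : differentiable f x by apply/diff_locallyP; rewrite d0; split.
split=> // v; apply: DeriveDef; first exact: diff_derivable.
by rewrite deriveE // d0.
Qed.

Lemma difC x (a : R) : dif (fun=> a) x (fun=> 0).
Proof. by split=> [|v]; [exact: differentiable_cst|exact: derC]. Qed.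

Lemma difD x f g L M : dif f x L -> dif g x M ->
  dif (fun y => f y + g y) x (fun v => L v + M v).
Proof.
by move=> [h1 h2] [h3 h4]; split=> [|v]; [exact: differentiableD|exact: derD].
Qed.

Lemma difN x f L : dif f x L -> dif (fun y => - f y) x (fun v => - L v).
Proof. by move=> [h1 h2]; split=> [|v]; [exact: differentiableN|exact: derN]. Qed.

Lemma difB x f g L M : dif f x L -> dif g x M ->
  dif (fun y => f y - g y) x (fun v => L v - M v).
Proof.
by move=> [h1 h2] [h3 h4]; split=> [|v]; [exact: differentiableB|exact: derB].
Qed.

Lemma difM x f g L M : dif f x L -> dif g x M ->
  dif (fun y => f y * g y) x (fun v => L v * g x + f x * M v).
Proof.
by move=> [h1 h2] [h3 h4]; split=> [|v]; [exact: differentiableM|exact: derM].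
Qed.

Lemma dif_comp x f L (h : R -> R) a : is_derive (f x) 1 h a -> dif f x L ->
  dif (fun y => h (f y)) x (fun v => a * L v).
Proof.
move=> hh [h1 h2]; split=> [|v]; last exact: der_comp.
by apply: differentiable_comp => //; apply/derivable1_diffP; case: hh.
Qed.

Lemma difV x f L : f x != 0 -> dif f x L ->
  dif (fun y => (f y)^-1) x (fun v => - (f x) ^- 2 * L v).
Proof.
by move=> fx [h1 h2]; split=> [|v]; [exact: differentiableV|exact: derV].
Qed.

Lemma dif_near x f g L : (\near x, f x = g x) -> dif f x L -> dif g x L.
Proof.
move=> fg hf.
have h : dif (fun y => g y - f y) x (fun=> 0).
  apply: dif_small => e e0; apply: filterS fg => y ->.
  by rewrite subrr normr0 mulr_ge0 // ltW.
have := difD hf h; rewrite (_ : (fun y => _) = g); last first.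
  by apply/funext => y; rewrite addrC subrK.
by move=> hg; apply: dif_eq hg _ => v; rewrite addr0.
Qed.

(* The Caratheodory form of differentiability: A only has to be continuous. *)
Lemma dif_mul_cts x (A h : V -> R) L : A y @[y --> x] --> A x ->
  (forall y, `|h y| <= `|y - x|) -> dif h x L ->
  dif (fun y => A y * h y) x (fun v => A x * L v).
Proof.
move=> cA hx dh.
have d1 : dif (fun y => (A y - A x) * h y) x (fun=> 0).
  apply: dif_small => e e0.
  move/cvgrPdist_le : cA => /(_ e e0); apply: filterS => y.
  rewrite distrC => hA; rewrite normrM; apply: ler_pM => //.
have := difD (difM (difC x (A x)) dh) d1.
rewrite (_ : (fun y => _) = (fun y => A y * h y)); last first.
  by apply/funext => y; ring.
by move=> hg; apply: dif_eq hg _ => v; ring.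
Qed.

End Differentials.

(** * Derivatives of t and cos al as functions on the base *)

Section ChartDifferentials.
Context {R : realType}.
Implicit Types (p q v : 'rV[R]_3) (c t : R).

Lemma dif_coord q j : dif (fun p => coord p j) q (fun v => coord v j).
Proof.
split=> [|v]; first exact: differentiable_coord.
exact: is_derive_coord (is_derive_id _ _).
Qed.

Lemma dif_coordB q j : dif (fun p => coord p j - coord q j) q (fun v => coord v j).
Proof. by apply: dif_eq (difB (dif_coord q j) (difC q (coord q j))) _ => v; rewrite subr0. Qed.

Lemma coord_norm p q j : `|coord p j - coord q j| <= `|p - q|.
Proof.
rewrite [leRHS]/Num.Def.normr/= mx_normrE.
by apply: le_trans (le_bigmax _ _ (0, inord j)); rewrite !mxE.
Qed.

Definition dvsq q v := 2 * coord q 1 * coord v 1 + 2 * coord q 2 * coord v 2.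

(* [kap] is the difference quotient of (c + t^2)^(1/2). *)
Lemma chart_dif c q (T C : 'rV[R]_3 -> R) : 0 <= c -> reg c q ->
  (\forall p \near q, chart c p (T p) (C p)) ->
  T p @[p --> q] --> T q -> C p @[p --> q] --> C q ->
  let s := (c + T q ^+ 2) `^ (1 / 2) in
  let N := 2 * s ^+ 2 * C q ^+ 2 + T q ^+ 2 * (1 - C q ^+ 2) in
  [/\ 0 < N,
    dif T q (fun v => (2 * s ^+ 2 * C q / N) * coord v 0
                      + T q * s / (4 * N) * dvsq q v)
  & dif C q (fun v => T q * (1 - C q ^+ 2) / N * coord v 0
                      - C q * s / (4 * N) * dvsq q v)].
Proof.
move=> c0 rq hn cT cC s N.
have hq := nbhs_singleton hn; have [P0 hu hV] := hq.
have s0 : 0 < s by rewrite powR_gt0.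
have s2 : s ^+ 2 = c + T q ^+ 2 by rewrite powR_half_sqr // ltW.
have N0 : 0 < N.
  have := jac_gt0 c0 rq (chart_sigma c0 hq); rewrite /jac -hV -/s.
  rewrite (_ : 4 * s * _ / _ = 1 - C q ^+ 2); last by field; rewrite gt_eqF.
  rewrite (_ : 2 * _ * _ + _ = N) // /N s2; ring.
pose S p := Num.sqrt (c + T p * T p).
have hS p : 0 < c + T p ^+ 2 -> (c + T p ^+ 2) `^ (1 / 2) = S p.
  by move=> h; rewrite div1r powR12_sqrt ?(ltW h) // expr2.
have Sq : S q = s by rewrite /s hS.
have cS : S p @[p --> q] --> S q.
  by apply: cts_sqrt; apply: ctsD; [exact: ctsC|exact: ctsM].
pose kap p := (T p + T q) / (S p + s).
have ckap : kap p @[p --> q] --> kap q.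
  apply: ctsM; first by apply: ctsD => //; exact: ctsC.
  apply: ctsV; first by rewrite gt_eqF // Sq addr_gt0.
  by apply: ctsD => //; exact: ctsC.
(* The determinant of the linear system for (T p - T q, C p - C q) whose right-hand sides are the
   exact increments of u and v^2. *)
pose D p := - (4 * s) * (C p * (C p + C q)) - 4 * T q * (kap p * (1 - C p * C p)).
have cD : D p @[p --> q] --> D q.
  apply: ctsB; apply: ctsM; [exact: ctsC| |exact: ctsC|]; apply: ctsM => //.
    by apply: ctsD => //; exact: ctsC.
  by apply: ctsB; [exact: ctsC|exact: ctsM].
have kq : kap q = T q / s by rewrite /kap Sq; field; rewrite !gt_eqF ?addr_gt0.
have DE : D q = - (4 * N) / s.
  by rewrite /D kq /N; field; rewrite gt_eqF.
have D0 : D q < 0 by rewrite DE mulNr oppr_lt0 divr_gt0 // mulr_gt0.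
(* Cramer's rule for that system, near q, where D stays negative. *)
have near_eqs : \forall p \near q, [/\ D p != 0,
    (T p - T q) * D p = - (4 * s) * (C p + C q) * (coord p 0 - coord q 0)
      - T q * (vsq p - vsq q)
  & (C p - C q) * D p = C p * (vsq p - vsq q)
      - 4 * kap p * (1 - C p * C p) * (coord p 0 - coord q 0)].
  near=> p.
  have [Pp hup hVp] : chart c p (T p) (C p) by near: p.
  have Dp : D p < 0 by near: p; exact: (cts_lt cD D0).
  have Sp : 0 < S p by rewrite -hS // powR_gt0.
  have Sk : S p = s + kap p * (T p - T q).
    have e1 : S p ^+ 2 = c + T p ^+ 2 by rewrite -hS // powR_half_sqr // ltW.
    have e2 : S p + s != 0 by rewrite gt_eqF // addr_gt0.
    apply: (mulfI e2); rewrite mulrDr mulrA /kap (mulrCA (S p + s)) divff // mulr1.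
    have -> : (S p + s) * S p = S p ^+ 2 + S p * s by ring.
    rewrite e1; have -> : c = s ^+ 2 - T q ^+ 2 by rewrite s2; ring.
    by ring.
  split; first by rewrite lt_eqF.
    by rewrite -hVp -hV -hup -hu -/s hS // Sk /D; ring.
  by rewrite -hVp -hV -hup -hu -/s hS // Sk /D; ring.
have cDV : (D p)^-1 @[p --> q] --> (D q)^-1 by apply: ctsV; rewrite ?lt_eqF.
have ccoord j : coord p j @[p --> q] --> coord q j by exact: coord_cvg.
have vsqB p : vsq p - vsq q = (coord p 1 + coord q 1) * (coord p 1 - coord q 1)
    + (coord p 2 + coord q 2) * (coord p 2 - coord q 2).
  by rewrite /vsq; ring.
(* If the increment of f is a combination of coordinate increments with coefficients continuous at
   q, their values at q are the partial derivatives. *)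
have hdif (f A0 A1 A2 : 'rV[R]_3 -> R) : A0 p @[p --> q] --> A0 q ->
    A1 p @[p --> q] --> A1 q -> A2 p @[p --> q] --> A2 q ->
    (\forall p \near q, f p = f q + (A0 p * (coord p 0 - coord q 0)
       + A1 p * (coord p 1 - coord q 1) + A2 p * (coord p 2 - coord q 2))) ->
    dif f q (fun v => A0 q * coord v 0 + A1 q * coord v 1 + A2 q * coord v 2).
  move=> c_0 c_1 c_2 hf.
  have t0 := dif_mul_cts c_0 (fun p => coord_norm p q 0) (dif_coordB q 0).
  have t1 := dif_mul_cts c_1 (fun p => coord_norm p q 1) (dif_coordB q 1).
  have t2 := dif_mul_cts c_2 (fun p => coord_norm p q 2) (dif_coordB q 2).
  have t3 := difD (difC q (f q)) (difD (difD t0 t1) t2).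
  apply: dif_eq (dif_near _ t3) _ => [|v]; last by rewrite add0r.
  by apply: filterS hf => p ->.
have sn : s != 0 by rewrite gt_eqF.
have Nn : N != 0 by rewrite gt_eqF.
split=> //.
- apply: dif_eq (hdif T (fun p => - (4 * s) * (C p + C q) * (D p)^-1)
    (fun p => - T q * (coord p 1 + coord q 1) * (D p)^-1)
    (fun p => - T q * (coord p 2 + coord q 2) * (D p)^-1) _ _ _ _) _ => [|||  |v].
  + by apply: ctsM cDV; apply: ctsM; [exact: ctsC|apply: ctsD; [exact: cC|exact: ctsC]].
  + by apply: ctsM cDV; apply: ctsM; [exact: ctsC|apply: ctsD; [exact: ccoord|exact: ctsC]].
  + by apply: ctsM cDV; apply: ctsM; [exact: ctsC|apply: ctsD; [exact: ccoord|exact: ctsC]].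
  + apply: filterS near_eqs => p [Dp e1 _].
    apply/eqP; rewrite addrC -subr_eq; apply/eqP; apply: (mulIf Dp).
    by rewrite e1 vsqB; field.
  + by rewrite DE /dvsq; field; rewrite sn Nn.
- apply: dif_eq (hdif C (fun p => - (4 * (kap p * (1 - C p * C p))) * (D p)^-1)
    (fun p => C p * (coord p 1 + coord q 1) * (D p)^-1)
    (fun p => C p * (coord p 2 + coord q 2) * (D p)^-1) _ _ _ _) _ => [|||  |v].
  + apply: ctsM cDV; apply: ctsN; apply: ctsM; [exact: ctsC|apply: ctsM ckap _].
    by apply: ctsB; [exact: ctsC|exact: ctsM].
  + by apply: ctsM cDV; apply: ctsM cC _; apply: ctsD; [exact: ccoord|exact: ctsC].
  + by apply: ctsM cDV; apply: ctsM cC _; apply: ctsD; [exact: ccoord|exact: ctsC].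
  + apply: filterS near_eqs => p [Dp _ e1].
    apply/eqP; rewrite addrC -subr_eq; apply/eqP; apply: (mulIf Dp).
    by rewrite e1 vsqB; field.
  + by rewrite DE kq /dvsq; field; rewrite sn Nn.
Unshelve. all: by end_near. Qed.

End ChartDifferentials.

(** * The Hodge dual *)

Section Hodge.
Context {R : realType}.
Implicit Types (p q : 'rV[R]_3) (c t : R).

Definition det_rows (r x y : 'rV[R]_3) : R := \det (\matrix_(i < 3) [:: r; x; y]`_i).

Lemma det_rowsE (r x y : 'rV[R]_3) : det_rows r x y =
  coord r 0 * (coord x 1 * coord y 2 - coord x 2 * coord y 1)
  - coord r 1 * (coord x 0 * coord y 2 - coord x 2 * coord y 0)
  + coord r 2 * (coord x 0 * coord y 1 - coord x 1 * coord y 0).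
Proof. by rewrite /det_rows det3 !mxE !inordK //= /coord; ring. Qed.

Definition chart_facts c q t (C w N : R) :=
  [/\ 0 < w, 0 < N, c + t ^+ 2 = w ^+ 4, (c + t ^+ 2) `^ (1 / 4) = w
    & [/\ (c + t ^+ 2) `^ (1 / 2) = w ^+ 2, vsq q = 4 * w ^+ 2 * (1 - C ^+ 2),
      N = 2 * w ^+ 4 * C ^+ 2 + t ^+ 2 * (1 - C ^+ 2),
      jac c (w ^+ 2) q = N & sigma c q = w ^+ 2]].

Lemma chart_factsP c q t C : 0 <= c -> reg c q -> chart c q t C ->
  exists w N, chart_facts c q t C w N.
Proof.
move=> c0 rq hq; have [P0 hu hV] := hq.
have [w [w0 wP w14 w12 _]] := powR_quarter P0.
have wn : w != 0 by rewrite gt_eqF.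
have hs := chart_sigma c0 hq; have := jac_gt0 c0 rq hs; rewrite w12 => j0.
exists w, (jac c (w ^+ 2) q); split=> //; split=> //.
- by rewrite -hV w12.
- rewrite /jac -hV w12 (_ : c = w ^+ 4 - t ^+ 2); last by rewrite -wP; ring.
  by field.
- by rewrite (sigma_chart c0 hq).
Qed.

Lemma lam_kmetric c q t C : 0 <= c -> reg c q -> chart c q t C ->
  let k := kmetric c q in
  exists w N, [/\ chart_facts c q t C w N,
    lamv c t C q *m invmx k = vec3 (- w^-1 * C * N)
      (t * N / (2 * w ^+ 5) * coord q 1) (t * N / (2 * w ^+ 5) * coord q 2)
  & Num.sqrt (\det k) = w ^+ 3 / N].
Proof.
move=> c0 rq hq k; have [w [N hF]] := chart_factsP c0 rq hq.
exists w, N; have [w0 N0 wP w14 [w12 hV hN hj hs]] := hF.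
have wn : w != 0 by rewrite gt_eqF.
have Nn : N != 0 by rewrite gt_eqF.
(* The radial entry of k. With the angular entry 1 / 2 and the u-entry 2 w^2 / N it gives det k =
   (w^3 / N)^2. *)
have hg : 1 / 2 + (c + (w ^+ 2) ^+ 2) / (8 * N * w ^+ 2) * vsq q = w ^+ 4 / N.
  have -> : c = w ^+ 4 - t ^+ 2 by rewrite -wP; ring.
  rewrite hV; have -> : w ^+ 4 / N =
     (N + (2 * w ^+ 4 - t ^+ 2) * (1 - C ^+ 2)) / (2 * N).
    by rewrite {2}hN; field.
  by field; rewrite Nn wn.
have dk : \det k = (w ^+ 3 / N) ^+ 2.
  rewrite /k /kmetric hs /kmat hj det3 !mxE !inordK //=.
  set g := (c + _) / _ in hg *.
  transitivity (2 * w ^+ 2 / N * (1 / 2 * (1 / 2 + g * vsq q))).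
    by rewrite /vsq; move: (N^-1) => n; field.
  by rewrite hg; field.
have kn : k \in unitmx by rewrite unitmxE dk unitfE expf_neq0 // mulf_neq0 ?invr_eq0 // expf_neq0.
split=> //.
  (* As k is invertible, it is enough to multiply the claimed vector by k. *)
  rewrite -[RHS](mulmxK kn); congr (_ *m _).
  rewrite /k /kmetric hs /kmat hj vec3_mx3 /lamv w14.
  set g := (c + _) / _ in hg *.
  have e1 x : x * coord q 1 * (1 / 2 + g * coord q 1 * coord q 1)
      + x * coord q 2 * (g * coord q 1 * coord q 2) = x * (w ^+ 4 / N) * coord q 1.
    by rewrite -hg /vsq; ring.
  have e2 x : x * coord q 1 * (g * coord q 1 * coord q 2)
      + x * coord q 2 * (1 / 2 + g * coord q 2 * coord q 2) = x * (w ^+ 4 / N) * coord q 2.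
    by rewrite -hg /vsq; ring.
  congr vec3; first by field; rewrite wn Nn.
    by rewrite mulr0 add0r e1; field; rewrite wn Nn.
  by rewrite mulr0 add0r e2; field; rewrite wn Nn.
by rewrite dk sqrtr_sqr ger0_norm // divr_ge0 ?exprn_ge0 // ltW.
Qed.

(** The vector field whose contraction with the Euclidean volume form is the dual of lambda_c, up to
    4 pi. That dual is closed when the Euclidean divergence of this field vanishes. *)
Definition hodge_vec c t (C : R) q : 'rV[R]_3 :=
  let s := (c + t ^+ 2) `^ (1 / 2) in
  vec3 (- s * C) (t / (2 * s) * coord q 1) (t / (2 * s) * coord q 2).

Lemma hodge_lam c T Al q x y : 0 <= c -> reg c q ->
  chart c q (T q) (cos (Al q)) ->
  hodge (kmetric c) (lam c T Al) q x y =
  4 * pi * det_rows (hodge_vec c (T q) (cos (Al q)) q) x y.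
Proof.
move=> c0 rq hq; rewrite /hodge lamE // -/(det_rows _ _ _).
have [w [N [[w0 N0 _ _ [w12 _ _ _ _]] e1 ->]]] := lam_kmetric c0 rq hq.
have wn : w != 0 by rewrite gt_eqF.
have Nn : N != 0 by rewrite gt_eqF.
rewrite -scalemxAl e1 !det_rowsE /hodge_vec w12 !coordZ !vec3E //=.
by field; rewrite wn Nn.
Qed.

Lemma knorm_lam c T Al q be : 0 <= c -> reg c q ->
  chart c q (T q) (cos (Al q)) ->
  knorm (kmetric c) (lam c T Al) q = 4 * pi * bolt_size c (T q) (Al q) be.
Proof.
move=> c0 rq hq; have [P0 _ _] := hq; rewrite /knorm lamE // bolt_size_eq //.
have [w [N [[w0 N0 wP w14 [w12 hV hN _ _]] e1 _]]] := lam_kmetric c0 rq hq.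
have wn : w != 0 by rewrite gt_eqF.
have p0 : 0 <= 4 * pi :> R by rewrite mulr_ge0 // pi_ge0.
rewrite -scalemxAl e1 w12.
have -> : 2 * c * cos (Al q) ^+ 2 + T q ^+ 2 * (1 + cos (Al q) ^+ 2) = N.
  by rewrite hN -wP; ring.
set l := lamv _ _ _ _; set v := vec3 _ _ _.
have -> : dot ((4 * pi) *: v) ((4 * pi) *: l) = (4 * pi * (N / w ^+ 2)) ^+ 2.
  rewrite !dot3 !coordZ /v /l /lamv; rewrite w14 !vec3E //=.
  transitivity ((4 * pi) ^+ 2 * (2 * cos (Al q) ^+ 2 * N
      + T q ^+ 2 * N / (4 * w ^+ 6) * vsq q)).
    by rewrite /vsq; field.
  rewrite hV; transitivity ((4 * pi) ^+ 2 * (N / w ^+ 4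
      * (2 * w ^+ 4 * cos (Al q) ^+ 2 + T q ^+ 2 * (1 - cos (Al q) ^+ 2)))).
    by field.
  by rewrite -hN; field.
by rewrite sqrtr_sqr ger0_norm // mulr_ge0 // divr_ge0 ?exprn_ge0 // ltW.
Qed.

(** The norm is 4 pi N / s, and N > 0 at regular points. *)
Lemma lam_neq0 c T Al q : 0 <= c -> reg c q -> chart c q (T q) (cos (Al q)) ->
  lam c T Al q != 0.
Proof.
move=> c0 rq hq; apply/eqP => l0.
have := knorm_lam 0 c0 rq hq; have [P0 _ _] := hq.
rewrite /knorm l0 mul0mx /dot mul0mx mxE sqrtr0 bolt_size_eq //.
have [w [N [w0 N0 wP _ [w12 _ hN _ _]]]] := chart_factsP c0 rq hq.
have -> : 2 * c * cos (Al q) ^+ 2 + T q ^+ 2 * (1 + cos (Al q) ^+ 2) = N.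
  by rewrite hN -wP; ring.
rewrite w12 => /esym/eqP; rewrite gt_eqF //.
by rewrite mulr_gt0 ?divr_gt0 ?exprn_gt0 // mulr_gt0 // pi_gt0.
Qed.

Lemma lam_eq0 c T Al Be q : 0 <= c -> bolt_coords c T Al Be ->
  lam c T Al q = 0 <-> sing c q.
Proof.
move=> c0 /(bolt_coordsP _ _ _ c0) h; split=> [l0|sq].
  apply: contrapT => rq; have [_ hq _] := h q rq.
  by have := lam_neq0 c0 rq hq; rewrite l0 eqxx.
by rewrite /lam asboolF // => rq; exact: rq.
Qed.


End Hodge.

(** * Harmonicity and rotation invariance *)

Section Radial.
Context {R : realType}.
Implicit Types (p q : 'rV[R]_3).

Lemma differentiable_coords (V : normedModType R) (f : V -> 'rV[R]_3) (x : V) L0 L1 L2 :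
  dif (fun y => coord (f y) 0) x L0 -> dif (fun y => coord (f y) 1) x L1 ->
  dif (fun y => coord (f y) 2) x L2 -> differentiable f x.
Proof.
move=> [h0 _] [h1 _] [h2 _].
rewrite (_ : f = (fun y => coord (f y) 0 *: vec3 1 0 0 + coord (f y) 1 *: vec3 0 1 0
   + coord (f y) 2 *: (vec3 0 0 1 : 'rV[R]_3))).
  by apply: differentiableD; [apply: differentiableD|]; exact: differentiableZl.
apply/funext => y; apply/rowP => j; rewrite [in LHS](vec3_coord (f y)) !mxE.
by case: j => -[|[|[|//]]] j3 /=; ring.
Qed.

(* f0 du + f1 (q_1 dq_1 + q_2 dq_2), where f0 and f1 are functions of u and v. *)
Definition radial (f0 f1 : 'rV[R]_3 -> R) p : 'rV[R]_3 :=
  vec3 (f0 p) (f1 p * coord p 1) (f1 p * coord p 2).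

Section Fields.
Variables (f0 f1 : 'rV[R]_3 -> R) (q : 'rV[R]_3) (a0 b0 a1 b1 : R).
Hypothesis df0 : dif f0 q (fun v => a0 * coord v 0 + b0 * dvsq q v).
Hypothesis df1 : dif f1 q (fun v => a1 * coord v 0 + b1 * dvsq q v).

Let L0 v := a0 * coord v 0 + b0 * dvsq q v.
Let Lj j v := (a1 * coord v 0 + b1 * dvsq q v) * coord q j + f1 q * coord v j.

Let dif0 : dif (fun p => coord (radial f0 f1 p) 0) q L0.
Proof. by apply: dif_near df0; near=> p; rewrite vec3E. Unshelve. all: by end_near. Qed.

Let dif1 : dif (fun p => coord (radial f0 f1 p) 1) q (Lj 1).
Proof.
apply: dif_near (difM df1 (dif_coord q 1)).
by near=> p; rewrite vec3E. Unshelve. all: by end_near. Qed.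

Let dif2 : dif (fun p => coord (radial f0 f1 p) 2) q (Lj 2).
Proof.
apply: dif_near (difM df1 (dif_coord q 2)).
by near=> p; rewrite vec3E. Unshelve. all: by end_near. Qed.

(** As d(v^2) = 2 (q_1 dq_1 + q_2 dq_2), the differential is (a1 - 2 b0) du /\ (q_1 dq_1 + q_2
    dq_2); the term with b1 is the wedge of a form with itself. *)
Lemma radial_closed (l : 'rV[R]_3 -> 'rV[R]_3) x y :
  (\forall p \near q, radial f0 f1 p = l p) -> 2 * b0 = a1 ->
  differentiable l q /\ d1 l q x y = 0.
Proof.
move=> hn hb.
have dl j L : dif (fun p => coord (radial f0 f1 p) j) q L ->
    dif (fun p => coord (l p) j) q L.
  by apply: dif_near; apply: filterS hn => p ->.
have l0 := dl _ _ dif0; have l1 := dl _ _ dif1; have l2 := dl _ _ dif2.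
split; first exact: differentiable_coords l0 l1 l2.
have der u v : 'D_u (fun p => dot (l p) v) q =
    L0 u * coord v 0 + Lj 1 u * coord v 1 + Lj 2 u * coord v 2.
  have h := difD (difD (difM l0 (difC q (coord v 0))) (difM l1 (difC q (coord v 1))))
    (difM l2 (difC q (coord v 2))).
  rewrite (_ : (fun p => _) = (fun p => coord (l p) 0 * coord v 0
    + coord (l p) 1 * coord v 1 + coord (l p) 2 * coord v 2)); last first.
    by apply/funext => p; rewrite dot3.
  have [_ /(_ u)[_ ->]] := h; rewrite /=; ring.
by rewrite /d1 !der /L0 /Lj -hb /dvsq; ring.
Qed.

(** The sum in the hypothesis is the divergence of the field (f0, f1 q_1, f1 q_2), and the exterior
    derivative of its contraction with the volume form is that divergence times the volume form. *)
Lemma radial_divergence_free (K : R) om x y z :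
  (\forall p \near q, forall x y, K * det_rows (radial f0 f1 p) x y = om p x y) ->
  a0 + 2 * b1 * vsq q + 2 * f1 q = 0 ->
  differentiable (fun p => om p x y) q /\ d2 om q x y z = 0.
Proof.
move=> hn hdiv.
have h u v : dif (fun p => om p u v) q (fun w => K *
    (L0 w * (coord u 1 * coord v 2 - coord u 2 * coord v 1)
     - Lj 1 w * (coord u 0 * coord v 2 - coord u 2 * coord v 0)
     + Lj 2 w * (coord u 0 * coord v 1 - coord u 1 * coord v 0))).
  have dC a := difC q (a : R).
  have h := difM (dC K) (difD (difB
    (difM dif0 (dC (coord u 1 * coord v 2 - coord u 2 * coord v 1)))
    (difM dif1 (dC (coord u 0 * coord v 2 - coord u 2 * coord v 0))))
    (difM dif2 (dC (coord u 0 * coord v 1 - coord u 1 * coord v 0)))).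
  apply: dif_eq (dif_near _ h) _ => [|w]; last by ring.
  by apply: filterS hn => p <-; rewrite det_rowsE.
split; first by have [] := h x y.
have der u v w : 'D_w (fun p => om p u v) q = _ := let: conj _ h' := h u v in
  @derive_val _ _ _ _ _ _ _ (h' w).
rewrite /d2 !der.
transitivity (K * (a0 + 2 * b1 * vsq q + 2 * f1 q) * det_rows x y z).
  by rewrite det_rowsE /L0 /Lj /dvsq /vsq; ring.
by rewrite hdiv mulr0 mul0r.
Qed.

End Fields.

(** Both [lam] and [hodge_vec] are radial with coefficients depending only on t and cos al. The
    chain rule with [chart_dif] leaves one scalar identity for each: [el] for closedness, [ex] for
    zero divergence. *)
Lemma lam_harmonic c (T Al Be : 'rV[R]_3 -> R) U : 0 <= c ->
  bolt_coords c T Al Be -> coherent c T Al U ->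
  harmonic_on U (kmetric c) (lam c T Al).
Proof.
move=> c0 /(bolt_coordsP _ _ _ c0) hb [oU Ur cT cAl] q Uq.
have rq := Ur _ Uq; have nU : \forall p \near q, U p by exact: open_nbhs_nbhs.
pose C p := cos (Al p).
have cC : C p @[p --> q] --> C q.
  by apply: cts_comp; [exact: continuous_cos|exact: cAl].
have hn : \forall p \near q, chart c p (T p) (C p).
  by apply: filterS nU => p /Ur /hb[].
have [] := chart_dif c0 rq hn (cT q Uq) cC.
have hq := nbhs_singleton hn; have [P0 _ _] := hq.
have [w [_ [w0 _ wP w14 [w12 hV _ _ _]]]] := chart_factsP c0 rq hq.
rewrite w12 -!exprM /=.
set N := _ + _; set Tu := _ * C q / N; set Tv := _ / (4 * N).
set Cu := _ * (1 - _) / N; set Cv := C q * _ / (4 * N) => N0 dT dC.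
have wn : w != 0 by rewrite gt_eqF.
have Nn : N != 0 by rewrite gt_eqF.
have [p14 p12] : (c + T q ^+ 2) `^ (1 / 4 - 1) = w ^- 3
    /\ (c + T q ^+ 2) `^ (1 / 2 - 1) = w ^- 2.
  have [w' [_ _ + _ [e2 _ ->]]] := powR_quarter P0; rewrite w14 => <-.
  split=> //; rewrite (_ : 1 / 2 - 1 = - (1 / 2)); last by field.
  by rewrite powRN w12.
have dP := difD (difC q c) (difM dT dT).
have PE p : c + T p * T p = c + T p ^+ 2 by rewrite expr2.
have dpow a : dif (fun p => (c + T p * T p) `^ a) q
    (fun v => a * (c + T q ^+ 2) `^ (a - 1) * (2 * T q * Tu * coord v 0
                                            + 2 * T q * Tv * dvsq q v)).
  apply: dif_eq (dif_comp (f := fun p => c + T p * T p) (h := fun x => x `^ a) _ dP) _.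
    by rewrite PE; exact: is_derive1_powR.
  by move=> v; rewrite -?PE; ring.
have dw := dpow (1 / 4); have ds := dpow (1 / 2).
have wq : (c + T q * T q) `^ (1 / 4) = w by rewrite PE.
have sq : (c + T q * T q) `^ (1 / 2) = w ^+ 2 by rewrite PE.
have w2 : 2 * (c + T q * T q) `^ (1 / 4) != 0 by rewrite wq mulf_neq0.
have s2 : 2 * (c + T q * T q) `^ (1 / 2) != 0 by rewrite sq mulf_neq0 // expf_neq0.
(* Derivatives of the four coefficients in a direction in which t and cos al have derivatives u and
   k: [lu] and [lt] for lambda_c, [xu] and [xt] for its dual. *)
pose lu (u k : R) := 4 * pi * (- 2) * (w ^- 3 * T q * u / 2 * C q + w * k).
pose lt (u : R) := 4 * pi * (u / (2 * w) - T q * (w ^- 3 * T q * u / 2) / (2 * w ^+ 2)).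
pose xu (u k : R) := - (w ^- 2 * T q * u * C q + w ^+ 2 * k).
pose xt (u : R) := u / (2 * w ^+ 2) - T q * (w ^- 2 * T q * u) / (2 * w ^+ 4).
have h0 : dif (fun y => 4 * pi * (- 2 * (c + T y * T y) `^ (1 / 4) * C y)) q
    (fun v => lu Tu Cu * coord v 0 + lu Tv (- Cv) * dvsq q v).
  apply: dif_eq (difM (difC q (4 * pi)) (difM (difM (difC q (- 2)) dw) dC)) _ => v.
  by rewrite -?PE wq ?PE p14 /lu; field.
have h1 : dif (fun y => 4 * pi * (T y / (2 * (c + T y * T y) `^ (1 / 4)))) q
    (fun v => lt Tu * coord v 0 + lt Tv * dvsq q v).
  apply: dif_eq (difM (difC q (4 * pi)) (difM dT
    (difV (f := fun y => 2 * (c + T y * T y) `^ (1 / 4)) w2 (difM (difC q 2) dw)))) _ => v.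
  by rewrite -?PE wq ?PE p14 /lt; field.
have h2 : dif (fun y => - (c + T y * T y) `^ (1 / 2) * C y) q
    (fun v => xu Tu Cu * coord v 0 + xu Tv (- Cv) * dvsq q v).
  apply: dif_eq (difM (difN ds) dC) _ => v.
  by rewrite -?PE sq ?PE p12 /xu; field.
have h3 : dif (fun y => T y / (2 * (c + T y * T y) `^ (1 / 2))) q
    (fun v => xt Tu * coord v 0 + xt Tv * dvsq q v).
  apply: dif_eq (difM dT
    (difV (f := fun y => 2 * (c + T y * T y) `^ (1 / 2)) s2 (difM (difC q 2) ds))) _ => v.
  by rewrite -?PE sq ?PE p12 /xt; field.
have hlam : \forall p \near q, radial
    (fun y => 4 * pi * (- 2 * (c + T y * T y) `^ (1 / 4) * C y))
    (fun y => 4 * pi * (T y / (2 * (c + T y * T y) `^ (1 / 4)))) p = lam c T Al p.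
  apply: filterS nU => p /Ur rp; rewrite lamE // /lamv /radial PE /C.
  by apply/rowP => j; rewrite !mxE; case: j => -[|[|[|//]]] j3 /=; ring.
have hhodge : \forall p \near q, forall x y, 4 * pi * det_rows (radial
    (fun y => - (c + T y * T y) `^ (1 / 2) * C y)
    (fun y => T y / (2 * (c + T y * T y) `^ (1 / 2))) p) x y =
    hodge (kmetric c) (lam c T Al) p x y.
  apply: filterS nU => p /Ur rp x y.
  by have [_ hp _] := hb p rp; rewrite hodge_lam // /hodge_vec /radial PE.
have el : 2 * lu Tv (- Cv) = lt Tu.
  by rewrite /lu /lt /Tv /Cv /Tu; move: Nn; rewrite /N => Nn'; field; rewrite wn Nn'.
have ex : xu Tu Cu + 2 * xt Tv * vsq q + 2 * (T q / (2 * (c + T q * T q) `^ (1 / 2))) = 0.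
  rewrite sq hV /xu /xt /Tu /Tv /Cu; move: Nn; rewrite /N => Nn'; field.
  by rewrite wn Nn'.
have cl x y := radial_closed h0 h1 x y hlam el.
have dv x y z := radial_divergence_free h2 h3 x y z hhodge ex.
split; [by have [] := cl 0 0|by move=> x y; have [] := cl x y
  |by move=> x y; have [] := dv x y 0|by move=> x y z; have [] := dv x y z].
Qed.

End Radial.

(** * Invariance under rotations in be *)

Section Rotation.
Context {R : realType}.
Implicit Types (p q : 'rV[R]_3).

Lemma chart_rot c q ps (t C : R) : chart c (rot ps q) t C <-> chart c q t C.
Proof. by rewrite /chart; have [-> _ _ ->] := rot_coords ps q. Qed.

Lemma chart_not_both_zero c q (t C : R) : 0 <= c -> reg c q -> chart c q t C ->
  0 < t ^+ 2 + C ^+ 2.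
Proof.
move=> c0 rq [_ hu hV]; rewrite lt_neqAle addr_ge0 ?sqr_ge0 // andbT eq_sym.
rewrite paddr_eq0 ?sqr_ge0 // !sqrf_eq0; apply/negP => /andP[/eqP t0 /eqP C0].
apply: ((regP _ c0).1 rq).
by rewrite -hu -hV t0 C0 mul0r expr0n /= addr0 subr0 mulr1.
Qed.

Lemma rot_continuous q (ps : R) : rot x q @[x --> ps] --> rot ps q.
Proof.
have hid : is_derive ps 1 (fun s : R => s) 1 by exact: is_derive_id.
have hC a := derC ps (1 : R) (a : R).
have hc := der_cos hid; have hs := der_sin hid.
have [h _] := is_derive_vec3 (hC (coord q 0))
  (derB (derM hc (hC (coord q 1))) (derM hs (hC (coord q 2))))
  (derD (derM hs (hC (coord q 1))) (derM hc (hC (coord q 2)))).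
by have := differentiable_continuous ((derivable1_diffP _ _).1 h).
Qed.

(* (T, C) is constant up to sign on an orbit, and the sign is continuous. *)
Lemma coords_rot c (T C : 'rV[R]_3 -> R) U q ps : 0 <= c -> U `<=` reg c ->
  (forall p, U p -> chart c p (T p) (C p)) ->
  (forall p, U p -> {for p, continuous T}) ->
  (forall p, U p -> {for p, continuous C}) ->
  rot_stable U -> U q -> T (rot ps q) = T q /\ C (rot ps q) = C q.
Proof.
move=> c0 Ur hch cT cC stU Uq.
(* Always plus or minus T q ^+ 2 + C q ^+ 2, which is positive; a change of sign along the orbit
   would force a zero. *)
pose f x := T (rot x q) * T q + C (rot x q) * C q.
have m0 := chart_not_both_zero c0 (Ur _ Uq) (hch _ Uq).
have Urot x : U (rot x q) by exact: stU.
have hpm x : (T (rot x q) = T q /\ C (rot x q) = C q) \/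
    (T (rot x q) = - T q /\ C (rot x q) = - C q).
  by apply: chart_unique c0 (hch _ Uq) _; apply/(chart_rot _ _ x)/hch.
have fN0 x : f x != 0.
  rewrite /f; have [[-> ->]|[-> ->]] := hpm x; rewrite ?mulNr -?opprD ?oppr_eq0;
    by rewrite -!expr2 gt_eqF.
have cf : continuous f.
  have comp (g : 'rV[R]_3 -> R) x : {for rot x q, continuous g} ->
      g (rot y q) @[y --> x] --> g (rot x q).
    by move=> hg; apply: (cvg_comp _ _ (@rot_continuous q x)); exact: hg.
  move=> x; apply: ctsD; apply: ctsM; try exact: ctsC.
    by apply: comp; exact: cT.
  by apply: comp; exact: cC.
have f0 : 0 < f 0.
  have r0 : rot 0 q = q.
    rewrite [RHS]vec3_coord /rot sin0 cos0; congr vec3; ring.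
  by rewrite /f r0 -!expr2.
have fpos x : 0 < f x.
  rewrite lt_neqAle eq_sym fN0 leNgt; apply/negP => fx.
  have [z _ fz] : exists2 z, z \in `[Num.min 0 x, Num.max 0 x] & f z = 0.
    apply: IVT; first by rewrite ge_min le_max lexx.
      exact: continuous_subspaceT.
    by case: (leP 0 x) => _; rewrite ge_min le_max !(ltW f0, ltW fx) ?orbT.
  by have := fN0 z; rewrite fz eqxx.
have [//|[h1 h2]] := hpm ps.
by have := fpos ps; rewrite /f h1 h2 !mulNr -opprD oppr_gt0 -!expr2 ltNge (ltW m0).
Qed.

Lemma lam_rot_invariant c (T Al Be : 'rV[R]_3 -> R) U : 0 <= c ->
  bolt_coords c T Al Be -> coherent c T Al U -> rot_stable U ->
  rot_invariant_on U (lam c T Al).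
Proof.
move=> c0 /(bolt_coordsP _ _ _ c0) hb [_ Ur cT cAl] stU ps q w Uq.
have [hT hC] : T (rot ps q) = T q /\ cos (Al (rot ps q)) = cos (Al q).
  apply: (coords_rot (C := fun p => cos (Al p)) ps c0 Ur _ cT _ stU Uq).
    by move=> p /Ur /hb[].
  move=> p Up; apply: cts_comp; first exact: continuous_cos.
  exact: cAl.
rewrite !lamE ?hT ?hC; [|exact: Ur|exact/Ur/stU].
rewrite /lamv !dot3 !coordZ !vec3E //=.
by ring: (cos2E ps).
Qed.

End Rotation.

Theorem proposition5p15 (R : realType) (c : R) (hc : 0 <= c) :
  exists k : 'rV[R]_3 -> 'M[R]_3,
  is_pushforward_metric c k /\
  exists K : R, 0 < K /\
  (forall q0, reg c q0 -> exists T Al Be U,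
     [/\ bolt_coords c T Al Be, coherent c T Al U, rot_stable U & U q0]) /\
  (c = 0 -> exists T Al Be, bolt_coords c T Al Be /\ coherent c T Al (reg c)) /\
  forall T Al Be : 'rV[R]_3 -> R, bolt_coords c T Al Be ->
  exists lam : 'rV[R]_3 -> 'rV[R]_3,
  [/\ is_pushforward_form c T Al Be lam,
      (forall U, coherent c T Al U ->
         harmonic_on U k lam /\ (rot_stable U -> rot_invariant_on U lam)),
      (forall q, reg c q ->
         knorm k lam q = K * bolt_size c (T q) (Al q) (Be q) /\
         bolt_size c (T q) (Al q) (Be q) =
           (2 * c * cos (Al q) ^+ 2 + T q ^+ 2 * (1 + cos (Al q) ^+ 2))
           / (c + T q ^+ 2) `^ (1 / 2)),
      (0 < c -> forall q, lam q = 0 <-> circle c q)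
    & (c = 0 -> forall q, lam q = 0 <-> q = 0)].
Proof.
exists (kmetric c); split; first exact: kmetric_pushforward.
(* The area of the unit sphere, by which the bolt size is divided while the fibre integral is
   not. *)
exists (4 * pi); split; first by rewrite mulr_gt0 // pi_gt0.
split; first exact: coords_exist.
split; first exact: coords_exist_cone.
move=> T Al Be hT; exists (lam c T Al); have hch := (bolt_coordsP T Al Be hc).1 hT.
split.
- exact: lam_pushforward.
- move=> U hU; split; first exact: lam_harmonic hc hT hU.
  exact: lam_rot_invariant hc hT hU.
- move=> q rq; have [_ hq _] := hch q rq.
  split; first exact: knorm_lam.
  by apply: bolt_size_eq; case: hq.
- move=> cp q; rewrite (lam_eq0 q hc hT); split=> [[[]//|[c0 _]]|h]; last by left.
  by move: cp; rewrite c0 ltxx.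
- move=> c0 q; rewrite (lam_eq0 q hc hT); split=> [[[cp _]|[]//]|h]; last by right.
  by move: cp; rewrite c0 ltxx.
Qed.
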